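(* Let $p$ be an odd prime, $M=\mathbb Q_p\times\mathbb R$, $\mathcal H=L^2(M)$, $\alpha_0\in\mathbb R^\times$, $y_\alpha\in\mathbb Q_p^\times$. For each $A\in\mathrm{SL}_2(\mathbb Z[1/p])$ choose any word $A=A_1A_2\cdots A_k$ with each $A_i\in\{J,L_1,D,J^{-1},L_1^{-1},D^{-1}\}$, and let $S_A=S_{A_1}S_{A_2}\cdots S_{A_k}$ be the corresponding unitary on $\mathcal H$. Then the projective class $[S_A]\in PU(\mathcal H)$ is independent of the chosen word, and $$\pi:\mathrm{SL}_2(\mathbb Z[1/p])\to PU(\mathcal H),\qquad \pi(A)=[S_A],$$ is a group homomorphism. Moreover, for every $A\in\mathrm{SL}_2(\mathbb Z[1/p])$ and every $z\in M\times M$, $S_A\,\mathcal W(z)\,S_A^{-1}=\mathcal W(Az)$.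
   Context: $e(t)=e^{2\pi it}$ for $t\in\mathbb R$; $e_p(x)=e^{2\pi i\{x\}_p}$ for $x\in\mathbb Q_p$, where $\{x\}_p\in\mathbb Z[1/p]$ is the $p$-adic fractional part. $\chi(t,\xi)=e_p(t_1\xi_1y_\alpha)\,e(t_2\xi_2/\alpha_0)$ for $t=(t_1,t_2),\xi=(\xi_1,\xi_2)\in M$; the Haar measure on $M$ is normalised to be self-dual with respect to the bicharacter $\chi$. Weyl operators: for $x,\xi\in M$, $\mathcal W(x,\xi)$ is the unitary on $\mathcal H$ given by $(\mathcal W(x,\xi)f)(t)=\chi(t-\tfrac x2,\xi)f(t-x)$. $J=\begin{pmatrix}0&1\\-1&0\end{pmatrix}$, $L_1=\begin{pmatrix}1&0\\1&1\end{pmatrix}$, $D=\begin{pmatrix}p&0\\0&1/p\end{pmatrix}$; these generate $\mathrm{SL}_2(\mathbb Z[1/p])$. A matrix $\begin{pmatrix}a&b\\c&d\end{pmatrix}$ acts on $M\times M$ by $(x,\xi)\mapsto(ax+b\xi,cx+d\xi)$. Unitaries on $\mathcal H$ (defined on the Bruhat–Schwartz space $\mathcal S(M)$ and extended): $(S_Jf)(t)=\int_M\overline{\chi(h,t)}f(h)\,dh$; $(S_{L_1}f)(t)=\chi(t,\tfrac12t)f(t)$; $(S_Df)(t_1,t_2)=f(t_1/p,t_2/p)$; and $S_{X^{-1}}=S_X^{-1}$ for $X\in\{J,L_1,D\}$. $PU(\mathcal H)=U(\mathcal H)/\mathbb TI$ is the projective unitary group and $[U]$ the class of $U$. *)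

(* Defs.v *)
From HB Require Import structures.
From mathcomp Require Import all_boot all_order all_algebra.
From mathcomp Require Import all_classical all_reals all_analysis.
From mathcomp Require Import complex.

Set Implicit Arguments.
Unset Strict Implicit.
Unset Printing Implicit Defensive.

Import Order.TTheory GRing.Theory Num.Theory.
Import numFieldNormedType.Exports.

Local Open Scope classical_set_scope.
Local Open Scope ring_scope.

(* Z_p as the inverse limit of the rings Z/p^n: an element is the compatible *)
(* sequence of its least residues.  The type carries the proof of primality  *)
(* so that it is canonically an integral domain.                             *)

Record padic_int (p : nat) (p_pr : prime p) := PadicInt {
  residue :> nat -> nat;
  residueE : forall n, residue n = (residue n.+1 %% p ^ n)%N
}.

Section PadicInt.
Context (p : nat) (p_pr : prime p).
Local Notation Zp := (padic_int p_pr).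
Implicit Types x y z : Zp.

HB.instance Definition _ := gen_eqMixin Zp.
HB.instance Definition _ := gen_choiceMixin Zp.

Lemma padic_intP x y : x =1 y -> x = y.
Proof.
case: x y => [x xE] [y yE] /= /funext xy; move: xE yE; rewrite xy => xE yE.
by congr PadicInt; exact: Prop_irrelevance.
Qed.

Lemma residue_mod x n : (x n %% p ^ n)%N = x n.
Proof. by rewrite residueE modn_mod. Qed.

Lemma modn_expS (a n : nat) : (a %% p ^ n.+1 %% p ^ n)%N = (a %% p ^ n)%N.
Proof. by rewrite modn_dvdm// expnS dvdn_mull. Qed.

Lemma residue_nat_subproof (a : nat) n :
  (a %% p ^ n)%N = (a %% p ^ n.+1 %% p ^ n)%N.
Proof. by rewrite modn_expS. Qed.
Definition padic_nat (a : nat) : Zp := PadicInt p_pr (residue_nat_subproof a).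

Lemma residue_add_subproof x y n :
  ((x n + y n) %% p ^ n)%N = ((x n.+1 + y n.+1) %% p ^ n.+1 %% p ^ n)%N.
Proof. by rewrite modn_expS (residueE x) (residueE y) modnDm. Qed.
Definition padic_add x y : Zp := PadicInt p_pr (residue_add_subproof x y).

Lemma residue_mul_subproof x y n :
  ((x n * y n) %% p ^ n)%N = ((x n.+1 * y n.+1) %% p ^ n.+1 %% p ^ n)%N.
Proof. by rewrite modn_expS (residueE x) (residueE y) modnMm. Qed.
Definition padic_mul x y : Zp := PadicInt p_pr (residue_mul_subproof x y).

Lemma residue_le x n : (x n <= p ^ n)%N.
Proof. by rewrite -residue_mod ltnW// ltn_mod expn_gt0 prime_gt0. Qed.

Lemma residue_opp_subproof x n : ((p ^ n - x n) %% p ^ n)%N =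
  ((p ^ n.+1 - x n.+1) %% p ^ n.+1 %% p ^ n)%N.
Proof.
rewrite modn_expS; apply/eqP.
rewrite -(eqn_modDr (x n.+1)) subnK ?residue_le// -modnDmr -residueE.
by rewrite subnK ?residue_le// modnn expnS modnMl.
Qed.
Definition padic_opp x : Zp := PadicInt p_pr (residue_opp_subproof x).

Lemma padic_addA : associative padic_add.
Proof. by move=> x y z; apply: padic_intP => n /=; rewrite modnDml modnDmr addnA. Qed.
Lemma padic_addC : commutative padic_add.
Proof. by move=> x y; apply: padic_intP => n /=; rewrite addnC. Qed.
Lemma padic_add0 : left_id (padic_nat 0) padic_add.
Proof. by move=> x; apply: padic_intP => n /=; rewrite modnDml add0n residue_mod. Qed.
Lemma padic_addN : left_inverse (padic_nat 0) padic_opp padic_add.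
Proof.
by move=> x; apply: padic_intP => n /=; rewrite modnDml subnK ?residue_le// modnn mod0n.
Qed.
HB.instance Definition _ :=
  GRing.isZmodule.Build Zp padic_addA padic_addC padic_add0 padic_addN.

Lemma padic_mulA : associative padic_mul.
Proof. by move=> x y z; apply: padic_intP => n /=; rewrite modnMml modnMmr mulnA. Qed.
Lemma padic_mulC : commutative padic_mul.
Proof. by move=> x y; apply: padic_intP => n /=; rewrite mulnC. Qed.
Lemma padic_mul1 : left_id (padic_nat 1) padic_mul.
Proof. by move=> x; apply: padic_intP => n /=; rewrite modnMml mul1n residue_mod. Qed.
Lemma padic_mulDl : left_distributive padic_mul padic_add.
Proof.
by move=> x y z; apply: padic_intP => n /=; rewrite modnMml modnDm mulnDl.
Qed.
Lemma padic_1neq0 : padic_nat 1 != 0.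
Proof.
apply/eqP => /(congr1 (fun x : Zp => x 1%N)) /=.
by rewrite expn1 mod0n modn_small ?prime_gt1.
Qed.
HB.instance Definition _ := GRing.Zmodule_isComNzRing.Build Zp
  padic_mulA padic_mulC padic_mul1 padic_mulDl padic_1neq0.

Definition padic_unit : {pred Zp} := [pred x | `[< exists y, y * x = 1 >]].
Definition padic_inv x : Zp :=
  if x \in padic_unit then xget x [set y | y * x = 1] else x.

Lemma padic_mulVx : {in padic_unit, left_inverse 1 padic_inv *%R}.
Proof.
move=> x xu; have /asboolP[y yx] := xu; rewrite /padic_inv xu.
exact: (@xgetPex _ x [set z | z * x = 1] (ex_intro _ y yx)).
Qed.
Lemma padic_unitPl x y : y * x = 1 -> padic_unit x.
Proof. by move=> yx; apply/asboolP; exists y. Qed.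
Lemma padic_inv_out : {in [predC padic_unit], padic_inv =1 id}.
Proof. by move=> x; rewrite inE /padic_inv => /negbTE ->. Qed.
HB.instance Definition _ := GRing.ComNzRing_hasMulInverse.Build Zp
  padic_mulVx padic_unitPl padic_inv_out.

Lemma residueD x m n : x m = (x (m + n) %% p ^ m)%N.
Proof.
elim: n => [|n IH]; first by rewrite addn0 residue_mod.
by rewrite IH addnS (residueE x (m + n)) modn_dvdm// dvdn_exp2l// leq_addr.
Qed.

Lemma padic_neq0 x : x <> 0 -> exists n, forall m, ~~ (p ^ n %| x (n + m))%N.
Proof.
move=> x0; apply: contrapT => /forallNP nx; apply: x0; apply: padic_intP => n.
have /existsNP[m /negP/negPn] := nx n.
by rewrite /dvdn -residueD => /eqP ->; rewrite [RHS]mod0n.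
Qed.

Lemma padic_mulf_eq0 : forall x y, x * y = 0 -> (x == 0) || (y == 0).
Proof.
move=> x y xy0; have [//|x0] := eqVneq x 0; have [//|y0] /= := eqVneq y 0.
have [a xa] := padic_neq0 (elimN eqP x0).
have [b yb] := padic_neq0 (elimN eqP y0).
have {xa} := xa b; have {yb} := yb a; rewrite [(b + a)%N]addnC => yb xa.
have /(congr1 (fun z : Zp => z (a + b)%N)) /= := xy0.
rewrite mod0n => /eqP; rewrite -/(dvdn _ _).
have xp : (0 < x (a + b)%N)%N by case: (x _) xa => //; rewrite dvdn0.
have yp : (0 < y (a + b)%N)%N by case: (y _) yb => //; rewrite dvdn0.
move: xa yb; rewrite !pfactor_dvdn ?muln_gt0 ?xp// lognM// -!ltnNge => xa yb.
by rewrite leqNgt -addSn leq_add// ltnW.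
Qed.
HB.instance Definition _ := GRing.ComUnitRing_isIntegral.Build Zp padic_mulf_eq0.

End PadicInt.

Definition padic (p : nat) (p_pr : prime p) := {fraction padic_int p_pr}.

Section Padic.
Context (p : nat) (p_pr : prime p).
Local Notation Qp := (padic p_pr).

HB.instance Definition _ := GRing.Field.on Qp.
HB.instance Definition _ := isPointed.Build Qp 0.

Definition is_padic_int (x : Qp) := exists z : padic_int p_pr, x = tofrac z.

Definition padic_ball (a : Qp) (n : nat) : set Qp :=
  [set x | exists z : padic_int p_pr, x = a + p%:R ^+ n * tofrac z].

Lemma padic_ball_center a n : padic_ball a n a.
Proof. by exists 0; rewrite tofrac0 mulr0 addr0. Qed.

Lemma padic_ball_sub a t m n : padic_ball a m t -> (m <= n)%N ->
  padic_ball t n `<=` padic_ball a m.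
Proof.
move=> [z ->] mn x [w ->]; exists (z + p%:R ^+ (n - m) * w).
rewrite tofracD tofracM tofracXn rmorph_nat mulrDr mulrA -exprD subnKC//.
by rewrite addrA.
Qed.

Lemma padic_ball_cover :
  \bigcup_(i in [set: Qp * nat]) padic_ball i.1 i.2 = setT.
Proof.
by apply/seteqP; split=> // x _; exists (x, 0%N) => //; exact: padic_ball_center.
Qed.

Lemma padic_ball_join (i j : Qp * nat) t : [set: Qp * nat] i ->
    [set: Qp * nat] j -> padic_ball i.1 i.2 t -> padic_ball j.1 j.2 t ->
  exists k : Qp * nat, [/\ [set: Qp * nat] k, padic_ball k.1 k.2 t &
    padic_ball k.1 k.2 `<=` padic_ball i.1 i.2 `&` padic_ball j.1 j.2].
Proof.
move=> _ _ it jt; exists (t, maxn i.2 j.2); split => //=.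
  exact: padic_ball_center.
by rewrite subsetI; split; apply: padic_ball_sub => //;
  rewrite ?leq_maxl ?leq_maxr.
Qed.

(* The p-adic topology: the balls a + p^n Z_p form a basis. *)
HB.instance Definition _ := isBaseTopological.Build Qp
  padic_ball_cover padic_ball_join.

HB.instance Definition _ := @isMeasurable.Build default_measure_display Qp
  <<s open >>
  (@sigma_algebra0 _ setT open) (@sigma_algebraC _ open)
  (@sigma_algebra_bigcup _ setT open).

End Padic.

Definition Zinv (p : nat) : {pred rat} :=
  [pred x | `[< exists n, x * p%:R ^+ n \is a Num.int >]].

Section Zinv.
Context (p : nat).

Lemma Zinv_subring : subring_closed (Zinv p).
Proof.
split => [|x y /asboolP[m xm] /asboolP[n yn]|x y /asboolP[m xm] /asboolP[n yn]].
- by apply/asboolP; exists 0%N; rewrite expr0 mulr1.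
- apply/asboolP; exists (m + n)%N; rewrite mulrBl {1}exprD addnC exprD !mulrA.
  by rewrite rpredB// rpredM ?rpredX ?rpred_nat.
- by apply/asboolP; exists (m + n)%N; rewrite exprD mulrACA rpredM.
Qed.
HB.instance Definition _ := GRing.isSubringClosed.Build rat (Zinv p) Zinv_subring.

Record SL2 := MkSL2 {
  sl2_mx :> 'M[rat]_2;
  sl2P : (sl2_mx \is a mxOver (Zinv p)) && (\det sl2_mx == 1)
}.
HB.instance Definition _ := [isSub for sl2_mx].
HB.instance Definition _ := [Choice of SL2 by <:].

Implicit Types A B C : SL2.

Lemma sl2_one_subproof :
  ((1%:M : 'M[rat]_2) \is a mxOver (Zinv p)) && (\det (1%:M : 'M[rat]_2) == 1).
Proof. by rewrite det1 eqxx andbT; apply: mxOver_scalar; rewrite ?rpred0 ?rpred1. Qed.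
Definition sl2_one := MkSL2 sl2_one_subproof.

Lemma sl2_mul_subproof A B :
  (A *m B \is a mxOver (Zinv p)) && (\det (A *m B) == 1).
Proof.
have /andP[AZ /eqP dA] := sl2P A; have /andP[BZ /eqP dB] := sl2P B.
by rewrite det_mulmx dA dB mulr1 eqxx andbT mxOverM.
Qed.
Definition sl2_mul A B := MkSL2 (sl2_mul_subproof A B).

Lemma sl2_inv_subproof A :
  (\adj A \is a mxOver (Zinv p)) && (\det (\adj A) == 1).
Proof.
have /andP[/mxOverP AZ /eqP dA] := sl2P A; apply/andP; split.
  apply/mxOverP => i j; rewrite mxE /cofactor rpredM ?rpredX ?rpredN ?rpred1//.
  apply: rpred_sum => s _; rewrite rpredM ?rpredX ?rpredN ?rpred1//.
  by apply: rpred_prod => k _; rewrite !mxE.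
by have := congr1 determinant (mul_mx_adj A); rewrite det_mulmx dA mul1r det1 => ->.
Qed.
Definition sl2_inv A := MkSL2 (sl2_inv_subproof A).

Lemma sl2_mulA : associative sl2_mul.
Proof. by move=> A B C; apply: val_inj; exact: mulmxA. Qed.
Lemma sl2_mul1 : left_id sl2_one sl2_mul.
Proof. by move=> A; apply: val_inj; exact: mul1mx. Qed.
Lemma sl2_1mul : right_id sl2_one sl2_mul.
Proof. by move=> A; apply: val_inj; exact: mulmx1. Qed.
Lemma sl2_mulV : left_inverse sl2_one sl2_inv sl2_mul.
Proof.
move=> A; apply: val_inj => /=; have /andP[_ /eqP dA] := sl2P A.
by rewrite mul_adj_mx dA.
Qed.
Lemma sl2_Vmul : right_inverse sl2_one sl2_inv sl2_mul.
Proof.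
move=> A; apply: val_inj => /=; have /andP[_ /eqP dA] := sl2P A.
by rewrite mul_mx_adj dA.
Qed.
HB.instance Definition _ :=
  isGroup.Build SL2 sl2_mulA sl2_mul1 sl2_1mul sl2_mulV sl2_Vmul.

End Zinv.

Definition mx22 (K : Type) (a b c d : K) : 'M[K]_2 :=
  \matrix_(i, j) (if i == 0 then if j == 0 then a else b
                  else if j == 0 then c else d).

Lemma det_mx22 (K : comNzRingType) (a b c d : K) :
  \det (mx22 a b c d) = a * d - b * c.
Proof.
rewrite (expand_det_row _ ord0) !big_ord_recl big_ord0 addr0.
rewrite /cofactor !det_mx11 !mxE/= expr0 mul1r expr1 mulN1r mulrN.
by [].
Qed.

Lemma mx22_over (p : nat) (a b c d : rat) : a \in Zinv p -> b \in Zinv p ->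
  c \in Zinv p -> d \in Zinv p -> mx22 a b c d \is a mxOver (Zinv p).
Proof. by move=> *; apply/mxOverP => i j; rewrite mxE; do 2 case: ifP. Qed.


Variant generator := genJ | genL | genD.

(* The letter (g, b) stands for g^-1 if b is true and for g otherwise. *)
Definition word := seq (generator * bool).

Definition word_eval (G : groupType) (g : generator -> G) (w : word) : G :=
  (\prod_(l <- w) (if l.2 then (g l.1)^-1 else g l.1))%g.

Section Generators.
Context (p : nat) (p_pr : prime p).

Definition gen_mx (g : generator) : 'M[rat]_2 :=
  match g with
  | genJ => mx22 0 1 (-1) 0
  | genL => mx22 1 0 1 1
  | genD => mx22 p%:R 0 0 p%:R^-1
  end.

Lemma gen_mxP g : (gen_mx g \is a mxOver (Zinv p)) && (\det (gen_mx g) == 1).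
Proof.
have p0 : (p%:R : rat) != 0 by rewrite pnatr_eq0 -lt0n prime_gt0.
have pV : p%:R^-1 \in Zinv p.
  by apply/asboolP; exists 1%N; rewrite expr1 mulVf.
case: g; rewrite det_mx22 mx22_over ?rpredN ?rpred0 ?rpred1 ?rpred_nat//.
by rewrite mulfV// mul0r subr0.
Qed.
Definition gen_sl2 (g : generator) : SL2 p := MkSL2 (gen_mxP g).

End Generators.

Definition Cintegral d (T : measurableType d) (R : realType)
    (mu : {measure set T -> \bar R}) (f : T -> R[i]) : R[i] :=
  Complex (\int[mu]_x complex.Re (f x)) (\int[mu]_x complex.Im (f x)).

Section L2.
Context d (T : measurableType d) (R : realType).
Variable mu : {measure set T -> \bar R}.

Definition L2pred : {pred T -> R[i]} :=
  [pred f : T -> R[i] | ((fun x => complex.Re (f x)) \in Lfun mu 2%:E) &&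
                        ((fun x => complex.Im (f x)) \in Lfun mu 2%:E)].

Lemma L2pred_submod : submod_closed L2pred.
Proof.
have L2lin (a b : R) (f g : T -> R) : f \in Lfun mu 2%:E -> g \in Lfun mu 2%:E ->
    a *: f + b *: g \in Lfun mu 2%:E.
  move=> fL gL; have [L0 cl] := Lfun_submod_closed mu (lee1n 2).
  have bgL : b *: g \in Lfun mu 2%:E by have := cl b g 0 gL L0; rewrite addr0.
  exact: (cl a f (b *: g) fL bgL).
split.
  have L0 : (cst 0 : T -> R) \in Lfun mu 2%:E.
    by have [] := Lfun_submod_closed mu (lee1n 2).
  by apply/andP; split.
move=> [a b] f g /andP[fr fi] /andP[gr gi].
have eqL (h k : T -> R) : h \in Lfun mu 2%:E -> h =1 k -> k \in Lfun mu 2%:E.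
  by move=> hL /funext <-.
apply/andP; split.
  apply: (eqL _ _ (L2lin 1 1 _ _ (L2lin a (- b) _ _ fr fi) gr)) => x.
  rewrite !scale1r !fctE /=.
  by case: (f x) (g x) => [u v] [w z] /=; rewrite scaleNr.
apply: (eqL _ _ (L2lin 1 1 _ _ (L2lin b a _ _ fr fi) gi)) => x.
rewrite !scale1r !fctE /=.
by case: (f x) (g x) => [u v] [w z] /=; rewrite [in RHS](addrC (a * v)).
Qed.
HB.instance Definition _ :=
  GRing.isSubmodClosed.Build R[i] (T -> R[i]) L2pred L2pred_submod.

Record L2fun := MkL2fun { L2fun_val :> T -> R[i]; _ : L2fun_val \in L2pred }.
HB.instance Definition _ := [isSub for L2fun_val].
HB.instance Definition _ := [Choice of L2fun by <:].
HB.instance Definition _ := [SubChoice_isSubLmodule of L2fun by <:].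

Definition L2null : {pred L2fun} := [pred f : L2fun |
  `[< {ae mu, forall x, f x = 0} >]].

Lemma L2null_submod : submod_closed L2null.
Proof.
split; first by apply/asboolP; exact: aeW.
move=> a f g /asboolP f0 /asboolP g0; apply/asboolP.
apply: filterS2 f0 g0 => x fx gx.
have -> : (a *: f + g : L2fun) x = a * f x + g x by [].
by rewrite fx gx mulr0 addr0.
Qed.
HB.instance Definition _ :=
  GRing.isSubmodClosed.Build R[i] L2fun L2null L2null_submod.

Definition L2 := Quotient.quot L2null.
HB.instance Definition _ := GRing.Zmodule.on L2.
HB.instance Definition _ := EqQuotient.on L2.

Definition L2pi (f : L2fun) : L2 := (\pi_L2 f)%qT.

(* The junk value is 0 when f is not square-integrable. *)
Definition L2class (f : T -> R[i]) : L2 := L2pi (insubd 0 f).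

Definition L2scale (a : R[i]) (F : L2) : L2 := L2pi (a *: repr F).

Lemma L2piP (f g : L2fun) : L2pi f = L2pi g <-> f - g \in L2null.
Proof. by rewrite Quotient.idealrBE; split => [/eqP|/eqP]. Qed.

Lemma L2piK (F : L2) : L2pi (repr F) = F.
Proof. exact: reprK. Qed.

Lemma L2piD f g : L2pi (f + g) = L2pi f + L2pi g.
Proof. exact: Quotient.pi_add. Qed.

Lemma L2piZ a f : L2scale a (L2pi f) = L2pi (a *: f).
Proof.
apply/L2piP; rewrite -scalerBr rpredZ//; apply/L2piP; exact: L2piK.
Qed.

Lemma L2scaleA a b F : L2scale a (L2scale b F) = L2scale (a * b) F.
Proof. by rewrite -[F]L2piK !L2piZ scalerA. Qed.
Lemma L2scale1 : left_id 1 L2scale.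
Proof. by move=> F; rewrite -[F]L2piK L2piZ scale1r. Qed.
Lemma L2scaleDr : right_distributive L2scale +%R.
Proof.
by move=> a F G; rewrite -[F]L2piK -[G]L2piK -L2piD !L2piZ scalerDr L2piD.
Qed.
Lemma L2scaleDl F : {morph L2scale^~ F : a b / a + b}.
Proof. by move=> a b; rewrite -[F]L2piK !L2piZ scalerDl L2piD. Qed.
HB.instance Definition _ := GRing.Zmodule_isLmodule.Build R[i] L2
  L2scaleA L2scale1 L2scaleDr L2scaleDl.

Definition L2dot (F G : L2) : R[i] :=
  Cintegral mu (fun x => L2fun_val (repr F) x * (L2fun_val (repr G) x)^* ).

Definition is_unitary (U : L2 -> L2) : Prop :=
  [/\ linear U, bijective U & forall F G, L2dot (U F) (U G) = L2dot F G].

Record unitary := MkUnitary { unitary_fun :> L2 -> L2;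
                              unitaryP : is_unitary unitary_fun }.
HB.instance Definition _ := gen_eqMixin unitary.
HB.instance Definition _ := gen_choiceMixin unitary.

Lemma unitary_eqP (U V : unitary) : U =1 V -> U = V.
Proof.
case: U V => [U UP] [V VP] /= /funext UV; move: UP VP; rewrite UV => UP VP.
by congr MkUnitary; exact: Prop_irrelevance.
Qed.

Lemma unitaryZ (U : unitary) a F : U (a *: F) = a *: U F.
Proof.
have [Ul _ _] := unitaryP U.
have U0 : U 0 = 0 by have := Ul (-1) 0 0; rewrite scaler0 addr0 scaleN1r addNr.
by have := Ul a F 0; rewrite U0 !addr0.
Qed.

Lemma unitary1_subproof : is_unitary id.
Proof. by split => //; exists id. Qed.
Definition unitary1 := MkUnitary unitary1_subproof.

Lemma unitary_mul_subproof (U V : unitary) : is_unitary (U \o V).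
Proof.
have [Ul Ub Ud] := unitaryP U; have [Vl Vb Vd] := unitaryP V; split.
- by move=> a F G /=; rewrite Vl Ul.
- exact: bij_comp.
- by move=> F G /=; rewrite Ud Vd.
Qed.
Definition unitary_mul (U V : unitary) := MkUnitary (unitary_mul_subproof U V).

Definition unitary_invfun (U : unitary) (G : L2) : L2 := xget 0 [set F | U F = G].

Lemma unitary_invK (U : unitary) : cancel (unitary_invfun U) U.
Proof.
move=> G; have [_ [V _ VK] _] := unitaryP U.
exact: (@xgetPex _ 0 [set F | U F = G] (ex_intro _ (V G) (VK G))).
Qed.

Lemma unitaryK (U : unitary) : cancel U (unitary_invfun U).
Proof.
move=> F; have [_ Ub _] := unitaryP U.
by apply: (bij_inj Ub); rewrite unitary_invK.
Qed.

Lemma unitary_inv_subproof (U : unitary) : is_unitary (unitary_invfun U).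
Proof.
have [Ul Ub Ud] := unitaryP U; split.
- move=> a F G; apply: (bij_inj Ub).
  by rewrite Ul !unitary_invK.
- by exists U; [exact: unitary_invK|exact: unitaryK].
- by move=> F G; rewrite -Ud !unitary_invK.
Qed.
Definition unitary_inv (U : unitary) := MkUnitary (unitary_inv_subproof U).

Lemma unitary_mulA : associative unitary_mul.
Proof. by move=> U V W; exact: unitary_eqP. Qed.
Lemma unitary_mul1 : left_id unitary1 unitary_mul.
Proof. by move=> U; exact: unitary_eqP. Qed.
Lemma unitary_1mul : right_id unitary1 unitary_mul.
Proof. by move=> U; exact: unitary_eqP. Qed.
Lemma unitary_mulV : left_inverse unitary1 unitary_inv unitary_mul.
Proof. by move=> U; apply: unitary_eqP => F; exact: unitaryK. Qed.
Lemma unitary_Vmul : right_inverse unitary1 unitary_inv unitary_mul.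
Proof. by move=> U; apply: unitary_eqP => F; exact: unitary_invK. Qed.
HB.instance Definition _ := isGroup.Build unitary
  unitary_mulA unitary_mul1 unitary_1mul unitary_mulV unitary_Vmul.

Definition phase_eq : rel unitary := fun U V =>
  `[< exists2 c : R[i], `|c| = 1 & forall F, U F = c *: V F >].

Lemma phase_eq_refl : reflexive phase_eq.
Proof.
by move=> U; apply/asboolP; exists 1; [rewrite normr1|move=> F; rewrite scale1r].
Qed.

Lemma phase_eq_trans : transitive phase_eq.
Proof.
move=> V U W /asboolP[a a1 UV] /asboolP[b b1 VW]; apply/asboolP.
by exists (a * b); [rewrite normrM a1 b1 mulr1|move=> F; rewrite UV VW scalerA].
Qed.

Lemma phase_eq_symP U V : phase_eq U V -> phase_eq V U.
Proof.
move=> /asboolP[a a1 UV]; apply/asboolP; exists a^-1.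
  by rewrite normfV a1 invr1.
move=> F; rewrite UV scalerA mulVf ?scale1r//.
by rewrite -normr_eq0 a1 oner_eq0.
Qed.

Lemma phase_eq_sym : symmetric phase_eq.
Proof. by move=> U V; apply/idP/idP; exact: phase_eq_symP. Qed.

Canonical phase_eq_equiv :=
  EquivRel phase_eq phase_eq_refl phase_eq_sym phase_eq_trans.

Definition PU := {eq_quot phase_eq}%qT.
HB.instance Definition _ := Choice.on PU.
HB.instance Definition _ := EqQuotient.on PU.

Definition PUclass (U : unitary) : PU := (\pi_PU U)%qT.

Lemma PUclassP U V : PUclass U = PUclass V <-> phase_eq U V.
Proof. by split => [/eqmodP//|UV]; exact/eqmodP. Qed.

Lemma PUclassK (X : PU) : PUclass (repr X) = X.
Proof. exact: reprK. Qed.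

Lemma phase_eq_repr U : phase_eq (repr (PUclass U)) U.
Proof. by apply/PUclassP; rewrite PUclassK. Qed.

Lemma phase_eqM U U' V V' : phase_eq U U' -> phase_eq V V' ->
  phase_eq (U * V)%g (U' * V')%g.
Proof.
move=> /asboolP[a a1 UU'] /asboolP[b b1 VV']; apply/asboolP; exists (a * b).
  by rewrite normrM a1 b1 mulr1.
move=> F; transitivity (U (V F)); first by [].
by rewrite UU' VV' unitaryZ scalerA.
Qed.

Lemma phase_eqV U V : phase_eq U V -> phase_eq (U^-1)%g (V^-1)%g.
Proof.
move=> UV; apply: phase_eq_symP.
have := phase_eqM (phase_eqM (phase_eq_refl (U^-1)%g) UV) (phase_eq_refl (V^-1)%g).
by rewrite mulVg mul1g -mulgA mulgV mulg1.
Qed.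

Definition PU_mul (X Y : PU) : PU := PUclass (repr X * repr Y)%g.
Definition PU_inv (X : PU) : PU := PUclass (repr X)^-1%g.

Lemma PUclassM U V : PU_mul (PUclass U) (PUclass V) = PUclass (U * V)%g.
Proof. by apply/PUclassP/phase_eqM; exact: phase_eq_repr. Qed.
Lemma PUclassV U : PU_inv (PUclass U) = PUclass (U^-1)%g.
Proof. by apply/PUclassP/phase_eqV; exact: phase_eq_repr. Qed.

Lemma PU_mulA : associative PU_mul.
Proof.
by move=> X Y Z; rewrite -[X]PUclassK -[Y]PUclassK -[Z]PUclassK !PUclassM mulgA.
Qed.
Lemma PU_mul1 : left_id (PUclass 1%g) PU_mul.
Proof. by move=> X; rewrite -[X]PUclassK PUclassM mul1g. Qed.
Lemma PU_1mul : right_id (PUclass 1%g) PU_mul.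
Proof. by move=> X; rewrite -[X]PUclassK PUclassM mulg1. Qed.
Lemma PU_mulV : left_inverse (PUclass 1%g) PU_inv PU_mul.
Proof. by move=> X; rewrite -[X]PUclassK PUclassV PUclassM mulVg. Qed.
Lemma PU_Vmul : right_inverse (PUclass 1%g) PU_inv PU_mul.
Proof. by move=> X; rewrite -[X]PUclassK PUclassV PUclassM mulgV. Qed.
HB.instance Definition _ :=
  isGroup.Build PU PU_mulA PU_mul1 PU_1mul PU_mulV PU_Vmul.

End L2.

Definition expe (R : realType) (t : R) : R[i] :=
  Complex (cos (2 * pi * t)) (sin (2 * pi * t)).

(* The fractional part of x is the unique r in Z[1/p], 0 <= r < 1, such that *)
(* x - r is a p-adic integer.                                               *)
Definition padic_frac (p : nat) (p_pr : prime p) (x : padic p_pr) : rat :=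
  xget 0 [set r : rat | [/\ r \in Zinv p, 0 <= r < 1 & is_padic_int (x - ratr r)]].

Definition padic_expe (R : realType) (p : nat) (p_pr : prime p)
  (x : padic p_pr) : R[i] := expe (ratr (padic_frac x)).

Section Schwartz.
Context (R : realType) (p : nat) (p_pr : prime p).

Definition schwartz_real (f : R -> R) : Prop :=
  (forall n x, derivable (derive1n n f) x 1) /\
  (forall m n, exists B : R, forall x, `|x ^+ m * derive1n n f x| <= B).

Definition schwartz (f : R -> R[i]) : Prop :=
  schwartz_real (fun x => complex.Re (f x)) /\
  schwartz_real (fun x => complex.Im (f x)).

Definition locally_constant (f : padic p_pr -> R[i]) : Prop :=
  forall x, \forall y \near x, f y = f x.

Definition compactly_supported (f : padic p_pr -> R[i]) : Prop :=
  compact (closure [set x | f x != 0]).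

(* S(M) is the algebraic tensor product of S(Q_p), the locally constant      *)
(* functions with compact support, and the Schwartz space S(R).              *)
Definition bruhat_schwartz (f : padic p_pr * R -> R[i]) : Prop :=
  exists (n : nat) (phi : 'I_n -> padic p_pr -> R[i]) (psi : 'I_n -> R -> R[i]),
    (forall i, [/\ locally_constant (phi i), compactly_supported (phi i) &
                   schwartz (psi i)]) /\
    forall t, f t = \sum_(i < n) phi i t.1 * psi i t.2.

End Schwartz.

Section Weil.
Context (R : realType) (p : nat) (p_pr : prime p).
Local Notation M := (padic p_pr * R)%type.
Variables (alpha0 : R) (y : padic p_pr).
Variable mu : {measure set M -> \bar R}.
Implicit Types (t x xi : M) (f : M -> R[i]).

Definition chi t xi : R[i] :=
  padic_expe R (t.1 * xi.1 * y) * expe (t.2 * xi.2 / alpha0).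

Definition scaleM (a : rat) x : M := (ratr a * x.1, ratr a * x.2).

Definition sl2_act (A : 'M[rat]_2) (z : M * M) : M * M :=
  (scaleM (A 0 0) z.1 + scaleM (A 0 1) z.2, scaleM (A 1 0) z.1 + scaleM (A 1 1) z.2).

(* The measurable structure of M is the product one; as Q_p and R are second *)
(* countable, it is the Borel sigma-algebra of the product topology.         *)
Definition haar_measure : Prop :=
  [/\ forall x (A : set M), measurable A -> mu [set x + a | a in A] = mu A,
      forall K : set M, compact K -> (mu K < +oo)%E &
      forall U : set M, open U -> U !=set0 -> (0 < mu U)%E].

Definition fourier f t : R[i] := Cintegral mu (fun h => (chi h t)^* * f h).

(* Fourier inversion holds for mu, with M identified to its dual by chi.    *)
Definition self_dual : Prop := forall f, bruhat_schwartz f ->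
  forall t, f t = Cintegral mu (fun xi => chi t xi * fourier f xi).

(* L2class (fun t => ...) does not depend on the representative repr F, as   *)
(* the measure is translation-invariant.                                     *)
Definition weyl (z : M * M) (F : L2 mu) : L2 mu :=
  L2class mu (fun t => chi (t - scaleM 2^-1 z.1) z.2 * repr F (t - z.1)).

Definition gen_fun (g : generator) f t : R[i] :=
  match g with
  | genJ => fourier f t
  | genL => chi t (scaleM 2^-1 t) * f t
  | genD => f (scaleM p%:R^-1 t)
  end.

(* By density of S(M) in L^2(M), at most one U extends the operator gen_fun g. *)
Definition gen_unitary (g : generator) (U : unitary mu) : Prop :=
  forall f, bruhat_schwartz f -> U (L2class mu f) = L2class mu (gen_fun g f).

End Weil.

(* Main.v *)
(** Covariance: for each generator g, both [S_g W(z)] and [W(gz) S_g] are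
    isometries, and they agree on a total family of Bruhat-Schwartz functions,
    namely (indicator of a ball) * (rapidly decreasing bump) * (bounded
    function); hence they agree everywhere, and the relation propagates to words.

    Projective uniqueness is Schur's lemma for the Weyl operators.  Two words
    with the same value in SL_2 differ by a unitary U commuting with all W(z).
    The bounded functions whose multiplication operator commutes with U form an
    algebra, closed under bounded pointwise limits and containing the
    characters.  Averages of characters give the indicators of p-adic balls; the
    iterates of (3x - x^3)/2 turn sin into its sign, and sgn sin((x - b)/N)
    tends to sgn(x - b), which gives the indicators of intervals.  So U commutes
    with the indicators of boxes, and [<U 1_A, 1_B>] depends on the intersection
    of A and B only; it is additive and translation invariant, hence equal to
    [c mu(A /\ B)], so that U = c.

    Surjectivity of word evaluation is Euclid's algorithm over Z[1/p]. *)

Require Import Defs.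
From HB Require Import structures.
From mathcomp Require Import all_boot all_order all_algebra.
From mathcomp Require Import all_classical all_reals all_analysis.
From mathcomp Require Import complex measurable_realfun.
From mathcomp Require Import ring lra.

Set Implicit Arguments.
Unset Strict Implicit.
Unset Printing Implicit Defensive.

Import Order.TTheory GRing.Theory Num.Theory.
Import numFieldNormedType.Exports.

Local Open Scope classical_set_scope.
Local Open Scope ring_scope.

(** The operators [S g] are known only through [gen_unitary], that is, on Bruhat-Schwartz functions,
    and the proof uses neither the density of S(M) nor Plancherel. The test family is therefore
    tailored so that its members and their Weyl translates visibly lie in S(M), while only 0 is
    orthogonal to all of it. On the real side the logistic function achieves this: its derivative is
    a polynomial in itself, so a bump times a bounded factor keeps this form under derivation, and
    products of steep logistic functions tend to indicators of half-open intervals.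

    Measure theory goes through boxes, products of a p-adic ball and a half-open dyadic interval of
    the same level n. There are countably many, and two of them are nested or disjoint. A box of
    level n is the disjoint union of 2p boxes of level n + 1, and boxes of one level are translates
    of each other; in Schur's lemma these two facts replace the uniqueness of Haar measure or a
    Radon-Nikodym argument. Operators are compared through matrix coefficients alone, so that
    dominated convergence handles every limit of multipliers. *)

Local Notation expe := Defs.expe.

(** * The field Q_p and its standard character *)

Section PadicField.
Context (p : nat) (p_pr : prime p).
Local Notation Zp := (padic_int p_pr).
Local Notation Qp := (padic p_pr).
Local Notation isint := (@is_padic_int p p_pr).
Implicit Types x y c : Qp.

Lemma padic_int0 : isint 0.
Proof. by exists 0; rewrite tofrac0. Qed.

Lemma padic_intD x y : isint x -> isint y -> isint (x + y).
Proof. by move=> [a ->] [b ->]; exists (a + b); rewrite tofracD. Qed.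

Lemma padic_intN x : isint x -> isint (- x).
Proof. by move=> [a ->]; exists (- a); rewrite tofracN. Qed.

Lemma padic_intB x y : isint x -> isint y -> isint (x - y).
Proof. by move=> ix iy; apply/padic_intD/padic_intN. Qed.

Lemma padic_intM x y : isint x -> isint y -> isint (x * y).
Proof. by move=> [a ->] [b ->]; exists (a * b); rewrite tofracM. Qed.

Lemma padic_int_nat n : isint n%:R.
Proof. by exists n%:R; rewrite rmorph_nat. Qed.

Lemma residue_natr (n k : nat) : (n%:R : Zp) k = (n %% p ^ k)%N.
Proof.
elim: n => [|n IH]; first by rewrite /= mod0n.
rewrite -natr1; transitivity ((((n%:R)%R : Zp) k + (1%R : Zp) k) %% p ^ k)%N => //.
by rewrite IH modnDm addn1.
Qed.

(** The residue of n + 1 modulo p^(n+1) is n + 1 itself, because n + 1 < p^(n+1). Characteristic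
    zero is what makes [ratr] into Q_p meaningful. *)
Lemma padic_natr_neq0 n : (n.+1%:R : Qp) != 0.
Proof.
have -> : (n.+1%:R : Qp) = tofrac (n.+1%:R : Zp) by rewrite rmorph_nat.
rewrite tofrac_eq0; apply/eqP => /(congr1 (fun z : Zp => z n.+1)).
rewrite residue_natr [in RHS]/= mod0n modn_small//.
by rewrite (leq_trans (ltn_expl n.+1 (prime_gt1 p_pr))).
Qed.

Lemma padic_natr_eq0 n : ((n%:R : Qp) == 0) = (n == 0%N).
Proof. by case: n => [|n]; [rewrite mulr0n !eqxx|rewrite (negbTE (padic_natr_neq0 n))]. Qed.

Lemma padic_intr_eq0 (m : int) : ((m%:~R : Qp) == 0) = (m == 0).
Proof.
case: m => n; first exact: padic_natr_eq0.
by rewrite NegzE mulrNz oppr_eq0 (negbTE (padic_natr_neq0 n)).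
Qed.

Lemma padic_p_neq0 : (p%:R : Qp) != 0.
Proof. by rewrite padic_natr_eq0 -lt0n prime_gt0. Qed.

Lemma padic_pX_neq0 n : (p%:R : Qp) ^+ n != 0.
Proof. exact/expf_neq0/padic_p_neq0. Qed.

(** [ratr] reads the reduced fraction; cross-multiplication in characteristic zero allows any other
    one. The morphism laws below then follow from the unreduced fractions that the operations
    produce. *)
Lemma padic_ratrE (r : rat) (a b : int) : b != 0 -> r = a%:~R / b%:~R ->
  (ratr r : Qp) = a%:~R / b%:~R.
Proof.
move=> b0 rE; rewrite /ratr; apply/eqP.
rewrite eqr_div ?padic_intr_eq0 ?denq_neq0// -!intrM; apply/eqP; congr (_%:~R).
apply: (@intr_inj rat); rewrite !intrM; apply/eqP.
by rewrite -eqr_div ?intr_eq0 ?denq_neq0// divq_num_den rE.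
Qed.

Lemma padic_ratrM (r s : rat) : (ratr (r * s) : Qp) = ratr r * ratr s.
Proof.
rewrite (@padic_ratrE _ (numq r * numq s) (denq r * denq s)).
- by rewrite /ratr !intrM invfM mulrACA.
- by rewrite mulf_neq0 ?denq_neq0.
- by rewrite !intrM invfM mulrACA !divq_num_den.
Qed.

Lemma padic_ratrD (r s : rat) : (ratr (r + s) : Qp) = ratr r + ratr s.
Proof.
rewrite (@padic_ratrE _ (numq r * denq s + numq s * denq r) (denq r * denq s)).
- by rewrite /ratr addf_div ?padic_intr_eq0 ?denq_neq0// intrD !intrM.
- by rewrite mulf_neq0 ?denq_neq0.
- by rewrite intrD !intrM -addf_div ?intr_eq0 ?denq_neq0// !divq_num_den.
Qed.

Lemma padic_ratr_int (m : int) : (ratr m%:~R : Qp) = m%:~R.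
Proof. by rewrite (@padic_ratrE _ m 1) ?invr1 ?mulr1. Qed.

Lemma padic_ratr_nat (m : nat) : (ratr m%:R : Qp) = m%:R.
Proof. exact: (padic_ratr_int m). Qed.

Lemma padic_ratr0 : (ratr 0 : Qp) = 0. Proof. exact: (padic_ratr_nat 0). Qed.
Lemma padic_ratr1 : (ratr 1 : Qp) = 1. Proof. exact: (padic_ratr_nat 1). Qed.

Lemma padic_ratrN (r : rat) : (ratr (- r) : Qp) = - ratr r.
Proof. by apply/eqP; rewrite -addr_eq0 -padic_ratrD addNr padic_ratr0. Qed.

Lemma padic_ratrB (r s : rat) : (ratr (r - s) : Qp) = ratr r - ratr s.
Proof. by rewrite padic_ratrD padic_ratrN. Qed.

Lemma padic_ratrV (r : rat) : (ratr r^-1 : Qp) = (ratr r)^-1.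
Proof.
have [->|r0] := eqVneq r 0; first by rewrite invr0 padic_ratr0 invr0.
have r1 : (ratr r^-1 : Qp) * ratr r = 1 by rewrite -padic_ratrM mulVf ?padic_ratr1.
have r'0 : (ratr r : Qp) != 0.
  by apply/eqP => r'0; move: r1; rewrite r'0 mulr0 => /eqP; rewrite eq_sym oner_eq0.
by apply: (mulIf r'0); rewrite r1 mulVf.
Qed.

Lemma padic_ratrX (r : rat) n : (ratr (r ^+ n) : Qp) = ratr r ^+ n.
Proof.
by elim: n => [|n IH]; rewrite ?expr0 ?padic_ratr1// !exprS padic_ratrM IH.
Qed.

Lemma p_rat_neq0 n : ((p%:R : rat) ^+ n) != 0.
Proof. by apply/expf_neq0; rewrite pnatr_eq0 -lt0n prime_gt0. Qed.

(** z is prime to p at every level, so Bezout inverts it modulo each p^n; uniqueness of inverses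
    modulo p^n makes these a compatible sequence. *)
Lemma padic_int_unit (z : Zp) : z 1%N != 0%N -> exists w : Zp, w * z = 1.
Proof.
move=> z0.
have cop n : coprime (z n) (p ^ n).
  have [->|n0] := posnP n; first by rewrite expn0 coprimen1.
  rewrite coprimeXr// coprime_sym prime_coprime//.
  apply: contra z0 => pz; rewrite (residueD z 1 n.-1) add1n prednK// expn1.
(* Level 0 stands apart: modulo 1 every residue is 0 and any number is an inverse. *)
have zn n : (0 < z n)%N || (n == 0%N).
  case: n => [|n]; rewrite ?orbT// orbF lt0n.
  apply/eqP => zn0; move: (cop n.+1); rewrite zn0 /coprime gcd0n expnS.
  by rewrite muln_eq1 => /andP[/eqP p1]; have := prime_gt1 p_pr; rewrite p1.
have Hw n : exists w, (w * z n = 1 %[mod p ^ n])%N.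
  have /orP[zn0|/eqP ->] := zn n; last by exists 0%N; rewrite expn0 !modn1.
  case: (egcdnP (p ^ n) zn0) => km kn E _; exists km.
  by rewrite E (eqP (cop n)) modnMDl.
pose w n := (sval (cid (Hw n)) %% p ^ n)%N.
have wz n : (w n * z n = 1 %[mod p ^ n])%N.
  by rewrite /w modnMml; case: (cid (Hw n)).
have wE n : w n = (w n.+1 %% p ^ n)%N.
  have -> : w n = (w n %% p ^ n)%N by rewrite modn_mod.
  have H1 := wz n; have H2 : (w n.+1 * z n = 1 %[mod p ^ n])%N.
    have := congr1 (fun m => (m %% p ^ n)%N) (wz n.+1).
    by rewrite !modn_expS (residueE z n) modnMmr => ->.
  (* Modulo p^n, w_n = w_n * (w_(n+1) * z_n) = w_(n+1) * (w_n * z_n) = w_(n+1). *)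
  rewrite -[w n]muln1 -modnMmr -H2 modnMmr mulnA [(_ * w _.+1)%N]mulnC -mulnA.
  by rewrite -modnMmr H1 modnMmr muln1.
exists (PadicInt p_pr wE); apply: padic_intP => n /=.
by rewrite wz.
Qed.

Lemma residue_pX (m i : nat) : (p%:R ^+ m : Zp) i = (p ^ m %% p ^ i)%N.
Proof. by rewrite -natrX residue_natr. Qed.

(** If the residue at level k vanishes, p^k divides all later ones, and dividing the sequence
    shifted by k levels keeps it compatible. The residues of u are exported because
    [padic_int_factor] needs the first of them. *)
Lemma padic_int_div (z : Zp) k : z k = 0%N -> exists u : Zp,
  z = p%:R ^+ k * u /\ forall n, u n = (z (k + n) %/ p ^ k)%N.
Proof.
move=> zk0; have pk0 : (0 < p ^ k)%N by rewrite expn_gt0 prime_gt0.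
have dv n : (p ^ k %| z (k + n))%N by rewrite /dvdn -residueD zk0.
have uE n : (z (k + n) %/ p ^ k)%N = ((z (k + n.+1) %/ p ^ k) %% p ^ n)%N.
  apply/eqP; rewrite -(eqn_pmul2r pk0) divnK// muln_modl divnK//.
  by rewrite -expnD [(n + k)%N]addnC addnS -residueE.
exists (PadicInt p_pr uE); split => //=; apply: padic_intP => n.
rewrite [RHS]/= residue_pX /= modnMml mulnC divnK//.
by rewrite addnC -residueD.
Qed.

Lemma padic_int_factor (z : Zp) : z != 0 ->
  exists k (u : Zp), u 1%N != 0%N /\ z = p%:R ^+ k * u.
Proof.
move=> /eqP z0; have exn : exists n, z n != 0%N.
  apply: contrapT => /forallNP H; apply: z0; apply: padic_intP => n.
  by rewrite [RHS]mod0n; have /negP/negPn/eqP := H n.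
(* The first nonzero residue sits at level k + 1 when the valuation is k; level 0 is excluded since
   residues modulo 1 vanish. *)
case: (ex_minnP exn) => [[|k]] zk kmin.
  by move: zk; rewrite -residue_mod expn0 modn1.
have zk0 : z k = 0%N.
  by apply/eqP; case: eqP => // /eqP/kmin; rewrite ltnn.
have pk0 : (0 < p ^ k)%N by rewrite expn_gt0 prime_gt0.
have [u [zE uE]] := padic_int_div zk0; exists k, u; split => //.
rewrite uE addn1 -lt0n divn_gt0// dvdn_leq ?lt0n//.
by rewrite /dvdn -[k.+1]addn1 -residueD zk0.
Qed.

(** Q_p is built as a fraction field: a denominator is p^k times a unit, and the inverse of the unit
    is absorbed into the numerator. *)
Lemma padic_int_mulpX x : exists n, isint (p%:R ^+ n * x).
Proof.
elim/quotW: x => r; set x : Qp := (\pi_(Qp) r)%qT.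
have [a [b [b0 ->]]] : exists a b : Zp, b != 0 /\ x = tofrac a / tofrac b.
  exists (frac r).1, (frac r).2; split; first exact: denom_ratioP.
  have d0 : (tofrac (frac r).2 : Qp) != 0 by rewrite tofrac_eq0 denom_ratioP.
  apply: (mulIf d0); rewrite mulfVK//.
  rewrite /x; rewrite !piE; apply/eqmodP; rewrite /= FracField.equivfE.
  by rewrite !numden_Ratio ?oner_eq0 ?denom_ratioP// ?mulf_neq0 ?oner_eq0 ?denom_ratioP// !mulr1 mulrC.
have [k [u [u1 ->]]] := padic_int_factor b0.
have [w wu] := padic_int_unit u1.
exists k; exists (a * w).
have wE : tofrac w = (tofrac u)^-1 :> Qp.
  have wu' : (tofrac w : Qp) * tofrac u = 1 by rewrite -tofracM wu tofrac1.
  have u0 : (tofrac u : Qp) != 0.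
    by apply/eqP => u0; move: wu'; rewrite u0 mulr0 => /eqP; rewrite eq_sym oner_eq0.
  by apply: (mulIf u0); rewrite wu' mulVf.
rewrite !tofracM tofracXn rmorph_nat invfM wE mulrCA.
by congr (_ * _); rewrite mulrA mulfV ?padic_pX_neq0// mul1r.
Qed.

Lemma padic_int_mulpXW x n m : (n <= m)%N -> isint (p%:R ^+ n * x) ->
  isint (p%:R ^+ m * x).
Proof.
move=> nm ix; rewrite -(subnK nm) exprD -mulrA; apply: padic_intM => //.
by rewrite -natrX; exact: padic_int_nat.
Qed.

Lemma Zinv_div_pX (m : int) n : m%:~R / p%:R ^+ n \in Zinv p.
Proof. by apply/asboolP; exists n; rewrite mulfVK ?p_rat_neq0. Qed.

Lemma Zinv_eq r : r \in Zinv p -> exists (m : int) n, r = m%:~R / p%:R ^+ n.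
Proof.
by move=> /asboolP[n /intrP[m mE]]; exists m, n; rewrite -mE mulfK ?p_rat_neq0.
Qed.

Lemma padic_frac_ex x : exists r : rat,
  [/\ r \in Zinv p, 0 <= r < 1 & isint (x - ratr r)].
Proof.
have [n [z zE]] := padic_int_mulpX x.
(* With p^n x = z, the principal part of x is z_n / p^n; the remainder (z - z_n) / p^n is integral
   because z - z_n has zero residue at level n. *)
exists ((z n)%:~R / p%:R ^+ n); split; first exact: Zinv_div_pX.
  rewrite divr_ge0 ?exprn_ge0 ?ler0n//= ltr_pdivrMr ?mul1r ?exprn_gt0 ?ltr0n ?prime_gt0//.
  by rewrite -natrX ltr_nat -residue_mod ltn_mod expn_gt0 prime_gt0.
have [u [uE _]] : exists u : Zp, z - (z n)%:R = p%:R ^+ n * u /\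
    forall m, u m = ((z - (z n)%:R)%R (n + m) %/ p ^ n)%N.
  apply: padic_int_div.
  rewrite -residue_mod; apply/eqP.
  have -> : (0 = 0 %% p ^ n)%N by rewrite mod0n.
  rewrite -(eqn_modDr (z n)) add0n -[X in _ == X %[mod _]]/(z n).
  set X := (z - (z n)%:R)%R.
  have : ((X n + ((z n)%:R%R : Zp) n) %% p ^ n = z n)%N.
    have XE : X + (z n)%:R = z by rewrite subrK.
    by rewrite -[in RHS]XE.
  by rewrite residue_natr residue_mod => ->.
exists u; apply: (mulfI (padic_pX_neq0 n)).
rewrite mulrBr zE padic_ratrM padic_ratrV padic_ratrX padic_ratr_int padic_ratr_nat.
rewrite [X in _ - X]mulrC divfK ?padic_pX_neq0//.
have -> : (p%:R : Qp) = tofrac p%:R by rewrite rmorph_nat.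
by rewrite -tofracXn -tofracM -uE tofracB rmorph_nat.
Qed.

Lemma padic_int_natdiv (a n : nat) : isint (a%:R / p%:R ^+ n) -> (p ^ n %| a)%N.
Proof.
move=> [z /(congr1 ( *%R^~ (p%:R ^+ n)))]; rewrite mulfVK ?padic_pX_neq0//.
have -> : (p%:R : Qp) = tofrac p%:R by rewrite rmorph_nat.
have -> : (a%:R : Qp) = tofrac a%:R by rewrite rmorph_nat.
rewrite -tofracXn -tofracM => /eqP; rewrite tofrac_eq => /eqP.
move=> /(congr1 (fun w : Zp => w n)); rewrite residue_natr /= residue_pX modnn.
by rewrite muln0 mod0n => /eqP.
Qed.

(** Z[1/p] and Z_p meet in Z. Fractional parts are therefore unique up to an integer. *)
Lemma padic_int_Zinv r : r \in Zinv p -> isint (ratr r) -> r \is a Num.int.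
Proof.
move=> /Zinv_eq[m [n ->]].
have int_natdiv (a : nat) : isint (a%:R / p%:R ^+ n) ->
    (a%:R / p%:R ^+ n : rat) \is a Num.int.
  move=> /padic_int_natdiv/dvdnP[k ->].
  by rewrite natrM natrX mulfK ?p_rat_neq0// rpred_nat.
rewrite padic_ratrM padic_ratrV padic_ratrX padic_ratr_nat padic_ratr_int.
case: m => a; first exact: int_natdiv.
rewrite NegzE !mulrNz !mulNr => /padic_intN; rewrite opprK => /int_natdiv.
by rewrite rpredN.
Qed.

Lemma padic_fracP x : [/\ padic_frac x \in Zinv p, 0 <= padic_frac x < 1 &
  isint (x - ratr (padic_frac x))].
Proof. exact: (@xgetPex _ 0 [set r : rat | _] (padic_frac_ex x)). Qed.

Section Character.
Context (R : realType).

Lemma expeD (s t : R) : expe (s + t) = expe s * expe t.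
Proof.
rewrite /expe mulrDr cosD sinD; congr Complex.
by rewrite addrC.
Qed.

Lemma expe0 : expe (0 : R) = 1.
Proof. by rewrite /expe mulr0 cos0 sin0. Qed.

Lemma expeN (t : R) : expe (- t) = (expe t)^*.
Proof. by rewrite /expe mulrN cosN sinN. Qed.

Lemma expe_nat (n : nat) : expe (n%:R : R) = 1.
Proof.
elim: n => [|n IH]; first exact: expe0.
rewrite -natr1 expeD IH mul1r /expe mulr1 mulr_natl cos2pi.
by rewrite sin2pi.
Qed.

Lemma expe_int (t : R) : t \is a Num.int -> expe t = 1.
Proof.
move=> /intrP[[n|n] ->]; first exact: expe_nat.
by rewrite NegzE mulrNz expeN expe_nat rmorph1.
Qed.

(** 1 - cos (2 pi t) = 2 sin (pi t)^2, and sin (pi t) > 0 for 0 < t < 1. *)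
Lemma expe_eq1 (t : R) : 0 <= t < 1 -> expe t = 1 -> t = 0.
Proof.
move=> /andP[t0 t1] [ct _]; apply/eqP/negPn/negP => tn0.
have tp : 0 < t by rewrite lt_def tn0.
have : 0 < sin (pi * t).
  apply: sin_gt0_pi; rewrite mulr_gt0 ?pi_gt0//=.
  by rewrite gtr_pMr ?pi_gt0.
have : cos (2 * pi * t) = 1 - sin (pi * t) ^+ 2 *+ 2.
  by rewrite -mulrA mulr_natl cos_mulr2n cos2sin2; ring.
rewrite ct => /eqP; rewrite eq_sym subr_eq addrC -subr_eq subrr eq_sym.
by rewrite mulrn_eq0 /= sqrf_eq0 => /eqP ->; rewrite ltxx.
Qed.

(** Two representatives in Z[1/p] differ by an integer, which [expe] ignores. Without the
    normalisation 0 <= r < 1, additivity of the character becomes additivity of representatives. *)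
Lemma padic_expeE x r : r \in Zinv p -> isint (x - ratr r) ->
  padic_expe R x = expe (ratr r).
Proof.
move=> rZ ix; have [fZ _ ifr] := padic_fracP x.
have : padic_frac x - r \is a Num.int.
  apply: padic_int_Zinv; first by rewrite rpredB.
  have -> : ratr (padic_frac x - r) = (x - ratr r) - (x - ratr (padic_frac x)).
    by rewrite padic_ratrB; ring.
  exact: padic_intB.
rewrite /padic_expe -[in expe (ratr (padic_frac x))](subrK r (padic_frac x)).
move=> /intrP[m mE]; rewrite mE rmorphD/= expeD expe_int ?mul1r//.
by rewrite ratr_int intr_int.
Qed.

Lemma padic_expeD x1 x2 : padic_expe R (x1 + x2) = padic_expe R x1 * padic_expe R x2.
Proof.
have [f1Z _ i1] := padic_fracP x1; have [f2Z _ i2] := padic_fracP x2.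
rewrite (@padic_expeE _ (padic_frac x1 + padic_frac x2)) ?rpredD//.
  by rewrite rmorphD expeD.
by rewrite padic_ratrD opprD addrACA; exact: padic_intD.
Qed.

Lemma padic_expe_int x : isint x -> padic_expe R x = 1.
Proof.
by move=> ix; rewrite (@padic_expeE _ 0) ?rpred0 ?rmorph0 ?expe0// padic_ratr0 subr0.
Qed.

(** The kernel of the character is no larger than Z_p; this lets averages of characters detect
    p-adic balls. *)
Lemma padic_expe_eq1 x : padic_expe R x = 1 -> isint x.
Proof.
have [_ f01 ifr] := padic_fracP x; rewrite /padic_expe => /expe_eq1 f0.
move: ifr; have -> : padic_frac x = 0; last by rewrite padic_ratr0 subr0.
apply: (fmorph_inj (@ratr R)); rewrite rmorph0; apply: f0.
by rewrite ler0q -[X in _ < X](rmorph1 (@ratr R)) ltr_rat.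
Qed.

Lemma padic_expeN x : padic_expe R (- x) = (padic_expe R x)^*.
Proof.
have [fZ _ ix] := padic_fracP x.
rewrite (@padic_expeE _ (- padic_frac x)) ?rpredN//.
  by rewrite rmorphN expeN.
by rewrite padic_ratrN -opprD; exact: padic_intN.
Qed.

Lemma nsq_expe (t : R) : complex.Re (expe t) ^+ 2 + complex.Im (expe t) ^+ 2 = 1.
Proof. by rewrite /= cos2Dsin2. Qed.

End Character.

End PadicField.

(** * Topology of Q_p: balls, measurability, compactness *)

Section PadicTopology.
Context (p : nat) (p_pr : prime p).
Local Notation Zp := (padic_int p_pr).
Local Notation Qp := (padic p_pr).
Local Notation isint := (@is_padic_int p p_pr).
Implicit Types (x y c a b : Qp) (A : set Qp).

Lemma padic_ballP a n x : padic_ball a n x <-> isint ((x - a) / p%:R ^+ n).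
Proof.
split=> [[z ->]|[z zE]].
  by exists z; rewrite addrAC subrr add0r mulrC mulKf ?padic_pX_neq0.
by exists z; rewrite -zE mulrC divfK ?padic_pX_neq0// subrKC.
Qed.

Lemma padic_ball_sym a n x : padic_ball a n x -> padic_ball x n a.
Proof. by rewrite !padic_ballP => /padic_intN; rewrite -mulNr opprB. Qed.

Lemma padic_ball_eq a n x : padic_ball a n x -> padic_ball a n = padic_ball x n.
Proof.
move=> ax; apply/seteqP; split; apply: padic_ball_sub => //.
exact: padic_ball_sym.
Qed.

Lemma padic_ball_shift a n x c : padic_ball a n (x - c) <-> padic_ball (a + c) n x.
Proof. by rewrite !padic_ballP opprD addrA addrAC. Qed.

(** A centre matters only modulo p^n Z_p, and Q_p = Z[1/p] + Z_p. Consequently there are only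
    countably many balls. *)
Lemma padic_ball_rat a n : exists q : rat, padic_ball a n = padic_ball (ratr q) n.
Proof.
have [rZ _ ir] := padic_fracP (a / p%:R ^+ n).
exists (p%:R ^+ n * padic_frac (a / p%:R ^+ n)); apply/padic_ball_eq/padic_ball_sym.
apply/padic_ballP; rewrite padic_ratrM padic_ratrX padic_ratr_nat mulrBl.
by rewrite [X in _ - X]mulrAC mulfV ?padic_pX_neq0// mul1r.
Qed.

Lemma padic_open_ball a n : open (padic_ball a n).
Proof.
exists [set (a, n)] => //; apply/seteqP; split=> x /=; first by case=> _ -> .
by move=> ax; exists (a, n).
Qed.

Lemma padic_openP A : open A <-> forall x, A x -> exists n, padic_ball x n `<=` A.
Proof.
split=> [[D _ <-] x [[a n] Di /= ax]|H].
  exists n; rewrite -(padic_ball_eq ax) => y ay.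
  by exists (a, n).
rewrite openE => x /H[n nA]; rewrite /interior nbhsE; exists (padic_ball x n) => //.
by split; [exact: padic_open_ball|exact: padic_ball_center].
Qed.

Lemma padic_nbhsP x A : nbhs x A <-> exists n, padic_ball x n `<=` A.
Proof.
rewrite nbhsE; split=> [[B [/padic_openP oB /oB[n nB] BA]]|[n nA]].
  by exists n; apply: subset_trans BA.
exists (padic_ball x n) => //.
by split; [exact: padic_open_ball|exact: padic_ball_center].
Qed.

Lemma padic_closed_ball a n : closed (padic_ball a n).
Proof.
rewrite -openC; apply/padic_openP => x /= nax; exists n => y /= xy ay; apply: nax.
by rewrite (padic_ball_eq ay); exact: padic_ball_sym.
Qed.

Lemma padic_measurable_ball a n : measurable (padic_ball a n).
Proof. apply: sub_sigma_algebra; exact: padic_open_ball. Qed.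

(** The preimage of every set, measurable or not, is open. *)
Lemma padic_measurable_lc d (T : measurableType d) (f : Qp -> T) :
  (forall x, exists n, forall y, padic_ball x n y -> f y = f x) ->
  measurable_fun setT f.
Proof.
move=> lf _ B _; rewrite setTI; apply: sub_sigma_algebra.
apply/padic_openP => x /= Bfx; have [n fn] := lf x.
by exists n => y /fn /= ->.
Qed.

Lemma padic_measurable_cont (f : Qp -> Qp) :
  (forall x n, exists m, forall y, padic_ball x m y -> padic_ball (f x) n (f y)) ->
  measurable_fun setT f.
Proof.
move=> cf; apply: (measurability (@open Qp)) => //.
move=> _ [B oB <-]; rewrite setTI; apply: sub_sigma_algebra.
apply/padic_openP => x /= Bfx; have [n nB] := (padic_openP B).1 oB _ Bfx.
by have [m mn] := cf x n; exists m => y /mn /nB.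
Qed.

Lemma padic_measurableD c : measurable_fun setT (fun x => x + c).
Proof.
apply: padic_measurable_cont => x n; exists n => y /padic_ballP xy.
by apply/padic_ballP; rewrite opprD addrACA subrr addr0.
Qed.

(** An ultrafilter on the ball selects one residue class at each level; the selected residues form a
    p-adic integer, to which the ultrafilter converges. *)
Lemma padic_compact_ball a n : compact (padic_ball a n).
Proof.
rewrite compact_ultra => F FU Fan.
pose S k (i : nat) := [set x : Qp | exists2 z : Zp, z k = i & x = a + p%:R ^+ n * tofrac z].
have FS k : exists i, F (S k i).
  apply: contrapT => /forallNP H.
  (* If no class were selected, the ultrafilter would contain the complement of all p^k classes
     within the ball, which is empty. *)
  have Hc m : F (padic_ball a n `&` ~` \bigcup_(i < m) S k i).
    elim: m => [|m IH]; first by rewrite bigcup_mkord big_ord0 setC0 setIT.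
    rewrite bigcup_mkord big_ord_recr/= setCU setIA; apply: filterI.
      by rewrite -bigcup_mkord.
    by have [/H//|] := in_ultra_setVsetC (S k m) FU.
  have [x [[z xz]]] := filter_ex (Hc (p ^ k)%N); apply; exists (z k); last by exists z.
  by rewrite /= -residue_mod ltn_mod expn_gt0 prime_gt0.
pose s k := sval (cid (FS k)).
have Fs k : F (S k (s k)) by rewrite /s; case: (cid (FS k)).
have sE k : s k = (s k.+1 %% p ^ k)%N.
  (* A point common to the classes selected at levels k and k + 1 has a single coordinate z, so the
     two residues are compatible. *)
  have [x [[z zk xz] [z' zk' xz']]] := filter_ex (filterI (Fs k) (Fs k.+1)).
  have zz' : z = z'.
    apply/eqP; rewrite -(tofrac_eq z z'); apply/eqP.
    by apply: (mulfI (padic_pX_neq0 p_pr n)); apply: (addrI a); rewrite -xz.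
  by rewrite -zk -zk' zz' -residueE.
pose z := PadicInt p_pr sE; exists (a + p%:R ^+ n * tofrac z).
split; first by exists z.
move=> A /padic_nbhsP[k kA]; apply: (filterS kA).
apply: (filterS _ (Fs k)) => x [w wk ->].
apply/padic_ballP; rewrite opprD addrACA subrr add0r -mulrBr -tofracB.
have [u [-> _]] : exists u : Zp, w - z = p%:R ^+ k * u /\
    forall m, u m = ((w - z)%R (k + m) %/ p ^ k)%N.
  apply: padic_int_div.
  rewrite /= wk modnDmr addnC subnK ?modnn// -wk; exact: residue_le.
rewrite tofracM tofracXn rmorph_nat mulrA mulrAC mulfK ?padic_pX_neq0//.
apply: padic_intM; first by rewrite -natrX; exact: padic_int_nat.
by exists u.
Qed.

End PadicTopology.

(** * Boxes and Haar measure on M *)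

Section Boxes.
Context (R : realType) (p : nat) (p_pr : prime p).
Local Notation Qp := (padic p_pr).
Local Notation M := (padic p_pr * R)%type.
Implicit Types (q : Qp) (n m : nat) (j : int) (t x : M).

(** Bounding 2 ^+ n * t.2, rather than t.2, keeps both ends integers, so that nesting is decided
    between integers. *)
Definition box q n j : set M :=
  [set t | padic_ball q n t.1 /\ j%:~R < 2 ^+ n * t.2 <= j%:~R + 1].

(** The empty set is included for stability under intersection. *)
Definition boxes : set (set M) :=
  [set A | A = set0 \/ exists q n j, A = box q n j].

Lemma measurable_box q n j : measurable (box q n j).
Proof.
have -> : box q n j = padic_ball q n `*`
    ((fun r : R => 2 ^+ n * r) @^-1` `]j%:~R, j%:~R + 1]%classic).
  by apply/seteqP; split => t /=; rewrite in_itv/=.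
apply: measurableX; first exact: padic_measurable_ball.
rewrite -[X in measurable X]setTI.
by apply: mulrl_measurable.
Qed.

Lemma boxes_measurable : boxes `<=` measurable.
Proof.
by move=> _ [->|[q [n [j ->]]]]; [exact: measurable0|exact: measurable_box].
Qed.

Lemma ceil_bounds (r : R) : (Num.ceil r - 1)%:~R < r <= (Num.ceil r - 1)%:~R + 1.
Proof.
by have := ceil_itv r; rewrite intrB addrNK.
Qed.

Lemma ex_exp2_gt (r : R) : exists n : nat, r < 2 ^+ n.
Proof.
exists (Num.truncn r).+1; apply: (lt_le_trans (truncnS_gt r)).
by rewrite -natrX ler_nat ltnW// ltn_expl.
Qed.

Lemma in_box t n : box t.1 n (Num.ceil (2 ^+ n * t.2) - 1) t.
Proof. by split; [exact: padic_ball_center|exact: ceil_bounds]. Qed.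

Lemma box_nested q q' n m j j' t : (n <= m)%N -> box q n j t -> box q' m j' t ->
  box q' m j' `<=` box q n j.
Proof.
move=> nm [qt /andP[jt tj]] [q't /andP[j't tj']] s [q's /andP[j's sj']].
have p2 : 0 < 2 ^+ (m - n) :> R by rewrite exprn_gt0.
have e2 (r : R) : 2 ^+ m * r = 2 ^+ (m - n) * (2 ^+ n * r).
  by rewrite mulrA -exprD subnK.
(* The common point t gives j 2^(m-n) < j' + 1 and j' < (j + 1) 2^(m-n); between integers, these
   sharpen to the inclusion of the intervals. *)
have jj' : j * 2 ^+ (m - n) <= j'.
  rewrite -ltzD1 -(ltr_int R) intrD intrM rmorphXn/=.
  by apply: lt_le_trans tj'; rewrite e2 mulrC ltr_pM2l.
have j'j : j' + 1 <= (j + 1) * 2 ^+ (m - n).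
  rewrite lezD1 -(ltr_int R) intrM intrD rmorphXn/=.
  by apply: (lt_le_trans j't); rewrite e2 mulrC ler_pM2r.
split.
  by apply: (padic_ball_sub qt nm); rewrite -(padic_ball_eq q't).
move: jj' j'j; rewrite -!(ler_int R) !intrD !intrM !intrD rmorphXn/= => jj' j'j.
rewrite -(ltr_pM2l p2) -(ler_pM2l p2) -e2 mulrC [leRHS]mulrC.
by rewrite (le_lt_trans jj' j's) (le_trans sj' j'j).
Qed.

Lemma boxes_setI : setI_closed boxes.
Proof.
have H q q' n m j j' : (n <= m)%N -> boxes (box q n j `&` box q' m j').
  move=> nm; have [|/set0P[t [t1 t2]]] := eqVneq (box q n j `&` box q' m j') set0.
    by left.
  right; exists q', m, j'; apply/setIidPr; exact: box_nested nm t1 t2.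
move=> A B [->|[q [n [j ->]]]]; first by rewrite set0I; left.
move=> [->|[q' [m [j' ->]]]]; first by rewrite setI0; left.
by have [/H//|/ltnW/H] := leqP n m; rewrite setIC.
Qed.

Lemma box_rat q n j : exists r : rat, box q n j = box (ratr r) n j.
Proof. by have [r rE] := padic_ball_rat q n; exists r; rewrite /box rE. Qed.

(** A is the union of the boxes with rational centre that it contains, a countable union. This
    criterion serves the preimages under both coordinates. *)
Lemma sigma_boxesP (A : set M) :
  (forall t, A t -> exists n, forall q j, box q n j t -> box q n j `<=` A) ->
  <<s boxes >> A.
Proof.
move=> H; pose T' := g_sigma_algebraType boxes.
pose F (i : rat * nat * int) : set T' :=
  if `[< box (ratr i.1.1) i.1.2 i.2 `<=` A >] then box (ratr i.1.1) i.1.2 i.2 else set0.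
have -> : A = \bigcup_i F i.
  apply/seteqP; split=> [t /H[n nA]|t [i _]]; last first.
    by rewrite /F; case: asboolP => // iA /iA.
  have tb := in_box t n; have [r rE] := box_rat t.1 n (Num.ceil (2 ^+ n * t.2) - 1).
  exists (r, n, Num.ceil (2 ^+ n * t.2) - 1) => //; rewrite /F /=.
  by case: asboolP => [|[]]; rewrite -rE//; exact: nA.
apply: (@countable_bigcupT_measurable _ T'); first exact: countableP.
move=> i; rewrite /F; case: asboolP => _; last exact: measurable0.
apply: sub_sigma_algebra; right; by exists (ratr i.1.1), i.1.2, i.2.
Qed.

Lemma measurable_boxes : (@measurable _ M) = <<s boxes >>.
Proof.
apply/seteqP; split; last first.
  by apply: smallest_sub; [exact: sigma_algebra_measurable|exact: boxes_measurable].
pose T' := g_sigma_algebraType boxes.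
have m1 : measurable_fun setT (fst : T' -> Qp).
  apply: (measurability (@open Qp)) => //.
  move=> _ [B /padic_openP oB <-]; rewrite setTI; apply: sigma_boxesP => t /= /oB[n nB].
  by exists n => q j [qt _] s [qs _]; apply: nB; rewrite -(padic_ball_eq qt).
have m2 : measurable_fun setT (snd : T' -> R).
  apply: (measurability (@RGenOInfty.G R)); first exact: RGenOInfty.measurableE.
  move=> _ [_ [x ->] <-]; rewrite setTI; apply: sigma_boxesP => t /=.
  (* A box of level n around t has length 2^-n < t.2 - x, so it stays to the right of x. *)
  rewrite in_itv/= andbT => xt; have [n nx] := ex_exp2_gt (t.2 - x)^-1.
  exists n => q j [_ /andP[_ tj]] s [_ /andP[js _]] /=; rewrite in_itv/= andbT.
  have p2 : 0 < 2 ^+ n :> R by rewrite exprn_gt0.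
  rewrite -(ltr_pM2l p2); apply: le_lt_trans js.
  move: nx; rewrite -[X in X < _]mul1r ltr_pdivrMr ?subr_gt0// mulrBr => nx.
  by rewrite -lerBlDr in tj; lra.
apply: smallest_sub; first exact: (@sigma_algebra_measurable _ T').
move=> A [[B mB]|[B mB]]; rewrite setTI => <-.
  by rewrite -[X in _ X]setTI; exact: m1.
by rewrite -[X in _ X]setTI; exact: m2.
Qed.

Lemma boxes_cover : exists g : (set M)^nat,
  [/\ forall k, boxes (g k), \bigcup_k g k = setT &
      forall k, exists q j, g k = box q 0 j].
Proof.
pose g k := if @unpickle (rat * int)%type k is Some i then box (ratr i.1) 0 i.2
            else box 0 0 0.
have gE k : exists q j, g k = box q 0 j.
  by rewrite /g; case: unpickle => [i|]; [exists (ratr i.1), i.2|exists 0, 0].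
exists g; split=> //.
  by move=> k; right; have [q [j ->]] := gE k; exists q, 0, j.
apply/seteqP; split=> // t _; have tb := in_box t 0.
have [r rE] := box_rat t.1 0 (Num.ceil (2 ^+ 0 * t.2) - 1).
exists (pickle (r, Num.ceil (2 ^+ 0 * t.2) - 1)); first exact: I.
by rewrite /g pickleK /= -rE.
Qed.

End Boxes.

(** * Integrable functions with zero integral over every box *)

Section Density.
Local Open Scope ereal_scope.
Context d (T : measurableType d) (R : realType) (mu : {measure set T -> \bar R}).
Context (f : T -> \bar R) (mf : measurable_fun setT f).

(* The measurability proof is an argument so that the measure instance below
   can be attached to the head constant. *)
Definition density_pos (_ : measurable_fun setT f) (A : set T) : \bar R :=
  \int[mu]_(x in A) (f^\+ x).
Local Notation nu := (density_pos mf).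

Let nu0 : nu set0 = 0. Proof. exact: integral_set0. Qed.
Let nu_ge0 A : 0 <= nu A. Proof. by apply: integral_ge0 => x _; exact: funepos_ge0. Qed.
Let nu_sigma : semi_sigma_additive nu.
Proof.
move=> F mF tF mUF; rewrite /density_pos ge0_integral_bigcup//.
- by apply: is_cvg_ereal_nneg_natsum_cond => n _ _; exact: nu_ge0.
- exact/measurable_funTS/measurable_funepos.
Qed.
HB.instance Definition _ := isMeasure.Build _ _ _ nu nu0 nu_ge0 nu_sigma.

End Density.

Section BoxIntegrals.
Context (R : realType) (p : nat) (p_pr : prime p).
Local Notation Qp := (padic p_pr).
Local Notation M := (padic p_pr * R)%type.
Context (mu : {measure set M -> \bar R}).

(* The positive and negative parts of f are the densities of two measures that
   coincide on boxes, a pi-system generating the sigma-algebra. *)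
Lemma ae0_of_boxes (f : M -> \bar R) : mu.-integrable setT f ->
  (forall q n j, \int[mu]_(t in box q n j) f t = 0)%E ->
  {ae mu, forall t, f t = 0%E}.
Proof.
move=> intf f0; have mf := measurable_int _ intf.
have mfN : measurable_fun setT (\- f)%E by exact: measurableT_comp.
have intS A : measurable A -> mu.-integrable A f.
  by move=> mA; apply: integrableS intf.
have E A : measurable A -> (\int[mu]_(t in A) f t =
    density_pos mu mf A - density_pos mu mfN A)%E.
  by move=> mA; rewrite integralE /density_pos funeposN.
have fin A : measurable A -> density_pos mu mf A \is a fin_num /\
    density_pos mu mfN A \is a fin_num.
  move=> mA; rewrite /density_pos funeposN; split.
    by apply: integrable_fin_num => //; apply: integrable_funepos => //; exact: intS.
  by apply: integrable_fin_num => //; apply: integrable_funeneg => //; exact: intS.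
have [g [gG gT gE]] := @boxes_cover R p p_pr.
have H A : measurable A -> density_pos mu mf A = density_pos mu mfN A.
  move=> mA; apply: (measure_unique (@boxes R p p_pr) g) => //.
  - exact: measurable_boxes.
  - exact: boxes_setI.
  - move=> _ [->|[q [n [j ->]]]]; first by rewrite !measure0.
    have [f1 f2] := fin _ (measurable_box q n j).
    have := f0 q n j; rewrite E; last exact: measurable_box.
    by move=> /eqP; rewrite sube_eq// ?add0e// => /eqP.
  - move=> k; have [q [j ->]] := gE k.
    by have [] := fin _ (measurable_box q 0 j); rewrite ltey_eq => ->.
have : ae_eq mu setT f (cst 0%E).
  apply: integral_ae_eq => // A _ mA.
  rewrite E// H// integral_cst// mul0e subee//.
  by have [] := fin _ mA.
by apply: filterS => t; apply.
Qed.

End BoxIntegrals.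

Section Haar.
Context (R : realType) (p : nat) (p_pr : prime p).
Local Notation Qp := (padic p_pr).
Local Notation M := (padic p_pr * R)%type.
Context (mu : {measure set M -> \bar R}) (mu_haar : haar_measure mu).
Implicit Types (x t : M) (A : set M).

Lemma measurable_shift x : measurable_fun setT (fun t : M => t + x).
Proof.
have -> : (fun t : M => t + x) = (fun t => (t.1 + x.1, t.2 + x.2)) by [].
apply: measurable_fun_pair.
  exact: (measurableT_comp (padic_measurableD x.1) measurable_fst).
exact: (@measurable_funD _ _ _ _ snd (cst x.2)).
Qed.

Lemma shift_preimage x A : (fun t : M => t + x) @^-1` A = [set - x + a | a in A].
Proof.
apply/seteqP; split=> t /=; first by exists (t + x); rewrite // addrC addrK.
by move=> [a Aa <-]; rewrite addrC addNKr.
Qed.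

Lemma haar_shift x A : measurable A -> mu ((fun t : M => t + x) @^-1` A) = mu A.
Proof. by move=> mA; have [mux _ _] := mu_haar; rewrite shift_preimage mux. Qed.

Lemma ge0_integral_shift x (f : M -> \bar R) : measurable_fun setT f ->
  (forall t, 0 <= f t)%E -> (\int[mu]_t f (t + x)%R = \int[mu]_t f t)%E.
Proof.
move=> mf f0; have mx := measurable_shift x.
transitivity (\int[pushforward mu (fun t : M => t + x)%R]_t f t)%E.
  by rewrite (ge0_integral_pushforward mx).
by apply: eq_measure_integral => A mA _; exact: haar_shift.
Qed.

Lemma integrable_shift x (f : M -> \bar R) : mu.-integrable setT f ->
  mu.-integrable setT (fun t => f (t + x)).
Proof.
move=> /integrableP[mf fi]; apply/integrableP; split.
  exact: (measurableT_comp mf (measurable_shift x)).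
rewrite (ge0_integral_shift x (f := fun t => `|f t|%E))//.
exact: measurableT_comp.
Qed.

Lemma integral_shift x (f : M -> \bar R) : mu.-integrable setT f ->
  (\int[mu]_t f (t + x)%R = \int[mu]_t f t)%E.
Proof.
move=> intf; have mf := measurable_int _ intf.
have mx := measurable_shift x.
transitivity (\int[pushforward mu (fun t : M => t + x)%R]_t f t)%E.
  by rewrite (integral_pushforward mx)//; exact: integrable_shift.
by apply: eq_measure_integral => A mA _; exact: haar_shift.
Qed.

Lemma ae_shift x (P : M -> Prop) :
  {ae mu, forall t, P t} -> {ae mu, forall t, P (t + x)}.
Proof.
move=> [A [mA A0 PA]]; exists ((fun t : M => t + x) @^-1` A); split.
- by rewrite -[X in measurable X]setTI; exact: measurable_shift.
- by rewrite haar_shift.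
- by move=> t /= nP; apply: PA.
Qed.

(** Only the real coordinate of the shift is constrained: it must lie on the grid of step 2^-n for
    boxes of level n to be permuted. *)
Lemma box_shift (q : Qp) n j (k : int) t x : x.2 = k%:~R / 2 ^+ n ->
  box q n j (t + x) <-> box (q - x.1) n (j - k) t.
Proof.
move=> xE; rewrite /box /=.
have -> : 2 ^+ n * (t.2 + x.2) = 2 ^+ n * t.2 + k%:~R.
  by rewrite xE mulrDr [X in _ + X]mulrC divfK// expf_neq0// pnatr_eq0.
have E : padic_ball q n (t.1 + x.1) <-> padic_ball (q - x.1) n t.1.
  by rewrite -padic_ball_shift opprK.
have -> : (j - k)%:~R < 2 ^+ n * t.2 <= (j - k)%:~R + 1 =
    (j%:~R < 2 ^+ n * t.2 + k%:~R <= j%:~R + 1) :> bool.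
  by rewrite intrB; apply/idP/idP => /andP[? ?]; apply/andP; split; lra.
by split=> -[/E ? ?]; split=> //; exact/E.
Qed.

Lemma mu_box q q' n j j' : mu (box q n j) = mu (box q' n j').
Proof.
pose x : M := (q - q', (j - j')%:~R / 2 ^+ n).
have <- : (fun t : M => t + x) @^-1` (box q n j) = box q' n j'.
  apply/seteqP; split=> t /=; rewrite (@box_shift _ _ _ (j - j') _ x)//= !subKr//.
by rewrite haar_shift//; exact: measurable_box.
Qed.

Lemma mu_box_fin q n j : (mu (box q n j) < +oo)%E.
Proof.
have p2 : 0 < 2 ^+ n :> R by rewrite exprn_gt0.
pose I := `[j%:~R / 2 ^+ n, (j%:~R + 1) / 2 ^+ n]%classic : set R.
have [_ muK _] := mu_haar.
apply: (@le_lt_trans _ _ (mu (padic_ball q n `*` I))); last first.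
  apply: muK; apply: compact_setX; first exact: padic_compact_ball.
  exact: segment_compact.
apply: le_measure; rewrite ?inE.
- exact: measurable_box.
- by apply: measurableX; [exact: padic_measurable_ball|exact: measurable_itv].
move=> t [qt /andP[jt tj]]; split=> //=; rewrite /I /= in_itv/=.
by rewrite ler_pdivrMr// ler_pdivlMr// ![_ * 2 ^+ n]mulrC ltW.
Qed.

Lemma mu_box_gt0 q n j : (0 < mu (box q n j))%E.
Proof.
have p2 : 0 < 2 ^+ n :> R by rewrite exprn_gt0.
pose I := `]j%:~R / 2 ^+ n, (j%:~R + 1) / 2 ^+ n[%classic : set R.
have [_ _ muU] := mu_haar.
have oU : open (padic_ball q n `*` I).
  rewrite openE => -[a b] [/= qa Ib]; exists (padic_ball q n, I) => //=; split.
    by apply: open_nbhs_nbhs; split=> //; exact: padic_open_ball.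
  by apply: open_nbhs_nbhs; split=> //; exact: interval_open.
apply: (@lt_le_trans _ _ (mu (padic_ball q n `*` I))).
  apply: muU => //; exists (q, (j%:~R + 2^-1) / 2 ^+ n); split => /=.
    exact: padic_ball_center.
  by rewrite /I /= in_itv/= !ltr_pM2r ?invr_gt0// ltrDl ltrD2l; apply/andP; split; lra.
apply: le_measure; rewrite ?inE.
- by apply: measurableX; [exact: padic_measurable_ball|exact: measurable_itv].
- exact: measurable_box.
move=> t [/= qt]; rewrite /I /= in_itv/= => /andP[jt tj]; split=> //.
by rewrite mulrC -ltr_pdivrMr// -ler_pdivlMr// jt ltW.
Qed.

End Haar.

(** * Calculus in L^2 *)

Section L2Calculus.
Context d (T : measurableType d) (R : realType) (mu : {measure set T -> \bar R}).
Local Notation C := R[i].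
Implicit Types (f g h : T -> C) (u v : T -> R).

Definition cmeasurable f := measurable_fun setT (fun x => complex.Re (f x)) /\
  measurable_fun setT (fun x => complex.Im (f x)).

Definition rint u := mu.-integrable setT (fun x => (u x)%:E).

Definition cint f := rint (fun x => complex.Re (f x)) /\ rint (fun x => complex.Im (f x)).

(** The squared modulus with values in R; the norm of [R[i]] takes its values in [R[i]]. *)
Definition nsq (z : C) : R := complex.Re z ^+ 2 + complex.Im z ^+ 2.

Lemma ReM (z w : C) : complex.Re (z * w) =
  complex.Re z * complex.Re w - complex.Im z * complex.Im w.
Proof. by case: z w => [a b] [c e]. Qed.
Lemma ImM (z w : C) : complex.Im (z * w) =
  complex.Re z * complex.Im w + complex.Im z * complex.Re w.
Proof. by case: z w => [a b] [c e]. Qed.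
Lemma ReD (z w : C) : complex.Re (z + w) = complex.Re z + complex.Re w.
Proof. by case: z w => [a b] [c e]. Qed.
Lemma ImD (z w : C) : complex.Im (z + w) = complex.Im z + complex.Im w.
Proof. by case: z w => [a b] [c e]. Qed.
Lemma ReN (z : C) : complex.Re (- z) = - complex.Re z. Proof. by case: z. Qed.
Lemma ImN (z : C) : complex.Im (- z) = - complex.Im z. Proof. by case: z. Qed.
Lemma ReJ (z : C) : complex.Re z^* = complex.Re z. Proof. by case: z. Qed.
Lemma ImJ (z : C) : complex.Im z^* = - complex.Im z. Proof. by case: z. Qed.
Definition ReImE := (ReM, ImM, ReD, ImD, ReN, ImN, ReJ, ImJ).

Lemma complex_eq (z w : C) : complex.Re z = complex.Re w ->
  complex.Im z = complex.Im w -> z = w.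
Proof. by case: z w => [a b] [c e] /= -> ->. Qed.

Lemma nsqM z w : nsq (z * w) = nsq z * nsq w.
Proof. by rewrite /nsq !ReImE; ring. Qed.

Lemma nsqJ z : nsq z^* = nsq z. Proof. by rewrite /nsq !ReImE sqrrN. Qed.

Lemma nsq_ge0 z : 0 <= nsq z. Proof. by rewrite addr_ge0// sqr_ge0. Qed.

Lemma rint_meas u : rint u -> measurable_fun setT u.
Proof. by move=> /measurable_int/measurable_EFinP. Qed.

Lemma le_rint u v : measurable_fun setT u -> (forall x, `|u x| <= v x) ->
  rint v -> rint u.
Proof.
move=> mu_ uv iv; apply: le_integrable iv => //; first exact/measurable_EFinP.
by move=> x _; rewrite lee_fin (le_trans (uv x))// ler_norm.
Qed.

Lemma rintD u v : rint u -> rint v -> rint (fun x => u x + v x).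
Proof. by move=> iu iv; exact: (integrableD measurableT iu iv). Qed.

Lemma rintZ a u : rint u -> rint (fun x => a * u x).
Proof. by move=> iu; exact: (integrableZl measurableT a iu). Qed.

Lemma rintN u : rint u -> rint (fun x => - u x).
Proof. by move=> /(rintZ (-1)); under eq_fun do rewrite mulN1r. Qed.

Lemma rintB u v : rint u -> rint v -> rint (fun x => u x - v x).
Proof. by move=> iu /rintN; exact: rintD. Qed.

Lemma cmeasM f g : cmeasurable f -> cmeasurable g -> cmeasurable (fun x => f x * g x).
Proof.
move=> [f1 f2] [g1 g2]; split; under eq_fun do rewrite !ReImE.
  by apply: measurable_funB; exact: measurable_funM.
by apply: measurable_funD; exact: measurable_funM.
Qed.

Lemma cmeasJ f : cmeasurable f -> cmeasurable (fun x => (f x)^*).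
Proof.
move=> [f1 f2]; split; under eq_fun do rewrite !ReImE; first exact: f1.
exact: measurable_funN.
Qed.

Lemma cmeas_cst a : cmeasurable (fun=> a).
Proof. by split; exact: measurable_cst. Qed.

Lemma cmeas_real u : measurable_fun setT u -> cmeasurable (fun x => (u x)%:C%C).
Proof. by move=> mu_; split => //=; exact: measurable_cst. Qed.

Lemma cmeas_nsq f : cmeasurable f -> measurable_fun setT (fun x => nsq (f x)).
Proof. by move=> [f1 f2]; apply: measurable_funD; exact: measurable_funX. Qed.

Lemma Lfun2P u : u \in Lfun mu 2%:E <->
  measurable_fun setT u /\ rint (fun x => u x ^+ 2).
Proof.
split=> [uL|[mu_ iu]].
  split; last exact: Lfun2_integrable_sqr uL.
  by move: uL; rewrite inE => /andP[/[!inE]].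
rewrite inE; apply/andP; split; rewrite inE//=.
rewrite /finite_norm unlock; apply: poweR_lty.
have := iu => /integrableP[_]; apply: le_lt_trans.
apply: ge0_le_integral => //.
- by move=> x _; rewrite poweR_ge0.
- apply/measurable_EFinP.
  apply/(@measurableT_comp _ _ _ _ _ _ (fun x : R => x `^ 2)%R) => //.
  exact/measurableT_comp.
- by apply: measurableT_comp => //; apply/measurable_EFinP; exact: measurable_funX.
by move=> x _; rewrite /= lee_fin powR_mulrn// -normrX.
Qed.

Lemma L2predP f : f \in L2pred mu <-> cmeasurable f /\ rint (fun x => nsq (f x)).
Proof.
split.
  rewrite inE => /andP[/Lfun2P[f1 i1] /Lfun2P[f2 i2]]; split => //.
  exact: rintD.
move=> [mf i]; have [f1 f2] := mf; rewrite inE; apply/andP; split; apply/Lfun2P.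
  split=> //; apply: le_rint i; first exact: measurable_funX.
  by move=> x; rewrite ger0_norm ?sqr_ge0// lerDl sqr_ge0.
split=> //; apply: le_rint i; first exact: measurable_funX.
by move=> x; rewrite ger0_norm ?sqr_ge0// lerDr sqr_ge0.
Qed.

Lemma L2pred_mul c f (K : R) : cmeasurable c -> (forall x, nsq (c x) <= K) ->
  f \in L2pred mu -> (fun x => c x * f x) \in L2pred mu.
Proof.
move=> mc cK /L2predP[mf i]; apply/L2predP; split; first exact: cmeasM.
have mcf := cmeasM mc mf.
apply: (@le_rint _ (fun x => K * nsq (f x))); first exact: cmeas_nsq.
  by move=> x; rewrite ger0_norm ?nsq_ge0// nsqM ler_wpM2r// nsq_ge0.
exact: rintZ.
Qed.

Lemma L2pred_conj f : f \in L2pred mu -> (fun x => (f x)^*) \in L2pred mu.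
Proof.
move=> /L2predP[mf i]; apply/L2predP; split; first exact: cmeasJ.
by under eq_fun do rewrite nsqJ.
Qed.

(** The bound |ab| <= a^2 + b^2 dominates both components of the product by [nsq] of f plus [nsq] of
    g. *)
Lemma cint_mul f g : f \in L2pred mu -> g \in L2pred mu -> cint (fun x => f x * g x).
Proof.
move=> /L2predP[mf fi] /L2predP[mg gi]; have [m1 m2] := cmeasM mf mg.
have AB (a b : R) : `|a * b| <= a ^+ 2 + b ^+ 2.
  rewrite normrM -(real_normK (num_real a)) -(real_normK (num_real b)).
  have := sqr_ge0 (`|a| - `|b|); have := normr_ge0 a; have := normr_ge0 b; nra.
have bnd z w : `|complex.Re (z * w)| <= nsq z + nsq w /\
               `|complex.Im (z * w)| <= nsq z + nsq w.
  rewrite !ReImE /nsq; split; rewrite (le_trans (ler_normD _ _))// ?normrN.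
    by rewrite addrACA lerD.
  by rewrite [leRHS]addrACA [X in _ <= _ + X]addrC addrACA lerD// addrC.
split; [apply: (le_rint m1 _ (rintD fi gi))|apply: (le_rint m2 _ (rintD fi gi))].
  by move=> x; have [] := bnd (f x) (g x).
by move=> x; have [] := bnd (f x) (g x).
Qed.

Lemma cint_cmeas f : cint f -> cmeasurable f.
Proof. by move=> [f1 f2]; split; exact: rint_meas. Qed.

Lemma cintD f g : cint f -> cint g -> cint (fun x => f x + g x).
Proof. by move=> [f1 f2] [g1 g2]; split; under eq_fun do rewrite !ReImE; exact: rintD. Qed.

Lemma cintZ a f : cint f -> cint (fun x => a * f x).
Proof.
move=> [f1 f2]; split; under eq_fun do rewrite !ReImE.
  by apply: rintB; exact: rintZ.
by apply: rintD; exact: rintZ.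
Qed.

Lemma CintegralD f g : cint f -> cint g ->
  Cintegral mu (fun x => f x + g x) = Cintegral mu f + Cintegral mu g.
Proof.
move=> [f1 f2] [g1 g2]; apply: complex_eq; rewrite ?ReImE /=.
  by under eq_Rintegral do rewrite ReImE; rewrite RintegralD.
by under eq_Rintegral do rewrite ReImE; rewrite RintegralD.
Qed.

Lemma CintegralZ a f : cint f ->
  Cintegral mu (fun x => a * f x) = a * Cintegral mu f.
Proof.
move=> [f1 f2]; apply: complex_eq; rewrite ?ReImE /=.
  under eq_Rintegral do rewrite ReImE.
  by rewrite RintegralB// ?RintegralZl//; exact: rintZ.
under eq_Rintegral do rewrite ReImE.
by rewrite RintegralD// ?RintegralZl//; exact: rintZ.
Qed.

Lemma CintegralJ f : cint f -> Cintegral mu (fun x => (f x)^*) = (Cintegral mu f)^*.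
Proof.
move=> [f1 f2]; apply: complex_eq; rewrite ?ReImE /=.
  by apply: eq_Rintegral => x _; rewrite ReImE.
under eq_Rintegral do rewrite ReImE -mulN1r.
by rewrite RintegralZl// mulN1r.
Qed.

Lemma eq_Cintegral f g : f =1 g -> Cintegral mu f = Cintegral mu g.
Proof. by move=> /funext ->. Qed.

Lemma ae_eq_Cintegral f g : cmeasurable f -> cmeasurable g ->
  {ae mu, forall x, f x = g x} -> Cintegral mu f = Cintegral mu g.
Proof.
move=> [f1 f2] [g1 g2] fg; rewrite /Cintegral /Rintegral; congr (Complex (fine _) (fine _)).
  apply: ae_eq_integral => //; [exact/measurable_EFinP|exact/measurable_EFinP|].
  by apply: filterS fg => x /= ->.
apply: ae_eq_integral => //; [exact/measurable_EFinP|exact/measurable_EFinP|].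
by apply: filterS fg => x /= ->.
Qed.

Section DominatedLimit.
Context (a_ : nat -> T -> R) (a : T -> R) (K : R).
Hypotheses (ma_ : forall n, measurable_fun setT (a_ n)) (a_K : forall n x, `|a_ n x| <= K).
Hypothesis a_a : forall x, (a_ ^~ x) @ \oo --> a x.

Lemma lim_measurable : measurable_fun setT a.
Proof. by apply: (measurable_fun_cvg ma_) => x _; exact: a_a. Qed.

Lemma lim_bounded x : `|a x| <= K.
Proof.
have H : (fun n => `|a_ n x|) @ \oo --> `|a x| by apply: cvg_norm; exact: a_a.
rewrite -(cvg_lim _ H)//; apply: limr_le; first by apply/cvg_ex; exists `|a x|.
by apply: nearW => n.
Qed.

(** Dominated convergence with dominating function K |u|. It carries vanishing integrals along
    bounded pointwise limits, both for test functions and for commutants. *)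
Lemma integral_lim0 u : rint u ->
  (forall n, \int[mu]_x (a_ n x * u x)%:E = 0)%E -> (\int[mu]_x (a x * u x)%:E = 0)%E.
Proof.
move=> iu i0; have mu_ := rint_meas iu.
have [|||||] // := @dominated_convergence _ _ _ mu setT measurableT
  (fun n x => (a_ n x * u x)%:E) (fun x => (a x * u x)%:E) (fun x => (K * `|u x|)%:E).
- by move=> n; apply/measurable_EFinP; exact: measurable_funM.
- by apply/measurable_EFinP; apply: measurable_funM => //; exact: lim_measurable.
- apply: aeW => x _; apply/cvg_EFin; first exact: nearW.
  by apply: cvgMl; exact: a_a.
- by apply: rintZ; apply: (integrable_norm iu).
- by apply: aeW => x n _; rewrite lee_fin normrM ler_wpM2r.
move=> _ _ H; rewrite -(cvg_lim _ H)//.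
rewrite (_ : [sequence _]_n = cst 0%E) ?lim_cst//.
by apply/funext => n /=; rewrite i0.
Qed.
End DominatedLimit.

Section L2Classes.
Implicit Types (F G H : L2 mu).
Local Notation L2pr := (L2pred mu).

Definition rep F : T -> C := L2fun_val (repr F).

Lemma repP F : rep F \in L2pr. Proof. exact: valP (repr F). Qed.

Lemma rep_cmeas F : cmeasurable (rep F). Proof. by have /L2predP[] := repP F. Qed.

Lemma L2class_in f (fP : f \in L2pr) : L2class mu f = L2pi (MkL2fun fP).
Proof. by rewrite /L2class /insubd insubT. Qed.

Lemma L2class_rep F : L2class mu (rep F) = F.
Proof.
rewrite (L2class_in (repP F)) -[RHS]L2piK; congr L2pi; exact: val_inj.
Qed.

Lemma L2classP f g : f \in L2pr -> g \in L2pr ->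
  L2class mu f = L2class mu g <-> {ae mu, forall x, f x = g x}.
Proof.
move=> fP gP; rewrite (L2class_in fP) (L2class_in gP) L2piP; split.
  by move=> /asboolP; apply: filterS => x /= /eqP; rewrite subr_eq0 => /eqP.
move=> fg; apply/asboolP; apply: filterS fg => x fgx.
have -> : (MkL2fun fP - MkL2fun gP : L2fun mu) x = f x - g x by [].
by rewrite fgx subrr.
Qed.

Lemma rep_class f : f \in L2pr -> {ae mu, forall x, rep (L2class mu f) x = f x}.
Proof. by move=> fP; apply/L2classP => //; [exact: repP|rewrite L2class_rep]. Qed.

Lemma L2eqP F G : F = G <-> {ae mu, forall x, rep F x = rep G x}.
Proof.
by rewrite -[in F = _](L2class_rep F) -[in _ = G](L2class_rep G); apply: L2classP; exact: repP.
Qed.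

Lemma L2predD f g : f \in L2pr -> g \in L2pr -> (fun x => f x + g x) \in L2pr.
Proof. by move=> fP gP; exact: rpredD. Qed.

Lemma L2predZ a f : f \in L2pr -> (fun x => a * f x) \in L2pr.
Proof. by move=> fP; exact: rpredZ. Qed.

Lemma L2pred0 : (fun=> 0 : C) \in L2pr. Proof. exact: rpred0. Qed.

Lemma L2classD f g : f \in L2pr -> g \in L2pr ->
  L2class mu (fun x => f x + g x) = L2class mu f + L2class mu g.
Proof.
move=> fP gP; rewrite (L2class_in fP) (L2class_in gP) (L2class_in (L2predD fP gP)).
by rewrite -L2piD; congr L2pi; exact: val_inj.
Qed.

Lemma L2classZ a f : f \in L2pr ->
  L2class mu (fun x => a * f x) = a *: L2class mu f.
Proof.
move=> fP; rewrite (L2class_in fP) (L2class_in (L2predZ a fP)).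
rewrite -[RHS]/(L2scale a _) L2piZ; congr L2pi; exact: val_inj.
Qed.

Lemma L2class0 : L2class mu (fun=> 0) = 0.
Proof.
by rewrite -[RHS](scale0r 0) -[X in _ *: X]L2class_rep -L2classZ ?repP//;
  congr L2class; apply/funext => x; rewrite mul0r.
Qed.

Lemma dot_class f g : f \in L2pr -> g \in L2pr ->
  L2dot (L2class mu f) (L2class mu g) = Cintegral mu (fun x => f x * (g x)^*).
Proof.
move=> fP gP; apply: ae_eq_Cintegral.
- by apply/cmeasM/cmeasJ; exact: rep_cmeas.
- have /L2predP[mf _] := fP; have /L2predP[mg _] := gP.
  exact/cmeasM/cmeasJ.
- by apply: filterS2 (rep_class fP) (rep_class gP) => x; rewrite /rep => -> ->.
Qed.

Lemma dot_cint F G : cint (fun x => rep F x * (rep G x)^*).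
Proof. by apply: cint_mul; [exact: repP|apply: L2pred_conj; exact: repP]. Qed.

Lemma dotDl F G H : L2dot (F + G) H = L2dot F H + L2dot G H.
Proof.
rewrite -{1}(L2class_rep F) -{1}(L2class_rep G) -L2classD ?repP//.
rewrite -{1}(L2class_rep H) dot_class ?repP ?L2predD ?repP//.
under eq_Cintegral do rewrite mulrDl.
by rewrite CintegralD//; exact: dot_cint.
Qed.

Lemma dotZl a F G : L2dot (a *: F) G = a * L2dot F G.
Proof.
rewrite -{1}(L2class_rep F) -L2classZ ?repP//.
rewrite -{1}(L2class_rep G) dot_class ?repP ?L2predZ ?repP//.
under eq_Cintegral do rewrite -mulrA.
by rewrite CintegralZ//; exact: dot_cint.
Qed.

Lemma dotC F G : L2dot G F = (L2dot F G)^*.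
Proof.
rewrite -CintegralJ; last exact: dot_cint.
by apply: eq_Cintegral => x; rewrite rmorphM /= conjCK mulrC.
Qed.

Lemma dotNl F G : L2dot (- F) G = - L2dot F G.
Proof. by rewrite -scaleN1r dotZl mulN1r. Qed.

Lemma dotBl F G H : L2dot (F - G) H = L2dot F H - L2dot G H.
Proof. by rewrite dotDl dotNl. Qed.

Lemma dotDr F G H : L2dot H (F + G) = L2dot H F + L2dot H G.
Proof. by rewrite dotC dotDl rmorphD /= -!dotC. Qed.

Lemma dotZr a F G : L2dot G (a *: F) = a^* * L2dot G F.
Proof. by rewrite dotC dotZl rmorphM /= -dotC. Qed.

Lemma dot0l G : L2dot 0 G = 0.
Proof. by rewrite -(scale0r (0 : L2 mu)) dotZl mul0r. Qed.

End L2Classes.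

End L2Calculus.

(** * A total family of Bruhat-Schwartz functions *)

Section SchwartzTest.
Context (R : realType).
Implicit Types (f g : R -> R) (x a b c : R).

Definition logistic x : R := (1 + expR (- x))^-1.

Lemma logistic_den x : 0 < 1 + expR (- x).
Proof. by rewrite addr_gt0 ?expR_gt0. Qed.

Lemma logistic_gt0 x : 0 < logistic x.
Proof. by rewrite invr_gt0 logistic_den. Qed.

Lemma logisticN x : logistic (- x) = 1 - logistic x.
Proof.
have e0 := expR_gt0 x; have d0 := logistic_den x.
rewrite /logistic opprK; move: d0; rewrite expRN => d0.
by field; rewrite !gt_eqF//= addr_gt0.
Qed.

Lemma logistic_lt1 x : logistic x < 1.
Proof. by rewrite -subr_gt0 -logisticN logistic_gt0. Qed.

Lemma logistic_le_expR x : logistic x <= expR x.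
Proof.
rewrite -[leRHS]invrK -expRN lef_pV2 ?posrE ?expR_gt0 ?logistic_den//.
by rewrite lerDr.
Qed.

Lemma is_derive_affine a b x : is_derive x 1 (fun x => a * x + b) a.
Proof.
have := is_deriveD (is_deriveZ a (is_derive_id x (1 : R))) (is_derive_cst b x (1 : R)).
by rewrite addr0 /GRing.scale /= mulr1.
Qed.

Lemma is_derive_comp_affine f a b x df : is_derive (a * x + b) 1 f df ->
  is_derive x 1 (fun x => f (a * x + b)) (df * a).
Proof.
move=> fE; exact: (@is_derive1_comp _ f (fun x => a * x + b) x df a fE (is_derive_affine a b x)).
Qed.

Lemma is_derive_logistic x : is_derive x 1 logistic (logistic x * (1 - logistic x)).
Proof.
have H : is_derive x 1 (fun x => 1 + expR (- x)) (- expR (- x)).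
  have := is_deriveD (is_derive_cst (1 : R) x (1 : R))
    (is_derive1_comp (is_derive_expR (- x)) (is_deriveNid x (1 : R))).
  by rewrite add0r mulrN1.
have := is_deriveV _ H; rewrite gt_eqF ?logistic_den// => /(_ isT) H1.
apply: (@is_derive_eq _ _ _ logistic _ _ _ _ H1).
rewrite -logisticN /logistic opprK /GRing.scale /=.
have e0 := expR_gt0 x; have := logistic_den x; rewrite expRN => d0.
by field; rewrite !gt_eqF//= addr_gt0.
Qed.

(* Bounded, stable under derivation and under modulation by characters, and
   large enough to approximate the indicators of intervals. *)
Inductive bfun : (R -> R) -> Prop :=
| bfun_cst c : bfun (fun=> c)
| bfun_logistic a b : bfun (fun x => logistic (a * x + b))
| bfun_cos a b : bfun (fun x => cos (a * x + b))
| bfun_sin a b : bfun (fun x => sin (a * x + b))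
| bfun_add f g : bfun f -> bfun g -> bfun (fun x => f x + g x)
| bfun_mul f g : bfun f -> bfun g -> bfun (fun x => f x * g x).

Lemma bfun_derive f : bfun f -> exists g, bfun g /\ forall x, is_derive x 1 f (g x).
Proof.
elim=> {f} [c|a b|a b|a b|f g bf [f' [bf' f'E]] bg [g' [bg' g'E]]|f g bf [f' [bf' f'E]] bg [g' [bg' g'E]]].
- exists (fun=> 0); split; first exact: bfun_cst.
  by move=> x; exact: is_derive_cst.
(* Differences are spelled as sums with a factor -1, the shape that the constructors of [bfun]
   recognise. *)
- exists (fun x => (logistic (a * x + b) * (1 + (- 1) * logistic (a * x + b))) * a); split.
    by do !constructor.
  move=> x; have := is_derive_comp_affine (is_derive_logistic (a * x + b)).
  by rewrite mulN1r.
- exists (fun x => (- 1 * sin (a * x + b)) * a); split; first by do !constructor.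
  move=> x; have := is_derive_comp_affine (is_derive_cos (a * x + b)).
  by rewrite mulN1r.
- exists (fun x => cos (a * x + b) * a); split; first by do !constructor.
  by move=> x; have := is_derive_comp_affine (is_derive_sin (a * x + b)).
- exists (fun x => f' x + g' x); split; first exact: bfun_add.
  by move=> x; exact: is_deriveD.
- exists (fun x => f x * g' x + g x * f' x); split.
    by apply: bfun_add; exact: bfun_mul.
  by move=> x; exact: is_deriveM.
Qed.

Lemma bfun_bounded f : bfun f -> exists K, forall x, `|f x| <= K.
Proof.
elim=> {f} [c|a b|a b|a b|f g bf [K KE] bg [L LE]|f g bf [K KE] bg [L LE]].
- by exists `|c|.
- by exists 1 => x; rewrite ger0_norm ?ltW ?logistic_gt0 ?logistic_lt1.
- by exists 1 => x; rewrite ler_norml cos_geN1 cos_le1.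
- by exists 1 => x; rewrite ler_norml sin_geN1 sin_le1.
- by exists (K + L) => x; rewrite (le_trans (ler_normD _ _))// lerD.
- by exists (K * L) => x; rewrite normrM ler_pM.
Qed.

Lemma bfun_shift f s : bfun f -> bfun (fun x => f (x - s)).
Proof.
have E a b x : a * (x - s) + b = a * x + (b - a * s) by ring.
elim=> {f} [c|a b|a b|a b|f g _ bf _ bg|f g _ bf _ bg].
- exact: bfun_cst.
- by under eq_fun do rewrite E; exact: bfun_logistic.
- by under eq_fun do rewrite E; exact: bfun_cos.
- by under eq_fun do rewrite E; exact: bfun_sin.
- exact: bfun_add.
- exact: bfun_mul.
Qed.

(** The derivative of the logistic function at x + c: positive everywhere, so that it can be divided
    out, and at most exp (-|x + c|). The parameter c absorbs the translations of Weyl operators. *)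
Definition bump c x : R := logistic (x + c) * (1 - logistic (x + c)).

Lemma bump_gt0 c x : 0 < bump c x.
Proof. by rewrite mulr_gt0 ?subr_gt0 ?logistic_gt0 ?logistic_lt1. Qed.

Lemma bump_le1 c x : bump c x <= 1.
Proof.
have := logistic_gt0 (x + c); have := logistic_lt1 (x + c); rewrite /bump; nra.
Qed.

Lemma bump_le_expR c x : bump c x <= expR (- `|x + c|).
Proof.
have l0 := logistic_gt0 (x + c); have l1 := logistic_lt1 (x + c).
have [xc|xc] := ger0P (x + c).
  apply: le_trans (logistic_le_expR _); rewrite logisticN /bump; nra.
by rewrite opprK; apply: le_trans (logistic_le_expR _); rewrite /bump; nra.
Qed.

(** 1 + z <= (m+1) (1 + z/(m+1)) <= (m+1) exp (z/(m+1)), raised to the power m. Dividing by m + 1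
    rather than m keeps the case m = 0 harmless. *)
Lemma expR_pow_bound m (z : R) : 0 <= z -> (1 + z) ^+ m <= m.+1%:R ^+ m * expR z.
Proof.
move=> z0; have m0 : 0 < m.+1%:R :> R by rewrite ltr0n.
have H : 1 + z <= m.+1%:R * expR (z / m.+1%:R).
  apply: (@le_trans _ _ (m.+1%:R * (1 + z / m.+1%:R))).
    by rewrite mulrDr mulr1 mulrC divfK ?gt_eqF// lerD2r ler1n.
  by rewrite ler_pM2l// expR_ge1Dx.
apply: (@le_trans _ _ ((m.+1%:R * expR (z / m.+1%:R)) ^+ m)).
  by rewrite lerXn2r// nnegrE ?addr_ge0// mulr_ge0 ?expR_ge0// ltW.
rewrite exprMn; apply: ler_wpM2l; first by rewrite exprn_ge0// ltW.
rewrite -expRM_natl ler_expR mulrCA.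
by rewrite ler_piMr// ler_pdivrMr// mul1r ler_nat.
Qed.

Lemma bump_decay c m : exists B, forall x, `|x| ^+ m * bump c x <= B.
Proof.
exists ((1 + `|c|) ^+ m * m.+1%:R ^+ m) => x.
have xc : `|x| <= (1 + `|c|) * (1 + `|x + c|).
  have : `|x| <= `|x + c| + `|c| by rewrite -{1}(addrK c x) ler_normB.
  have := normr_ge0 (x + c); have := normr_ge0 c; nra.
apply: (@le_trans _ _ (((1 + `|c|) * (1 + `|x + c|)) ^+ m * expR (- `|x + c|))).
  rewrite ler_pM ?exprn_ge0 ?bump_le_expR ?(ltW (bump_gt0 _ _))//.
  by rewrite lerXn2r// nnegrE ?mulr_ge0 ?addr_ge0.
rewrite exprMn -mulrA ler_wpM2l ?exprn_ge0 ?addr_ge0//.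
by rewrite expRN ler_pdivrMr ?expR_gt0// expR_pow_bound.
Qed.

Lemma derive1n_inv (P : (R -> R) -> Prop) : 
  (forall f, P f -> exists2 g, P g & forall x, is_derive x 1 f (g x)) ->
  forall f, P f -> forall n, P (derive1n n f).
Proof.
move=> H f Pf; elim=> [//|n IH]; rewrite derive1nS.
have [g Pg gE] := H _ IH.
have -> // : (derive1n n f)^`()%classic = g.
by apply/funext => x; rewrite derive1E; apply: derive_val; exact: gE.
Qed.

(** Since bump' = bump (1 - 2 logistic), the products of the bump with functions in [bfun] are
    stable under derivation; each is a rapidly decreasing factor times a bounded one. *)
Lemma schwartz_bump c f : bfun f -> schwartz_real (fun x => bump c x * f x).
Proof.
move=> bf; pose P (h : R -> R) := exists2 g, bfun g & h = fun x => bump c x * g x.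
have Pd h : P h -> exists2 k, P k & forall x, is_derive x 1 h (k x).
  move=> [g bg ->]; have [g' [bg' g'E]] := bfun_derive bg.
  exists (fun x => bump c x * ((1 + (- 2) * logistic (1 * x + c)) * g x + g' x)).
    by eexists; last reflexivity; do !constructor.
  move=> x.
  have lE : is_derive x 1 (fun x => logistic (x + c)) (logistic (x + c) * (1 - logistic (x + c))).
    have := @is_derive_comp_affine _ 1 c x _ (is_derive_logistic (1 * x + c)).
    by rewrite mulr1; under eq_fun do rewrite mul1r; rewrite mul1r.
  have bE : is_derive x 1 (bump c) (bump c x * (1 - 2 * logistic (x + c))).
    have := is_deriveM lE (is_deriveB (is_derive_cst (1 : R) x 1) lE).
    move=> H; apply: (@is_derive_eq _ _ _ (bump c) _ _ _ _ H).
    have -> : (cst 1 - (fun x => logistic (x + c))) x = 1 - logistic (x + c) by [].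
    by rewrite /bump /GRing.scale /=; ring.
  apply: (@is_derive_eq _ _ _ _ _ _ _ _ (is_deriveM bE (g'E x))).
  by rewrite /GRing.scale /= mul1r; ring.
have Pn := derive1n_inv Pd (ex_intro2 _ _ f bf erefl).
split=> [n x|m n]; first by have [k _ kE] := Pd _ (Pn n); case: (kE x).
have [g bg ->] := Pn n; have [K gK] := bfun_bounded bg.
have [B bB] := bump_decay c m; exists (B * K) => x.
have K0 : 0 <= K by apply: le_trans (gK 0).
rewrite mulrA normrM ler_pM//.
by rewrite normrM normrX (ger0_norm (ltW (bump_gt0 c x))).
Qed.

Lemma bfun_measurable f : bfun f -> measurable_fun setT f.
Proof.
move=> /bfun_derive[g [_ gE]]; apply: continuous_measurable_fun => x.
by apply: differentiable_continuous; apply/derivable1_diffP; case: (gE x).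
Qed.

Lemma measurable_bump c : measurable_fun setT (bump c).
Proof.
have -> : bump c = fun x => logistic (1 * x + c) * (1 + (- 1) * logistic (1 * x + c)).
  by apply/funext => x; rewrite /bump mul1r mulN1r.
by apply: bfun_measurable; do !constructor.
Qed.

End SchwartzTest.

Section TestFunctions.
Context (R : realType) (p : nat) (p_pr : prime p).
Local Notation Qp := (padic p_pr).
Local Notation M := (padic p_pr * R)%type.
Local Notation C := R[i].
Implicit Types (q : Qp) (n : nat) (t : M) (b : R -> R).

Lemma bruhat_schwartz_tensor q n (phi : Qp -> C) (psi : R -> C) :
  (forall x, exists m, forall y, padic_ball x m y -> phi y = phi x) ->
  (forall x, ~ padic_ball q n x -> phi x = 0) -> schwartz psi ->
  bruhat_schwartz (fun t : M => phi t.1 * psi t.2).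
Proof.
move=> lc supp spsi; exists 1%N, (fun=> phi), (fun=> psi); split; last first.
  by move=> t; rewrite big_ord1.
move=> _; split=> //.
  by move=> x; have [m mE] := lc x; apply/padic_nbhsP; exists m.
rewrite /compactly_supported; apply: (subclosed_compact _ (@padic_compact_ball p p_pr q n)).
  exact: closed_closure.
apply: (subset_trans (closure_subset (B := padic_ball q n) _)).
  by move=> x /=; apply: contra_neqP => /supp.
by rewrite -(closure_id _).1//; exact: padic_closed_ball.
Qed.

Definition ballC q n : Qp -> C := fun x => (\1_(padic_ball q n) x)%:C%C.

Lemma ballC_lc q n x y : padic_ball x n y -> ballC q n y = ballC q n x.
Proof.
move=> xy; rewrite /ballC !indicE; congr ((_ : bool)%:R%:C%C).
apply/idP/idP; rewrite !inE => H.
  by rewrite (padic_ball_eq H); exact: padic_ball_sym.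
by rewrite (padic_ball_eq H).
Qed.

(** Test functions are real, so that a vanishing pairing with them separates into its real and
    imaginary parts. *)
Definition testr q n b : M -> R := fun t => \1_(padic_ball q n) t.1 * (bump 0 t.2 * b t.2).

Definition testf q n b : M -> C := fun t => (testr q n b t)%:C%C.

Lemma testr_measurable q n b : bfun b -> measurable_fun setT (testr q n b).
Proof.
move=> bb; apply: measurable_funM.
  apply: (@measurableT_comp _ _ _ _ _ _ (\1_(padic_ball q n) : Qp -> R)) => //.
  by apply: measurable_indic; exact: padic_measurable_ball.
apply: measurable_funM.
  exact: (measurableT_comp (measurable_bump 0)).
exact: (measurableT_comp (bfun_measurable bb)).
Qed.

Lemma bruhat_schwartz_testf q n b : bfun b -> bruhat_schwartz (testf q n b).
Proof.
move=> bb; rewrite (_ : testf q n b = fun t => ballC q n t.1 * (bump 0 t.2 * b t.2)%:C%C).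
  apply: (@bruhat_schwartz_tensor q n (ballC q n) (fun x => (bump 0 x * b x)%:C%C)).
  - by move=> x; exists n => y; exact: ballC_lc.
  - by move=> x nx; rewrite /ballC indicE memNset.
  split => /=; first exact: schwartz_bump.
  have := schwartz_bump 0 (bfun_cst (0 : R)).
  by under eq_fun do rewrite mulr0.
by apply/funext => t; rewrite /testf rmorphM.
Qed.

Context (mu : {measure set M -> \bar R}) (mu_haar : haar_measure mu).

(** The real coordinate lies in ]k, k+1] or ]-k-1, -k], where the bump is at most 2^-k. *)
Let strip q k : set M := box q 0 (Posz k) `|` box q 0 (- (Posz k) - 1).

Lemma expR_half k (x : R) : k%:R <= `|x| -> bump 0 x <= 2 ^- k.
Proof.
move=> kx; apply: (le_trans (bump_le_expR _ _)); rewrite addr0.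
apply: (@le_trans _ _ (expR (- k%:R))); first by rewrite ler_expR lerN2.
rewrite expRN lef_pV2 ?posrE ?exprn_gt0 ?expR_gt0// -[k%:R]mulr1 expRM_natl.
by rewrite lerXn2r ?nnegrE ?expR_ge0//; have := expR_ge1Dx (1 : R); lra.
Qed.

(** The support is covered by strips of measure at most c, uniformly in k; the integral is dominated
    by the geometric series of the c 2^-k. *)
Lemma rint_ball_bump q n : rint mu (testr q n (fun=> 1)).
Proof.
have mt := testr_measurable q n (bfun_cst 1).
have t0 q' n' t : 0 <= testr q' n' (fun=> 1) t.
  by rewrite /testr mulr1 mulr_ge0// ltW// bump_gt0.
have strip_cover t : padic_ball q 0 t.1 -> exists2 k, strip q k t & k%:R <= `|t.2|.
  move=> qt; have [] := in_box t 0; rewrite expr0 mul1r; set j := Num.ceil _ - 1.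
  move=> _ /andP[jt tj]; case: j jt tj => k kt tk.
    exists k; last by rewrite ger0_norm ltW// (le_lt_trans _ kt)// ler0n.
    by left; split=> //; rewrite expr0 mul1r kt.
  exists k.
    right; split=> //; rewrite expr0 mul1r; move: kt tk.
    by rewrite NegzE -addn1 PoszD opprD => -> ->.
  move: tk; rewrite NegzE mulrNz -pmulrn -natr1 opprD addrNK => tk.
  have tle0 : t.2 <= 0 by apply: (le_trans tk); rewrite oppr_le0 ler0n.
  by rewrite ler0_norm// lerNr.
have mS k : measurable (strip q k) by apply: measurableU; exact: measurable_box.
pose c := fine (mu (box q 0 0)) *+ 2.
have muS k : (mu (strip q k) <= c%:E)%E.
  apply: (le_trans (measureU2 _ _ _)); rewrite ?measurable_box//; try exact: measurable_box.
  have fin : mu (box q 0 0) \is a fin_num by rewrite ge0_fin_numE// mu_box_fin.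
  rewrite /c mulr2n EFinD fineK//.
  by apply: leeD; rewrite le_eqVlt; apply/orP; left; apply/eqP; exact: mu_box.
pose u k t : \bar R := ((2 ^- k) * \1_(strip q k) t)%:E.
have mu_ k : measurable_fun setT (u k).
  by apply/measurable_EFinP; apply: measurable_funM => //; exact: measurable_indic.
have u0 k t : (0 <= u k t)%E by rewrite lee_fin mulr_ge0// invr_ge0 exprn_ge0.
apply/integrableP; split; first exact/measurable_EFinP.
apply: (@le_lt_trans _ _ (\int[mu]_t \sum_(k <oo) u k t)%E).
  apply: ge0_le_integral => //.
  - by apply: measurableT_comp => //; exact/measurable_EFinP.
  - by apply: ge0_emeasurable_sum => //.
  move=> t _; rewrite gee0_abs ?lee_fin//.
  have [qt|qt] := pselect (padic_ball q n t.1); last first.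
    by rewrite /testr indicE memNset// mul0r; apply: nneseries_ge0.
  have qt0 : padic_ball q 0 t.1 by apply: (padic_ball_sub (padic_ball_center q 0) (leq0n n)).
  have [k kt kle] := strip_cover t qt0.
  apply: (@le_trans _ _ (u k t)).
    by rewrite /u /testr !indicE !mem_set// mul1r !mulr1 lee_fin expR_half.
  apply: le_trans (nneseries_lim_ge (P := xpredT) k.+1 _) => //.
  by rewrite big_nat_recr//= leeDr// sume_ge0.
rewrite integral_nneseries//.
apply: (@le_lt_trans _ _ (\sum_(k <oo) ((c * 2) / (2 ^ (k + 1))%:R)%:E)%E).
  apply: lee_nneseries => [k _ _|k _]; first exact: integral_ge0.
  rewrite /u; under eq_integral do rewrite EFinM.
  rewrite ge0_integralZl//; last exact/measurable_EFinP/measurable_indic.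
  rewrite integral_indic// setIT.
  apply: (@le_trans _ _ ((2 ^- k)%:E * c%:E)%E).
    by rewrite lee_wpmul2l// lee_fin invr_ge0 exprn_ge0.
  have p0 : (2 : R) ^+ k != 0 by rewrite expf_neq0// pnatr_eq0.
  suff -> : c * 2 / (2 ^ (k + 1))%:R = 2 ^- k * c by rewrite EFinM.
  by rewrite addn1 expnSr natrM natrX; field.
have H := @cvg_geometric_eseries_half R (c * 2) 0.
by rewrite (cvg_lim _ H)// ltry.
Qed.

Lemma rint_testr q n b : bfun b -> rint mu (testr q n b).
Proof.
move=> bb; have [K bK] := bfun_bounded bb.
apply: (le_rint (testr_measurable q n bb) _ (rintZ K (rint_ball_bump q n))) => t.
have t0 : 0 <= \1_(padic_ball q n) t.1 * bump 0 t.2 :> R.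
  by rewrite mulr_ge0// ltW// bump_gt0.
by rewrite /testr mulr1 mulrA normrM (ger0_norm t0) mulrC ler_wpM2r.
Qed.

Lemma testf_cint q n b : bfun b -> cint mu (testf q n b).
Proof.
move=> bb; split; first exact: rint_testr.
rewrite /rint /=; exact: integrable0.
Qed.

Lemma testf_L2 q n b : bfun b -> testf q n b \in L2pred mu.
Proof.
move=> bb; apply/L2predP; split; first exact: (cmeas_real (testr_measurable q n bb)).
rewrite (_ : (fun t => _) = fun t => testr q n b t ^+ 2); last first.
  by apply/funext => t; rewrite /nsq /= expr0n addr0.
(* The square is the test function of b^2 times one more bump, which is at most 1. *)
have -> : (fun t => testr q n b t ^+ 2) = (fun t => testr q n (fun x => b x * b x) t * bump 0 t.2).
  apply/funext => t; rewrite /testr indicE; case: (_ \in _); rewrite ?mul0r ?expr0n// !mul1r.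
  by ring.
have bb2 := bfun_mul bb bb; have mt := testr_measurable q n bb2.
apply: (le_rint _ _ (integrable_norm (rint_testr q n bb2))) => [|t].
  by apply: measurable_funM => //; exact: (measurableT_comp (measurable_bump 0)).
by rewrite normrM ler_piMr// ger0_norm ?bump_le1// ltW// bump_gt0.
Qed.

End TestFunctions.

Section Totality.
Context (R : realType) (p : nat) (p_pr : prime p).
Local Notation Qp := (padic p_pr).
Local Notation M := (padic p_pr * R)%type.
Local Notation C := R[i].

(** The argument is k^2 (x - a) - k. The square wins for x > a; the term -k decides x = a, where it
    forces the limit 0 and so yields a strict inequality. *)
Lemma logistic_step (a x : R) :
  logistic (k%:R ^+ 2 * x + - (k%:R ^+ 2 * a + k%:R)) @[k --> \oo] --> ((a < x)%R%:R : R).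
Proof.
have E (k : nat) : k%:R ^+ 2 * x + - (k%:R ^+ 2 * a + k%:R) = k%:R ^+ 2 * (x - a) - k%:R.
  by ring.
under eq_cvg do rewrite E.
have [xa|ax] := ltP a x; last first.
  apply: (@squeeze_cvgr _ _ _ _ (cst 0) (fun k => expR (- k%:R))).
  - apply: nearW => k /=; rewrite ltW ?logistic_gt0//=.
    apply: (le_trans (logistic_le_expR _)); rewrite ler_expR gerDr.
    by rewrite mulr_ge0_le0 ?subr_le0// sqr_ge0.
  - exact: cvg_cst.
  - exact: cvgn_expR.
apply: (@squeeze_cvgr _ _ _ _ (fun k => 1 - expR (- k%:R)) (cst 1)).
- have [N NE] : exists N : nat, 2 / (x - a) <= N%:R.
    by exists (Num.truncn (2 / (x - a))).+1; rewrite ltW// truncnS_gt.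
  exists N => // k /= Nk; rewrite (ltW (logistic_lt1 _)) andbT lerBlDr -lerBlDl.
  rewrite -logisticN; apply: (le_trans (logistic_le_expR _)).
  rewrite ler_expR lerN2.
  have : 2 <= k%:R * (x - a).
    by rewrite -ler_pdivrMr ?subr_gt0// (le_trans NE)// ler_nat.
  have := ler0n R k; nra.
- rewrite -[X in _ --> X]subr0; apply: cvgB; first exact: cvg_cst.
  exact: cvgn_expR.
- exact: cvg_cst.
Qed.

Definition step_approx (a c : R) (k : nat) (x : R) : R :=
  logistic (k%:R ^+ 2 * x + - (k%:R ^+ 2 * a + k%:R)) *
  (1 + (- 1) * logistic (k%:R ^+ 2 * x + - (k%:R ^+ 2 * c + k%:R))).

Lemma bfun_step_approx a c k : bfun (step_approx a c k).
Proof. by do !constructor. Qed.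

Lemma step_approx_bounded a c k x : `|step_approx a c k x| <= 1.
Proof.
have l1 (y : R) : `|logistic y| <= 1.
  by rewrite ger0_norm ?(ltW (logistic_lt1 _)) ?(ltW (logistic_gt0 _)).
by rewrite /step_approx mulN1r -logisticN normrM mulr_ile1.
Qed.

Lemma step_approx_cvg a c x :
  step_approx a c k x @[k --> \oo] --> ((a < x <= c)%R%:R : R).
Proof.
have -> : ((a < x <= c)%R%:R : R) = (a < x)%R%:R * (1 + (- 1) * (c < x)%R%:R).
  by rewrite (ltNge c x); case: (a < x); case: (x <= c); rewrite /= ?mulr0n ?mulr1n; ring.
apply: cvgM; first exact: logistic_step.
apply: cvgD; first exact: cvg_cst.
by apply: cvgMr; exact: logistic_step.
Qed.

Context (mu : {measure set M -> \bar R}) (mu_haar : haar_measure mu).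

(** Over a ball of level 0, ball indicator times bump does not vanish, so u = 0 there once the
    product with u has zero integral over all boxes. A smaller ball in the test function gives the
    p-adic side of a box, steep logistic factors its interval. *)
Lemma testr_total (u : M -> R) :
  (forall q n b, bfun b -> rint mu (fun t => testr q n b t * u t)) ->
  (forall q n b, bfun b -> \int[mu]_t (testr q n b t * u t)%:E = 0)%E ->
  {ae mu, forall t, u t = 0}.
Proof.
move=> iu u0; have b1 := bfun_cst (1 : R).
have local_ae (q0 : Qp) : {ae mu, forall t, padic_ball q0 0 t.1 -> u t = 0}.
  have : {ae mu, forall t, (testr q0 0 (fun=> 1) t * u t)%:E = 0%E}.
    apply: ae0_of_boxes; first exact: iu.
    move=> q n j; rewrite integral_mkcond.
    (* Balls are nested or disjoint: the ball of the box lies inside that of q0, or the integrand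
       vanishes on the box. *)
    have [qq|nqq] := pselect (padic_ball q0 0 q); last first.
      rewrite [RHS](_ : 0%E = \int[mu]_x (cst 0%E x))%E; last by rewrite integral0.
      apply: eq_integral => t _; rewrite /patch; case: ifPn => //.
      rewrite inE => -[qt _]; rewrite /testr indicE memNset ?mul0r// => q0t.
      apply: nqq; rewrite (padic_ball_eq q0t).
      by apply: (padic_ball_sub _ (leq0n n) (padic_ball_sym qt)); exact: padic_ball_center.
    transitivity (\int[mu]_t ((j%:~R / 2 ^+ n < t.2 <= (j%:~R + 1) / 2 ^+ n)%R%:R *
       (testr q n (fun=> 1) t * u t))%:E)%E.
      apply: eq_integral => t _; rewrite /patch.
      have p2 : 0 < 2 ^+ n :> R by rewrite exprn_gt0.
      rewrite ltr_pdivrMr// ler_pdivlMr// ![t.2 * _]mulrC.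
      case: ifPn; rewrite ?inE ?notin_setE.
        move=> [qt ->]; rewrite mul1r /testr !indicE !mem_set//.
        by apply: (padic_ball_sub qq (leq0n n)).
      move=> nb; case: (boolP (_ < _ <= _)%R) => jt; last by rewrite mul0r.
      rewrite /testr indicE memNset ?mul0r ?mulr0// => qt; exact: nb.
    apply: (integral_lim0 (a_ := fun k t => step_approx (j%:~R / 2 ^+ n) ((j%:~R + 1) / 2 ^+ n) k t.2) (K := 1)).
    - move=> k; apply: (measurableT_comp (bfun_measurable _)) => //.
      exact: bfun_step_approx.
    - by move=> k t; exact: step_approx_bounded.
    - by move=> t; exact: step_approx_cvg.
    - exact: iu.
    - move=> k; rewrite -[RHS](u0 q n _ (bfun_step_approx (j%:~R / 2 ^+ n) ((j%:~R + 1) / 2 ^+ n) k)).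
      by apply: eq_integral => t _; congr EFin; rewrite /testr; ring.
  apply: filterS => t [+] q0t; rewrite /testr indicE mem_set// mul1r mulr1 => /eqP.
  by rewrite mulf_eq0 gt_eqF ?bump_gt0//= => /eqP.
(* Countably many balls with rational centre cover Q_p, so the null sets can be united. *)
pose Q k : Qp := if @unpickle rat k is Some r then ratr r else 0.
have := ae_foralln (fun k => local_ae (Q k)).
apply: filterS => t H; have [r rE] := padic_ball_rat t.1 0.
apply: (H (pickle r)); rewrite /Q pickleK -rE; exact: padic_ball_center.
Qed.

Lemma testf_total (G : L2 mu) :
  (forall q n b, bfun b -> L2dot G (L2class mu (testf q n b)) = 0) -> G = 0.
Proof.
move=> G0; have tL q n b (bb : bfun b) := testf_L2 mu_haar q n bb.
have iG q n b (bb : bfun b) : cint mu (fun t => testf q n b t * rep G t).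
  by apply: cint_mul; [exact: tL|exact: repP].
have E q n b : bfun b -> Cintegral mu (fun t => testf q n b t * rep G t) = 0.
  move=> bb; rewrite -(G0 q n b bb) -{2}(L2class_rep G) dot_class ?repP ?tL//.
  apply: eq_Cintegral => t; rewrite mulrC; congr (_ * _).
  by apply: complex_eq; rewrite !ReImE//= oppr0.
have iRe q n b (bb : bfun b) : rint mu (fun t => testr q n b t * complex.Re (rep G t)).
  have [i _] := iG q n b bb; move: i.
  by under eq_fun do rewrite ReImE /= mul0r subr0.
have iIm q n b (bb : bfun b) : rint mu (fun t => testr q n b t * complex.Im (rep G t)).
  have [_ i] := iG q n b bb; move: i.
  by under eq_fun do rewrite ReImE /= mul0r addr0.
apply/L2eqP.
have HRe : {ae mu, forall t, complex.Re (rep G t) = 0}.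
  apply: testr_total => // q n b bb; rewrite -[LHS]fineK; last first.
    by apply: integrable_fin_num => //; exact: iRe.
  congr EFin; have /(congr1 (@complex.Re R)) /= := E q n b bb.
  by under eq_Rintegral do rewrite ReImE /= mul0r subr0.
have HIm : {ae mu, forall t, complex.Im (rep G t) = 0}.
  apply: testr_total => // q n b bb; rewrite -[LHS]fineK; last first.
    by apply: integrable_fin_num => //; exact: iIm.
  congr EFin; have /(congr1 (@complex.Im R)) /= := E q n b bb.
  by under eq_Rintegral do rewrite ReImE /= mul0r addr0.
have H0 := rep_class (L2pred0 mu); rewrite L2class0 in H0.
by apply: filterS3 HRe HIm H0 => t r i ->; exact: complex_eq.
Qed.

End Totality.

(** * Covariance of the Weyl operators *)

Section Weyl.
Context (R : realType) (p : nat) (p_pr : prime p).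
Local Notation Qp := (padic p_pr).
Local Notation M := (padic p_pr * R)%type.
Local Notation C := R[i].
Variables (alpha0 : R) (y : Qp).
Local Notation chi := (chi alpha0 y).
Implicit Types (t s x xi : M) (a b : rat).

Lemma scaleM_Dr a x s : scaleM a (x + s) = scaleM a x + scaleM a s.
Proof. by rewrite /scaleM; congr pair => /=; rewrite mulrDr. Qed.

Lemma scaleM_Dl a b x : scaleM (a + b) x = scaleM a x + scaleM b x.
Proof. by rewrite /scaleM padic_ratrD rmorphD; congr pair => /=; rewrite mulrDl. Qed.

Lemma scaleM_M a b x : scaleM (a * b) x = scaleM a (scaleM b x).
Proof. by rewrite /scaleM padic_ratrM rmorphM; congr pair => /=; rewrite mulrA. Qed.

Lemma scaleM_1 x : scaleM 1 x = x.
Proof. by rewrite /scaleM padic_ratr1 rmorph1 !mul1r; case: x. Qed.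

Lemma scaleM_0 x : scaleM 0 x = 0.
Proof. by rewrite /scaleM padic_ratr0 rmorph0 !mul0r. Qed.

Lemma scaleM_N a x : scaleM (- a) x = - scaleM a x.
Proof. by rewrite /scaleM padic_ratrN rmorphN /= !mulNr. Qed.

Lemma scaleM_r0 a : scaleM a 0 = 0 :> M.
Proof. by rewrite /scaleM /= !mulr0. Qed.

Lemma scaleM_rN a x : scaleM a (- x) = - scaleM a x.
Proof. by rewrite /scaleM /= !mulrN. Qed.

Lemma scaleM_half x : scaleM 2^-1 x + scaleM 2^-1 x = x.
Proof. by rewrite -scaleM_Dl -[RHS]scaleM_1; congr scaleM. Qed.

Lemma chiDl t s xi : chi (t + s) xi = chi t xi * chi s xi.
Proof.
rewrite /Defs.chi -[(t + s).1]/(t.1 + s.1) -[(t + s).2]/(t.2 + s.2).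
rewrite (mulrDl t.1) (mulrDl _ _ y) (mulrDl t.2) (mulrDl _ _ alpha0^-1).
by rewrite padic_expeD (expeD (_ / _)) mulrACA.
Qed.

Lemma chiC t xi : chi t xi = chi xi t.
Proof. by rewrite /Defs.chi (mulrC t.1) (mulrC t.2). Qed.

Lemma chiNl t xi : chi (- t) xi = (chi t xi)^*.
Proof. by rewrite /Defs.chi /= !mulNr padic_expeN expeN rmorphM. Qed.

Lemma chiNr t xi : chi t (- xi) = (chi t xi)^*.
Proof. by rewrite chiC chiNl chiC. Qed.

Lemma chiZ a t xi : chi (scaleM a t) xi = chi t (scaleM a xi).
Proof.
rewrite /Defs.chi /=; congr (padic_expe _ _ * expe _); ring.
Qed.

Lemma nsq_chi t xi : nsq (chi t xi) = 1.
Proof. by rewrite /Defs.chi nsqM /padic_expe /nsq !nsq_expe mul1r. Qed.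

Lemma nsqE (z : C) : z * z^* = (nsq z)%:C%C.
Proof. by apply: complex_eq; rewrite !ReImE /nsq /=; ring. Qed.

Lemma chi_conjK t xi : chi t xi * (chi t xi)^* = 1.
Proof. by rewrite nsqE nsq_chi. Qed.

Lemma chi0r t : chi t 0 = 1.
Proof.
by rewrite /Defs.chi /= !mulr0 !mul0r expe0 padic_expe_int ?mulr1//; exact: padic_int0.
Qed.

(** One level serves all x: it depends only on the power of p that clears the denominator of c. *)
Lemma padic_expe_lc (c : Qp) : exists n, forall x z : Qp,
  padic_ball x n z -> padic_expe R (z * c) = padic_expe R (x * c).
Proof.
have [n inc] := padic_int_mulpX c; exists n => x z [w ->].
rewrite mulrDl padic_expeD [X in _ * X]padic_expe_int ?mulr1//.
by rewrite mulrAC; apply: padic_intM => //; exists w.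
Qed.

Lemma chi_cmeas xi : cmeasurable (fun t => chi t xi).
Proof.
apply: cmeasM.
  have [n lc] := padic_expe_lc (xi.1 * y).
  have H d (T : measurableType d) (h : C -> T) :
      measurable_fun setT (fun t : M => h (padic_expe R (t.1 * xi.1 * y))).
    apply: (@measurableT_comp _ _ _ _ _ _ (fun x : Qp => h (padic_expe R (x * xi.1 * y)))) => //.
    apply: padic_measurable_lc => x; exists n => z xz.
    by rewrite -!mulrA (lc _ _ xz).
  split; exact: H.
have m : measurable_fun setT (fun t : M => 2 * pi * (t.2 * xi.2 / alpha0)).
  apply: measurable_funM => //; apply: measurable_funM => //.
  exact: measurable_funM.
split => /=.
  apply: (measurableT_comp _ m); apply: continuous_measurable_fun; exact: continuous_cos.
apply: (measurableT_comp _ m); apply: continuous_measurable_fun; exact: continuous_sin.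
Qed.

Context (mu : {measure set M -> \bar R}) (mu_haar : haar_measure mu).
Local Notation weyl := (weyl alpha0 y (mu := mu)).
Implicit Types (z : M * M) (f g : M -> C) (F G : L2 mu).

Definition weyl_fun z f t : C := chi (t - scaleM 2^-1 z.1) z.2 * f (t - z.1).

Lemma chi_shift_cmeas x xi : cmeasurable (fun t => chi (t - x) xi).
Proof.
under eq_fun do rewrite chiDl; apply: cmeasM; first exact: chi_cmeas.
exact: cmeas_cst.
Qed.

Lemma L2pred_shift f x : f \in L2pred mu -> (fun t => f (t + x)) \in L2pred mu.
Proof.
move=> /L2predP[[f1 f2] i]; apply/L2predP; split.
  by split; [exact: (measurableT_comp f1 (measurable_shift x))|
             exact: (measurableT_comp f2 (measurable_shift x))].
exact: (integrable_shift mu_haar x i).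
Qed.

Lemma weyl_fun_L2 z f : f \in L2pred mu -> weyl_fun z f \in L2pred mu.
Proof.
move=> fP; apply: (@L2pred_mul _ _ _ _ _ _ 1).
- exact: chi_shift_cmeas.
- by move=> t; rewrite nsq_chi.
- exact: L2pred_shift.
Qed.

Lemma weylE z F : weyl z F = L2class mu (weyl_fun z (rep F)).
Proof. by []. Qed.

(** Translation preserves null sets, so any representative may stand for the chosen one. *)
Lemma weyl_class z f : f \in L2pred mu ->
  weyl z (L2class mu f) = L2class mu (weyl_fun z f).
Proof.
move=> fP; apply/L2classP; [exact/weyl_fun_L2/repP|exact: weyl_fun_L2|].
have := ae_shift mu_haar (- z.1) (rep_class fP).
by apply: filterS => t H; rewrite /weyl_fun -H.
Qed.

Lemma Cintegral_shift f x : cint mu f -> Cintegral mu (fun t => f (t + x)) = Cintegral mu f.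
Proof.
move=> [f1 f2]; rewrite /Cintegral /Rintegral; congr (Complex (fine _) (fine _)).
  exact: (integral_shift mu_haar x f1).
exact: (integral_shift mu_haar x f2).
Qed.

Lemma weyl_dot z F G : L2dot (weyl z F) (weyl z G) = L2dot F G.
Proof.
rewrite !weylE dot_class ?weyl_fun_L2 ?repP//.
rewrite -[RHS](Cintegral_shift (- z.1) (dot_cint F G)); apply: eq_Cintegral => t.
by rewrite /weyl_fun rmorphM /= mulrACA chi_conjK mul1r.
Qed.

Lemma weylK z F : weyl z (weyl (- z) F) = F.
Proof.
rewrite [weyl (- z) F]weylE weyl_class ?weyl_fun_L2 ?repP//.
rewrite -[RHS]L2class_rep; congr L2class; apply/funext => t.
rewrite /weyl_fun -[(- z).1]/(- z.1) -[(- z).2]/(- z.2) scaleM_rN !opprK subrK mulrA.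
(* The two phases are taken at the same point with opposite frequencies, hence cancel. *)
have -> : t - z.1 + scaleM 2^-1 z.1 = t - scaleM 2^-1 z.1.
  have h : z.1 - scaleM 2^-1 z.1 = scaleM 2^-1 z.1 by rewrite -{1}(scaleM_half z.1) addrK.
  by rewrite -addrA [- _ + _]addrC -opprB h.
by rewrite chiNr chi_conjK mul1r.
Qed.

Lemma weyl_linear z : linear (weyl z).
Proof.
move=> a F G; rewrite -{1}(L2class_rep F) -{1}(L2class_rep G).
rewrite -L2classZ ?repP// -L2classD ?L2predZ ?repP//.
rewrite weyl_class ?L2predD ?L2predZ ?repP//.
rewrite !weylE -L2classZ ?weyl_fun_L2 ?repP// -L2classD ?L2predZ ?weyl_fun_L2 ?repP//.
by congr L2class; apply/funext => t; rewrite /weyl_fun; ring.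
Qed.

Lemma weyl_unitary z : Defs.is_unitary (weyl z).
Proof.
split; [exact: weyl_linear| |exact: weyl_dot].
by exists (weyl (- z)) => F; [rewrite -[in weyl z _](opprK z)|]; exact: weylK.
Qed.

Lemma weyl0 z : weyl z 0 = 0.
Proof.
by have := weyl_linear z (-1) 0 0; rewrite scaler0 addr0 scaleN1r addNr.
Qed.

Lemma unitary_linear (U : unitary mu) : linear U.
Proof. by have [] := unitaryP U. Qed.

Lemma unitary0 (U : unitary mu) : U 0 = 0.
Proof.
by have := unitary_linear U (-1) 0 0; rewrite scaler0 addr0 scaleN1r addNr.
Qed.

Lemma unitaryB (U : unitary mu) F G : U (F - G) = U F - U G.
Proof. by have := unitary_linear U (-1) G F; rewrite !scaleN1r !(addrC (- _)). Qed.

Lemma unitary_dot (U : unitary mu) F G : L2dot (U F) (U G) = L2dot F G.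
Proof. by have [_ _] := unitaryP U. Qed.

(* V^-1 (V F - W F) is orthogonal to every test function. *)
Lemma isometry_eq (V W : unitary mu) :
  (forall q n (b : R -> R), bfun b -> V (L2class mu (testf q n b)) = W (L2class mu (testf q n b))) ->
  V =1 W.
Proof.
move=> VW F; apply/eqP; rewrite -subr_eq0; apply/eqP.
set D := V F - W F; have DE : V (unitary_inv V D) = D by rewrite unitary_invK.
suff H : unitary_inv V D = 0 by rewrite -DE H unitary0.
apply: (testf_total mu_haar) => q n b bb.
rewrite -(unitary_dot V) DE /D dotBl unitary_dot (VW _ _ _ bb) unitary_dot.
by rewrite subrr.
Qed.

(** On R the Weyl operator translates the bump and multiplies by cos and sin of an affine function,
    which is why [bump] has a parameter and [bfun] contains both. On Q_p it multiplies a translated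
    ball indicator by a locally constant character. *)
Lemma weyl_fun_testf_schwartz z q n (b : R -> R) : bfun b ->
  bruhat_schwartz (weyl_fun z (testf q n b)).
Proof.
move=> bb.
pose k : R := 2 * pi * (z.2.2 / alpha0).
pose l : R := 2 * pi * ((- (scaleM 2^-1 z.1).2) * z.2.2 / alpha0).
pose phi (x1 : Qp) : C := padic_expe R ((x1 - (scaleM 2^-1 z.1).1) * z.2.1 * y) * ballC R q n (x1 - z.1.1).
pose psi (x2 : R) : C := expe ((x2 - (scaleM 2^-1 z.1).2) * z.2.2 / alpha0) *
  (bump 0 (x2 - z.1.2) * b (x2 - z.1.2))%:C%C.
have -> : weyl_fun z (testf q n b) = fun t => phi t.1 * psi t.2.
  apply/funext => t; rewrite /weyl_fun /phi /psi mulrACA /testf /testr.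
  by rewrite [in RHS]/ballC -rmorphM.
have eE (x2 : R) : 2 * pi * ((x2 - (scaleM 2^-1 z.1).2) * z.2.2 / alpha0) = k * x2 + l.
  by rewrite /k /l; ring.
have bE (x2 : R) : bump 0 (x2 - z.1.2) = bump (- z.1.2) x2 by rewrite /bump addr0.
apply: (@bruhat_schwartz_tensor _ _ _ (q + z.1.1) n).
- move=> x1; have [m lc] := padic_expe_lc (z.2.1 * y); exists (maxn m n) => x2 x12.
  rewrite /phi -!mulrA; congr (_ * _).
    apply: lc; rewrite padic_ball_shift subrK.
    by apply: (padic_ball_sub (padic_ball_center _ _)) x12; exact: leq_maxl.
  apply: ballC_lc; rewrite padic_ball_shift subrK.
  by apply: (padic_ball_sub (padic_ball_center _ _)) x12; exact: leq_maxr.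
- move=> x1 nx; rewrite /phi /ballC indicE memNset ?mulr0// => H; apply: nx.
  by rewrite -padic_ball_shift.
- split; rewrite /psi.
    under eq_fun do rewrite ReImE /= mulr0 subr0 eE bE mulrCA.
    by apply: schwartz_bump; apply: bfun_mul; [exact: bfun_cos|exact: bfun_shift].
  under eq_fun do rewrite ReImE /= mulr0 add0r eE bE mulrCA.
  by apply: schwartz_bump; apply: bfun_mul; [exact: bfun_sin|exact: bfun_shift].
Qed.

End Weyl.

(** * Bicharacter identities behind the action of the generators *)

Section Bicharacter.
Context (R : realType) (p : nat) (p_pr : prime p).
Local Notation M := (padic p_pr * R)%type.
Local Notation C := R[i].
Context (c : M -> M -> C).
Hypotheses (cDl : forall t s xi, c (t + s) xi = c t xi * c s xi)
  (cC : forall t xi, c t xi = c xi t) (cNl : forall t xi, c (- t) xi = (c t xi)^*)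
  (cZ : forall a t xi, c (scaleM a t) xi = c t (scaleM a xi))
  (cK : forall t xi, c t xi * (c t xi)^* = 1).
Implicit Types (t x xi h : M).

Let cDr t xi s : c t (xi + s) = c t xi * c t s.
Proof. by rewrite cC cDl !(cC t). Qed.

Let cNr t xi : c t (- xi) = (c t xi)^*.
Proof. by rewrite cC cNl cC. Qed.

(** Compares the integrands of S_J W(x, xi) and W(xi, -x) S_J, the second after the substitution h
    -> h - x. The half shifts balance because c x xi is the square of c x (xi/2). *)
Lemma bichar_fourier t x xi h : (c h t)^* * c (h - scaleM 2^-1 x) xi =
  c (t - scaleM 2^-1 xi) (- x) * (c (h - x) (t - xi))^*.
Proof.
rewrite !(cDl, cDr, cNl, cNr) !cZ !rmorphM /= !conjCK.
rewrite [c xi (scaleM _ x)]cC cZ.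
have -> : c x xi = c x (scaleM 2^-1 xi) * c x (scaleM 2^-1 xi).
  by rewrite -cDr scaleM_half.
have X1 := cK x t; have E1 := cK x (scaleM 2^-1 xi).
rewrite [c t x]cC; move: X1 E1; rewrite !rmorphM /=.
move: (c x t) (c h t) (c x (scaleM 2^-1 xi)) (c h xi) => X A E B X1 E1.
(* Once the factors equal to 1 are inserted, both sides agree as polynomials in the values and their
   conjugates. *)
transitivity ((X * X^*) * (E * E^*) * (A^* * B * E^*)); first by rewrite X1 E1; ring.
by ring.
Qed.

(** Completing the square: in exponents, t^2/2 - (t - x)^2/2 = (t - x/2) x, which adds x to the
    frequency xi. *)
Lemma bichar_chirp t x xi : c t (scaleM 2^-1 t) * c (t - scaleM 2^-1 x) xi =
  c (t - scaleM 2^-1 x) (x + xi) * c (t - x) (scaleM 2^-1 (t - x)).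
Proof.
have E u v : c (t - u) (x + xi) * c (t - x) (v - u) =
    c t x * c t xi * (c u x * c u xi)^* * (c t v * (c t u)^* * (c x v)^* * c x u).
  rewrite !(cDl, cDr, cNl, cNr) !rmorphM /= !conjCK; ring.
have E' u : c (t - u) xi = c t xi * (c u xi)^* by rewrite cDl cNl.
have T1 := cK t (scaleM 2^-1 x); have Q1 := cK x (scaleM 2^-1 x).
rewrite (scaleM_Dr _ t) scaleM_rN E E' !cZ.
have -> : c x (scaleM 2^-1 t) = c t (scaleM 2^-1 x) by rewrite cC cZ.
have -> : c t x = c t (scaleM 2^-1 x) * c t (scaleM 2^-1 x).
  by rewrite -cDr scaleM_half.
move: (c t (scaleM 2^-1 t)) (c t xi) T1 Q1 (c x (scaleM 2^-1 xi)).
move: (c t (scaleM 2^-1 x)) (c x (scaleM 2^-1 x)) => T Q P Z T1 Q1 W.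
rewrite rmorphM /=.
transitivity ((T * T^*) * (T * T^*) * (Q * Q^*) * (P * Z * W^*)); last by ring.
by rewrite T1 Q1; ring.
Qed.

End Bicharacter.

Section Covariance.
Context (R : realType) (p : nat) (p_pr : prime p).
Local Notation Qp := (padic p_pr).
Local Notation M := (padic p_pr * R)%type.
Local Notation C := R[i].
Variables (alpha0 : R) (y : Qp).
Local Notation chi := (Defs.chi alpha0 y).
Context (mu : {measure set M -> \bar R}) (mu_haar : haar_measure mu).
Local Notation weyl := (weyl alpha0 y (mu := mu)).
Local Notation weyl_fun := (weyl_fun alpha0 y).
Implicit Types (z : M * M) (f g : M -> C) (F G : L2 mu).

Lemma sl2_act_J z : sl2_act (gen_mx p genJ) z = (z.2, - z.1).
Proof.
by rewrite /sl2_act !mxE /= !scaleM_0 !scaleM_N !scaleM_1 add0r addr0.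
Qed.

Lemma sl2_act_L z : sl2_act (gen_mx p genL) z = (z.1, z.1 + z.2).
Proof. by rewrite /sl2_act !mxE /= !scaleM_0 !scaleM_1 addr0. Qed.

Lemma sl2_act_D z : sl2_act (gen_mx p genD) z = (scaleM p%:R z.1, scaleM p%:R^-1 z.2).
Proof. by rewrite /sl2_act !mxE /= !scaleM_0 add0r addr0. Qed.

Lemma scaleM_pK x : scaleM p%:R^-1 (scaleM p%:R x) = x :> M.
Proof.
by rewrite -scaleM_M mulVf ?scaleM_1// pnatr_eq0 -lt0n prime_gt0.
Qed.

Lemma cint_unimod (c f : M -> C) : cmeasurable c -> (forall t, nsq (c t) = 1) ->
  cint mu f -> cint mu (fun t => c t * f t).
Proof.
move=> mc c1 fi; have mf := cint_cmeas fi; have [f1 f2] := fi.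
have [m1 m2] := cmeasM mc mf.
have cb t : `|complex.Re (c t)| <= 1 /\ `|complex.Im (c t)| <= 1.
  have := c1 t; rewrite /nsq => H; split; rewrite -(@ler_pXn2r _ 2)// ?nnegrE//.
    by rewrite real_normK ?num_real// expr1n -H lerDl sqr_ge0.
  by rewrite real_normK ?num_real// expr1n -H lerDr sqr_ge0.
have bnd := rintD (integrable_norm f1) (integrable_norm f2).
split; apply: (le_rint _ _ bnd) => // t; have [c1t c2t] := cb t.
  rewrite ReM (le_trans (ler_normB _ _))// !normrM lerD// ler_piMl//.
rewrite ImM (le_trans (ler_normD _ _))// !normrM addrC lerD// ler_piMl//.
Qed.

(** Integrability serves the Fourier case, where the integral is translated by x. For the dilation,
    chi (t/p - x/2) xi = chi (t - p x/2) (xi/p). *)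
Lemma gen_fun_weyl gen z f : cint mu f ->
  gen_fun alpha0 y mu gen (weyl_fun z f) =
  weyl_fun (sl2_act (gen_mx p gen) z) (gen_fun alpha0 y mu gen f).
Proof.
move=> fi; apply/funext => t; case: gen; rewrite ?sl2_act_J ?sl2_act_L ?sl2_act_D.
- case: z => x xi; rewrite /gen_fun /fourier /weyl_fun /=.
  set L := fun h => _; set c := chi _ _.
  pose K h : C := (chi h (t - xi))^* * f h.
  have Ki : cint mu K.
    apply: cint_unimod => // [|h]; last by rewrite nsqJ nsq_chi.
    exact/cmeasJ/chi_cmeas.
  have Kxi : cint mu (fun h => K (h - x)).
    have [k1 k2] := Ki.
    by split; [exact: (integrable_shift mu_haar (- x) k1)|exact: (integrable_shift mu_haar (- x) k2)].
  rewrite -[X in _ = _ * X](Cintegral_shift mu_haar (- x) Ki) -CintegralZ//.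
  apply: eq_Cintegral => h; rewrite /L /K /c [LHS]mulrA [RHS]mulrA; congr (_ * _).
  exact: (bichar_fourier (chiDl alpha0 y) (chiC alpha0 y) (chiNl alpha0 y) (chiZ alpha0 y) (chi_conjK alpha0 y)).
- case: z => x xi; rewrite /gen_fun /weyl_fun /= [LHS]mulrA [RHS]mulrA; congr (_ * _).
  exact: (bichar_chirp (chiDl alpha0 y) (chiC alpha0 y) (chiNl alpha0 y) (chiZ alpha0 y) (chi_conjK alpha0 y)).
- case: z => x xi; rewrite /gen_fun /weyl_fun /= -chiZ !scaleM_Dr !scaleM_rN scaleM_pK.
  by rewrite -(scaleM_M p%:R^-1) [p%:R^-1 * _]mulrC scaleM_M scaleM_pK.
Qed.

(* The Fourier transform of a test function f is not shown to be in L^2: were it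
   not, [gen_unitary] would give U f = 0, hence f = 0, and both sides vanish. *)
Lemma gen_weyl (gen : generator) (U : unitary mu) z F : gen_unitary alpha0 y gen U ->
  U (weyl z F) = weyl (sl2_act (gen_mx p gen) z) (U F).
Proof.
move=> Ugen; set z' := sl2_act _ _.
pose W z0 : unitary mu := MkUnitary (weyl_unitary alpha0 y mu_haar z0).
apply: (@isometry_eq _ _ _ _ mu_haar (unitary_mul U (W z)) (unitary_mul (W z') U)).
move=> q n b bb; set f := testf q n b.
have fP : f \in L2pred mu by exact: testf_L2.
have fi : cint mu f by exact: testf_cint.
rewrite /= weyl_class// Ugen; last exact: weyl_fun_testf_schwartz.
rewrite gen_fun_weyl// -/z' Ugen; last exact: bruhat_schwartz_testf.
have [gP|gP] := boolP (gen_fun alpha0 y mu gen f \in L2pred mu).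
  by rewrite weyl_class.
have g0 : L2class mu (gen_fun alpha0 y mu gen f) = 0.
  rewrite /L2class /insubd insubN//=.
  have <- : L2pi (MkL2fun (L2pred0 mu)) = 0 by rewrite -L2class_in L2class0.
  by congr L2pi; exact: val_inj.
have f0 : L2class mu f = 0.
  have [_ Ub _] := unitaryP U; apply: (bij_inj Ub); rewrite unitary0 -g0.
  by apply: Ugen; exact: bruhat_schwartz_testf.
rewrite g0 weyl0// -gen_fun_weyl// -Ugen; last exact: weyl_fun_testf_schwartz.
by rewrite -weyl_class// f0 weyl0// unitary0.
Qed.

End Covariance.

(** * Schur's lemma *)

Section Multiplication.
Context (R : realType) (p : nat) (p_pr : prime p).
Local Notation Qp := (padic p_pr).
Local Notation M := (padic p_pr * R)%type.
Local Notation C := R[i].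
Context (mu : {measure set M -> \bar R}) (mu_haar : haar_measure mu).
Implicit Types (a b : M -> R) (f g : M -> C) (F G : L2 mu).

Definition bounded_meas a := measurable_fun setT a /\ exists K, forall t, `|a t| <= K.

(** Multipliers are real, so that these operators are self-adjoint; a character enters through its
    real and imaginary parts. *)
Definition mulop a F : L2 mu := L2class mu (fun t => (a t)%:C%C * rep F t).

Lemma nsq_real (x : R) : nsq x%:C%C = x ^+ 2.
Proof. by rewrite /nsq /= expr0n addr0. Qed.

Lemma mulop_L2 a f : bounded_meas a -> f \in L2pred mu ->
  (fun t => (a t)%:C%C * f t) \in L2pred mu.
Proof.
move=> [ma [K aK]] fP; apply: (@L2pred_mul _ _ _ _ _ _ (K ^+ 2)) => //.
move=> t; rewrite nsq_real -real_normK ?num_real// lerXn2r// nnegrE//.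
exact: le_trans (aK t).
Qed.

Lemma mulop_class a f : bounded_meas a -> f \in L2pred mu ->
  mulop a (L2class mu f) = L2class mu (fun t => (a t)%:C%C * f t).
Proof.
move=> ba fP; apply/L2classP; [exact/mulop_L2/repP|exact: mulop_L2|].
by apply: filterS (rep_class fP) => t ->.
Qed.

Lemma bounded_measM a b : bounded_meas a -> bounded_meas b ->
  bounded_meas (fun t => a t * b t).
Proof.
move=> [ma [K aK]] [mb [L bL]]; split; first exact: measurable_funM.
by exists (K * L) => t; rewrite normrM ler_pM.
Qed.

Lemma bounded_measD a b : bounded_meas a -> bounded_meas b ->
  bounded_meas (fun t => a t + b t).
Proof.
move=> [ma [K aK]] [mb [L bL]]; split; first exact: measurable_funD.
by exists (K + L) => t; rewrite (le_trans (ler_normD _ _))// lerD.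
Qed.

Lemma bounded_meas_cst (c : R) : bounded_meas (fun=> c).
Proof. by split; [exact: measurable_cst|exists `|c|]. Qed.

Lemma mulopM a b F : bounded_meas a -> bounded_meas b ->
  mulop (fun t => a t * b t) F = mulop a (mulop b F).
Proof.
move=> ba bb; rewrite [mulop b F]/mulop mulop_class//; last exact/mulop_L2/repP.
by congr L2class; apply/funext => t; rewrite rmorphM mulrA.
Qed.

Lemma mulopD a b F : bounded_meas a -> bounded_meas b ->
  mulop (fun t => a t + b t) F = mulop a F + mulop b F.
Proof.
move=> ba bb; rewrite /mulop -L2classD; [|exact/mulop_L2/repP|exact/mulop_L2/repP].
by congr L2class; apply/funext => t; rewrite rmorphD mulrDl.
Qed.

Lemma mulop_cst (c : R) F : mulop (fun=> c) F = c%:C%C *: F.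
Proof. by rewrite -[in RHS](L2class_rep F) -L2classZ// repP. Qed.

Lemma dot_mulop a F G : bounded_meas a ->
  L2dot (mulop a F) G = Cintegral mu (fun t => (a t)%:C%C * (rep F t * (rep G t)^*)).
Proof.
move=> ba; rewrite -{1}(L2class_rep G) dot_class ?repP//; last exact/mulop_L2/repP.
by apply: eq_Cintegral => t; rewrite mulrA.
Qed.

Lemma mulop_adj a F G : bounded_meas a -> L2dot (mulop a F) G = L2dot F (mulop a G).
Proof.
move=> ba; rewrite dot_mulop// -{2}(L2class_rep F) dot_class ?repP//; last exact/mulop_L2/repP.
apply: eq_Cintegral => t; rewrite rmorphM /= mulrCA; congr (_ * (_ * _)).
by apply: complex_eq; rewrite !ReImE//= oppr0.
Qed.

Section Commutant.
Context (U : unitary mu).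

Definition commutes a := bounded_meas a /\ forall F, U (mulop a F) = mulop a (U F).

Lemma unitaryD F G : U (F + G) = U F + U G.
Proof. by have := unitary_linear U 1 F G; rewrite !scale1r. Qed.

Lemma commutes_cst (c : R) : commutes (fun=> c).
Proof.
by split; [exact: bounded_meas_cst|move=> F; rewrite !mulop_cst unitaryZ].
Qed.

Lemma commutesM a b : commutes a -> commutes b -> commutes (fun t => a t * b t).
Proof.
move=> [ba Ua] [bb Ub]; split; first exact: bounded_measM.
by move=> F; rewrite !mulopM// Ua Ub.
Qed.

Lemma commutesD a b : commutes a -> commutes b -> commutes (fun t => a t + b t).
Proof.
move=> [ba Ua] [bb Ub]; split; first exact: bounded_measD.
by move=> F; rewrite !mulopD// unitaryD Ua Ub.
Qed.

Lemma commutesZ (c : R) a : commutes a -> commutes (fun t => c * a t).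
Proof. exact/commutesM/commutes_cst. Qed.

Lemma commutesB a b : commutes a -> commutes b -> commutes (fun t => a t - b t).
Proof.
move=> ca cb; under eq_fun do rewrite -mulN1r.
by apply: commutesD => //; exact: commutesZ.
Qed.

Lemma commutes_sum n (a_ : 'I_n -> M -> R) : (forall i, commutes (a_ i)) ->
  commutes (fun t => \sum_i a_ i t).
Proof.
elim: n a_ => [|n IH] a_ ca.
  by under eq_fun do rewrite big_ord0; exact: commutes_cst.
by under eq_fun do rewrite big_ord_recl; apply: commutesD => //; exact: IH.
Qed.

(** Rewriting <U(aF), G> as <aF, U^-1 G> shows that the coefficient of U a - a U between F and G is
    the integral of a h, with h integrable and independent of a. Dominated convergence applies, and
    it suffices to let G run through the test functions. *)
Lemma commutes_lim (a_ : nat -> M -> R) a (K : R) :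
  (forall n, commutes (a_ n)) -> (forall n t, `|a_ n t| <= K) ->
  (forall t, a_ n t @[n --> \oo] --> a t) -> commutes a.
Proof.
move=> ca aK a_a; have ma_ n : measurable_fun setT (a_ n) by have [[]] := ca n.
have ba : bounded_meas a.
  split; first exact: lim_measurable ma_ a_a.
  by exists K => t; exact: lim_bounded aK a_a t.
split=> // F; apply/eqP; rewrite -subr_eq0; apply/eqP.
apply: (testf_total mu_haar) => q n b bb; set G := L2class _ _.
pose h t : C := rep F t * (rep (unitary_inv U G) t)^* + (-1) * (rep (U F) t * (rep G t)^*).
have ih : cint mu h by apply: cintD; [exact: dot_cint|apply: cintZ; exact: dot_cint].
have ahi a' : bounded_meas a' -> cint mu (fun t => (a' t)%:C%C * h t) /\
    L2dot (U (mulop a' F) - mulop a' (U F)) G = Cintegral mu (fun t => (a' t)%:C%C * h t).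
  move=> ba'.
  have i1 (F1 G1 : L2 mu) : cint mu (fun t => (a' t)%:C%C * (rep F1 t * (rep G1 t)^*)).
    under eq_fun do rewrite mulrA; apply: cint_mul; first exact/mulop_L2/repP.
    by apply: L2pred_conj; exact: repP.
  have hE : (fun t => (a' t)%:C%C * h t) =
      fun t => (a' t)%:C%C * (rep F t * (rep (unitary_inv U G) t)^*) +
        (-1) * ((a' t)%:C%C * (rep (U F) t * (rep G t)^*)).
    by apply/funext => t; rewrite /h; ring.
  rewrite hE; split; first by apply: cintD => //; exact: cintZ.
  rewrite CintegralD//; last exact: cintZ.
  rewrite CintegralZ// -!dot_mulop// dotBl mulN1r; congr (_ - _).
  by rewrite -[in LHS](unitary_invK U G) unitary_dot.
have H0 k : Cintegral mu (fun t => (a_ k t)%:C%C * h t) = 0.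
  have [bk Uk] := ca k; have [_ <-] := ahi _ bk.
  by rewrite Uk subrr dot0l.
have [[ai1 ai2] ->] := ahi _ ba; have [h1 h2] := ih.
apply: complex_eq; rewrite /= /Rintegral.
  under eq_integral do rewrite ReM /= mul0r subr0.
  rewrite (integral_lim0 ma_ aK a_a h1)// => k.
  have [[i1 _] _] := ahi _ (ca k).1; have /(congr1 (@complex.Re R)) := H0 k.
  rewrite /= /Rintegral => E; rewrite -[LHS]fineK; last first.
    apply: integrable_fin_num => //; move: i1.
    by rewrite /rint; under eq_fun do rewrite ReM /= mul0r subr0.
  by congr EFin; rewrite -[RHS]E; congr fine; apply: eq_integral => t _; rewrite ReM /= mul0r subr0.
under eq_integral do rewrite ImM /= mul0r addr0.
rewrite (integral_lim0 ma_ aK a_a h2)// => k.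
have [[_ i2] _] := ahi _ (ca k).1; have /(congr1 (@complex.Im R)) := H0 k.
rewrite /= /Rintegral => E; rewrite -[LHS]fineK; last first.
  apply: integrable_fin_num => //; move: i2.
  by rewrite /rint; under eq_fun do rewrite ImM /= mul0r addr0.
by congr EFin; rewrite -[RHS]E; congr fine; apply: eq_integral => t _; rewrite ImM /= mul0r addr0.
Qed.

End Commutant.
End Multiplication.

(** * A polynomial iteration converging to the sign function *)

Section SignIteration.
Context (R : realType).
Implicit Types x : R.

(* -1, 0 and 1 are its fixed points, and 0 is repulsive. *)
Definition sign_step x : R := 3 / 2 * x - 1 / 2 * (x * (x * x)).

Lemma sign_step_bounded k x : `|x| <= 1 -> `|iter k sign_step x| <= 1.
Proof.
move=> x1; elim: k => [//|k]; rewrite iterS; move: (iter k _ _) => z.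
rewrite !ler_norml => /andP[z0 z1].
have E1 : 1 - sign_step z = (1 - z) ^+ 2 * (1 + z / 2) by rewrite /sign_step; field.
have E2 : sign_step z + 1 = (1 + z) ^+ 2 * (1 - z / 2) by rewrite /sign_step; field.
rewrite -subr_ge0 opprK E2 -(subr_ge0 _ 1) E1.
by apply/andP; split; rewrite mulr_ge0 ?sqr_ge0//; lra.
Qed.

Lemma iter_sign_stepN k x : iter k sign_step (- x) = - iter k sign_step x.
Proof. by elim: k => [//|k IH]; rewrite !iterS IH /sign_step; ring. Qed.

(** One step multiplies 1 - z by (1 - z)(1 + z/2) = 1 - z/2 - z^2/2, at most 1 - x/2 when z >= x.
    The lower bound x persists because a step does not decrease z on [0, 1]. *)
Lemma iter_sign_step_pos k x : 0 < x <= 1 ->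
  x <= iter k sign_step x <= 1 /\ 1 - iter k sign_step x <= (1 - x / 2) ^+ k.
Proof.
move=> /andP[x0 x1]; elim: k => [|k [/andP[xk k1] IH]].
  by rewrite /= lexx x1 expr0 gerBl ltW.
rewrite iterS; move: (iter k _ _) xk k1 IH => z xz z1 IH.
have E : 1 - sign_step z = (1 - z) * ((1 - z) * (1 + z / 2)) by rewrite /sign_step; field.
have H : (1 - z) * (1 + z / 2) <= 1 - x / 2 by nra.
have H0 : 0 <= (1 - z) * (1 + z / 2) by rewrite mulr_ge0//; lra.
split; last by rewrite E exprSr ler_pM//; lra.
by apply/andP; split; rewrite /sign_step; nra.
Qed.

Lemma sign_step_cvg x : `|x| <= 1 -> iter k sign_step x @[k --> \oo] --> Num.sg x.
Proof.
have pos (z : R) : 0 < z <= 1 -> iter k sign_step z @[k --> \oo] --> (1 : R).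
  move=> z01; have /andP[z0 z1] := z01.
  apply: (@squeeze_cvgr _ _ _ _ (fun k => 1 - (1 - z / 2) ^+ k) (cst 1)).
  - apply: nearW => k; have [/andP[_ ->] H] := iter_sign_step_pos k z01.
    by rewrite andbT lerBlDr -lerBlDl.
  - rewrite -[X in _ --> X]subr0; apply: cvgB; first exact: cvg_cst.
    by apply: cvg_expr; rewrite ger0_norm; lra.
  - exact: cvg_cst.
rewrite ler_norml => /andP[xN1 x1]; have [x0|x0|->] := ltgtP x 0.
- rewrite ltr0_sg//.
  rewrite (_ : (fun k => iter k sign_step x) = fun k => - iter k sign_step (- x)); last first.
    by apply/funext => k; rewrite iter_sign_stepN opprK.
  by apply: cvgN; apply: pos; rewrite oppr_gt0 x0 lerNl.
- by rewrite gtr0_sg//; apply: pos; rewrite x0.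
- rewrite sgr0.
  have E k : iter k sign_step 0 = 0.
    by elim: k => [//|k IH]; rewrite iterS IH /sign_step; ring.
  by under eq_cvg do rewrite E; exact: cvg_cst.
Qed.

(** Stationary for large k: the argument then lies in ]-1, 1[, inside ]-pi, pi[, where sin has the
    sign of its argument. *)
Lemma sg_sin_cvg (b x : R) :
  Num.sg (sin ((x - b) / k.+1%:R)) @[k --> \oo] --> Num.sg (x - b).
Proof.
apply: cvg_near_cst; exists (Num.truncn `|x - b|).+1 => // k /= Nk.
have k0 : 0 < k.+1%:R :> R by rewrite ltr0n.
have lt1 : `|(x - b) / k.+1%:R| < 1.
  rewrite normrM normfV (gtr0_norm k0) ltr_pdivrMr// mul1r.
  by apply: (lt_trans (truncnS_gt _)); rewrite ltr_nat ltnS.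
have pi1 : 1 < pi :> R by have := pi_ge2 R; lra.
move: lt1; rewrite ltr_norml => /andP[l1 l2].
have -> : Num.sg (x - b) = Num.sg ((x - b) / k.+1%:R).
  by rewrite sgrM sgrV (gtr0_sg k0) mulr1.
move: ((x - b) / _) l1 l2 => z l1 l2; have [z0|z0|->] := ltgtP z 0.
- rewrite (ltr0_sg z0) ltr0_sg// -[z]opprK sinN oppr_lt0 sin_gt0_pi// oppr_gt0 z0/=.
  by rewrite (lt_trans _ pi1)// ltrNl.
- by rewrite (gtr0_sg z0) gtr0_sg// sin_gt0_pi// z0 (lt_trans l2).
- by rewrite sin0.
Qed.

End SignIteration.

(** Splits a character centred at q into a constant phase and a value of [chi]; dividing the
    frequency by y undoes the factor y inside [chi]. *)
Lemma twist_frac (F : fieldType) (t q r j y : F) : y != 0 ->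
  (t - q) / r * j = - (q * j / r) + t * (j / r / y) * y.
Proof. by move=> y0; rewrite -(mulrA t) divfK//; ring. Qed.

(** * From characters to indicators of boxes in the commutant *)

Section CharacterCommutant.
Context (R : realType) (p : nat) (p_pr : prime p).
Local Notation Qp := (padic p_pr).
Local Notation M := (padic p_pr * R)%type.
Local Notation C := R[i].
Context (mu : {measure set M -> \bar R}) (mu_haar : haar_measure mu).
Variables (alpha0 : R) (y : Qp).
Hypotheses (alpha0_neq0 : alpha0 != 0) (y_neq0 : y != 0).
Local Notation chi := (Defs.chi alpha0 y).
Context (U : unitary mu).
Hypothesis UW : forall z F, U (weyl alpha0 y z F) = weyl alpha0 y z (U F).
Implicit Types (a b : M -> R) (F G : L2 mu).

Lemma chi_bounded xi : bounded_meas (fun t => complex.Re (chi t xi)) /\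
  bounded_meas (fun t => complex.Im (chi t xi)).
Proof.
have [m1 m2] := chi_cmeas alpha0 y xi.
have cb t : `|complex.Re (chi t xi)| <= 1 /\ `|complex.Im (chi t xi)| <= 1.
  have := nsq_chi alpha0 y t xi; rewrite /nsq => H.
  split; rewrite -(@ler_pXn2r _ 2)// ?nnegrE//.
    by rewrite real_normK ?num_real// expr1n -H lerDl sqr_ge0.
  by rewrite real_normK ?num_real// expr1n -H lerDr sqr_ge0.
by split; split=> //; exists 1 => t; have [] := cb t.
Qed.

Lemma weyl_char xi F :
  weyl alpha0 y (0, xi) F = L2class mu (fun t => chi t xi * rep F t).
Proof.
congr L2class; apply/funext => t.
by rewrite /= scaleM_r0 !subr0.
Qed.

(** The two multipliers are half the sum, and the difference over 2i, of the modulations W(0, xi)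
    and W(0, -xi). *)
Lemma commutes_chi xi : commutes U (fun t => complex.Re (chi t xi)) /\
  commutes U (fun t => complex.Im (chi t xi)).
Proof.
have [bRe bIm] := chi_bounded xi.
have cP s F : (fun t => chi t s * rep F t) \in L2pred mu.
  apply: (@L2pred_mul _ _ _ _ _ _ 1) (repP F); first exact: chi_cmeas.
  by move=> t; rewrite nsq_chi.
have i0 : ('i : C)%C != 0 by rewrite eq_complex /= oner_eq0 andbF.
have HRe F : mulop (fun t => complex.Re (chi t xi)) F =
    2^-1 *: (weyl alpha0 y (0, xi) F + weyl alpha0 y (0, - xi) F).
  rewrite !weyl_char -L2classD// -L2classZ ?L2predD//; congr L2class; apply/funext => t.
  rewrite chiNr -mulrDl mulrA; congr (_ * _); case: (chi t xi) => u v.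
  rewrite -[(Complex u v)^*]/(Complex u (- v)).
  apply: (@mulfI _ 2); first by rewrite pnatr_eq0.
  by rewrite mulrA mulfV ?pnatr_eq0// mul1r; apply: complex_eq; rewrite !ReImE /=; ring.
have HIm F : mulop (fun t => complex.Im (chi t xi)) F =
    (2 * 'i%C)^-1 *: (weyl alpha0 y (0, xi) F - weyl alpha0 y (0, - xi) F).
  rewrite !weyl_char -scaleN1r -L2classZ// -L2classD ?L2predZ// -L2classZ ?L2predD ?L2predZ//.
  congr L2class; apply/funext => t.
  rewrite chiNr mulrA -mulrDl mulrA; congr (_ * _); case: (chi t xi) => u v.
  rewrite -[(Complex u v)^*]/(Complex u (- v)).
  have i20 : (2 * 'i%C : C) != 0 by rewrite mulf_neq0// pnatr_eq0.
  apply: (mulfI i20).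
  by rewrite mulrA mulfV// mul1r; apply: complex_eq; rewrite !ReImE /=; ring.
split; split=> // F.
  by rewrite !HRe unitaryZ unitaryD !UW.
by rewrite !HIm unitaryZ unitaryB !UW.
Qed.

Lemma commutes_twist (k : C) xi : commutes U (fun t => complex.Re (k * chi t xi)) /\
  commutes U (fun t => complex.Im (k * chi t xi)).
Proof.
have [cRe cIm] := commutes_chi xi; split; under eq_fun do rewrite ReImE.
  by apply: commutesB; exact: commutesZ.
by apply: commutesD; exact: commutesZ.
Qed.

Lemma padic_expeX (x : Qp) j : padic_expe R (x * j%:R) = padic_expe R x ^+ j.
Proof.
elim: j => [|j IH]; first by rewrite mulr0 padic_expe_int//; exact: padic_int0.
by rewrite -natr1 mulrDr mulr1 padic_expeD IH exprSr.
Qed.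

(** Average w^j over j < p^m, where w is the character at (t.1 - q) / p^n. On the ball w = 1; off it
    w differs from 1 but w^(p^m) = 1 for large m, so the geometric sum vanishes. *)
Lemma commutes_ball q n : commutes U (fun t : M => \1_(padic_ball q n) t.1 : R).
Proof.
pose w (t : M) : C := padic_expe R ((t.1 - q) / p%:R ^+ n).
pose A m (t : M) : R := (p%:R ^+ m)^-1 * \sum_(j < p ^ m) complex.Re (w t ^+ j).
have pm0 m : (p%:R : R) ^+ m != 0 by rewrite expf_neq0// pnatr_eq0 -lt0n prime_gt0.
have pmp m : 0 < (p%:R : R) ^+ m by rewrite exprn_gt0// ltr0n prime_gt0.
have wE j t : w t ^+ j = padic_expe R (- (q * j%:R / p%:R ^+ n)) *
    chi t (j%:R / p%:R ^+ n / y, 0).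
  rewrite -padic_expeX /Defs.chi /= mulr0 mul0r expe0 mulr1 -padic_expeD.
  by congr padic_expe; rewrite (twist_frac _ _ _ _ y_neq0).
have w1 j t : `|complex.Re (w t ^+ j)| <= 1.
  by rewrite -padic_expeX /padic_expe /= ler_norml cos_geN1 cos_le1.
apply: (commutes_lim mu_haar (a_ := A) (K := 1)).
- move=> m; apply: commutesZ; apply: commutes_sum => j.
  by under eq_fun do rewrite wE; case: (commutes_twist (padic_expe R (- (q * j%:R / p%:R ^+ n)))
    (j%:R / p%:R ^+ n / y, 0)).
- move=> m t; rewrite /A normrM normfV (gtr0_norm (pmp m)) ler_pdivrMl// mulr1.
  apply: (le_trans (ler_norm_sum _ _ _)); apply: (@le_trans _ _ (\sum_(j < p ^ m) 1)).
    by apply: ler_sum => j _; exact: w1.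
  by rewrite sumr_const card_ord -natrX.
move=> t; rewrite indicE; case: (boolP (t.1 \in _)); rewrite ?inE ?notin_setE => /padic_ballP H.
  have wt : w t = 1 by exact: padic_expe_int.
  have -> : (fun m => A m t) = cst 1; last exact: cvg_cst.
  apply/funext => m; rewrite /A; under eq_bigr do rewrite wt expr1n /=.
  by rewrite sumr_const card_ord natrX mulVf.
have wt : w t != 1 by apply: contra_not_neq H => /padic_expe_eq1.
have [N iN] := padic_int_mulpX ((t.1 - q) / p%:R ^+ n).
apply: cvg_near_cst; exists N => // m /= Nm.
have S0 : \sum_(j < p ^ m) w t ^+ j = 0.
  have := subrX1 (w t) (p ^ m).
  rewrite -padic_expeX padic_expe_int ?subrr; last first.
    by rewrite mulrC natrX; exact: padic_int_mulpXW iN.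
  by move=> /esym/eqP; rewrite mulf_eq0 subr_eq0 (negbTE wt) => /eqP.
have ReS k (F : 'I_k -> C) : complex.Re (\sum_j F j) = \sum_j complex.Re (F j).
  by elim: k F => [|k IH] F; rewrite ?big_ord0 ?big_ord_recl //= ReD IH.
by rewrite /A -ReS S0 mulr0.
Qed.

Lemma commutes_sign (b : R) : commutes U (fun t : M => Num.sg (t.2 - b)).
Proof.
pose s N (t : M) : R := sin ((t.2 - b) / N.+1%:R).
have s1 N t : `|s N t| <= 1 by rewrite ler_norml sin_geN1 sin_le1.
have cs N : commutes U (s N).
  (* The real phase of [chi] carries the factor 2 pi / alpha0; the frequency alpha0 r compensates it
     and leaves t.2 / (N + 1). *)
  pose r : R := (2 * pi * N.+1%:R)^-1.
  have pi0 : (pi : R) != 0 by rewrite gt_eqF// pi_gt0.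
  have [_ H] := commutes_twist (expe (- b * r)) (0, alpha0 * r).
  have -> : s N = fun t => complex.Im (expe (- b * r) * chi t (0, alpha0 * r)); last exact: H.
  have cE t : chi t (0, alpha0 * r) = expe (t.2 * r).
    transitivity (padic_expe R (t.1 * 0 * y) * expe (t.2 * (alpha0 * r) / alpha0)) => //.
    rewrite mulr0 mul0r padic_expe_int ?mul1r; last exact: padic_int0.
    by congr Defs.expe; field.
  apply/funext => t; rewrite cE -expeD /= /s; congr sin; rewrite /r.
  have : (N.+1%:R : R) != 0 by rewrite pnatr_eq0.
  move: (N.+1%:R : R) (pi : R) pi0 => m P P0 m0.
  by field; rewrite m0 P0.
have csg N : commutes U (fun t => Num.sg (s N t)).
  apply: (commutes_lim mu_haar (a_ := fun k t => iter k (@sign_step R) (s N t)) (K := 1)).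
  - elim=> [|k IH]; first exact: cs.
    under eq_fun do rewrite iterS /sign_step.
    by apply: commutesB; apply: commutesZ => //; do 2?apply: commutesM.
  - by move=> k t; exact: sign_step_bounded.
  - by move=> t; exact: sign_step_cvg.
apply: (commutes_lim mu_haar (a_ := fun N t => Num.sg (s N t)) (K := 1)) => //.
- by move=> N t; rewrite normr_sg lern1 leq_b1.
- by move=> t; exact: sg_sin_cvg.
Qed.

(** (s^2 + s) / 2 sends the signs 1, 0, -1 to 1, 0, 0. *)
Lemma commutes_gt (b : R) : commutes U (fun t : M => (b < t.2)%R%:R : R).
Proof.
have cs := commutes_sign b.
have -> : (fun t : M => (b < t.2)%R%:R : R) =
    fun t => 1 / 2 * (Num.sg (t.2 - b) * Num.sg (t.2 - b) + Num.sg (t.2 - b)).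
  apply/funext => t; rewrite -subr_gt0; move: (t.2 - b) => z.
  have [z0|z0|->] := ltgtP z 0.
  - by rewrite ltr0_sg// mulr0n; ring.
  - by rewrite gtr0_sg// mulr1n; field.
  - by rewrite sgr0 mulr0n; ring.
by apply: commutesZ; apply: commutesD => //; exact: commutesM.
Qed.

Lemma commutes_box q n j : commutes U (\1_(box q n j) : M -> R).
Proof.
have p2 : 0 < 2 ^+ n :> R by rewrite exprn_gt0.
have -> : (\1_(box q n j) : M -> R) = fun t => \1_(padic_ball q n) t.1 *
    ((j%:~R / 2 ^+ n < t.2)%R%:R * (1 - ((j%:~R + 1) / 2 ^+ n < t.2)%R%:R)).
  apply/funext => t; rewrite !indicE.
  have -> : 1 - ((j%:~R + 1) / 2 ^+ n < t.2)%R%:R = (t.2 <= (j%:~R + 1) / 2 ^+ n)%R%:R :> R.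
    by rewrite leNgt; case: (_ < _); rewrite /= ?subrr ?subr0.
  rewrite ltr_pdivrMr// ler_pdivlMr// ![t.2 * _]mulrC -!natrM !mulnb; congr (_ : bool)%:R.
  apply/idP/idP; first by rewrite inE => -[qt ->]; rewrite andbT inE.
  by rewrite inE => /andP[]; rewrite inE.
apply: commutesM; first exact: commutes_ball.
apply: commutesM; first exact: commutes_gt.
by apply: commutesB; [exact: commutes_cst|exact: commutes_gt].
Qed.

End CharacterCommutant.

(** * Indicators of boxes as vectors of L^2 *)

Section BoxVectors.
Context (R : realType) (p : nat) (p_pr : prime p).
Local Notation Qp := (padic p_pr).
Local Notation M := (padic p_pr * R)%type.
Local Notation C := R[i].
Context (mu : {measure set M -> \bar R}) (mu_haar : haar_measure mu).
Implicit Types (E A B : set M) (F G : L2 mu) (q : Qp) (n : nat) (j : int).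
Local Notation boxes := (@boxes R p p_pr).

Definition indC E : M -> C := fun t => (\1_E t)%:C%C.
Definition ind E : L2 mu := L2class mu (indC E).

Lemma boxes_fin E : boxes E -> (mu E < +oo)%E.
Proof.
by move=> [->|[q [n [j ->]]]]; [rewrite measure0 ltry|exact: mu_box_fin].
Qed.

Lemma rint_ind E : boxes E -> rint mu (\1_E : M -> R).
Proof.
move=> bE; have mE := boxes_measurable bE; apply/integrableP; split.
  exact/measurable_EFinP/measurable_indic.
under eq_integral do rewrite gee0_abs ?lee_fin//.
by rewrite integral_indic// setIT boxes_fin.
Qed.

Lemma indC_L2 E : boxes E -> indC E \in L2pred mu.
Proof.
move=> bE; have mE := boxes_measurable bE; apply/L2predP; split.
  by apply: cmeas_real; exact: measurable_indic.
rewrite (_ : (fun t => _) = (\1_E : M -> R)); first exact: rint_ind.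
by apply/funext => t; rewrite nsq_real indicE; case: (_ \in _); rewrite ?expr1n ?expr0n.
Qed.

Lemma bounded_ind E : measurable E -> bounded_meas (\1_E : M -> R).
Proof.
move=> mE; split; first exact: measurable_indic.
by exists 1 => t; rewrite ger0_norm// indicE lern1 leq_b1.
Qed.

Lemma mulop_ind A B : measurable A -> boxes B -> mulop (\1_A) (ind B) = ind (A `&` B).
Proof.
move=> mA bB; rewrite mulop_class ?indC_L2//; last exact: bounded_ind.
by congr L2class; apply/funext => t; rewrite /indC -rmorphM indicI.
Qed.

(** Cutting a component of G by a box of the countable cover makes it integrable, and its integrals
    over boxes become integrals over intersections of two boxes, which are boxes or empty. *)
Lemma ind_total (G : L2 mu) : (forall E, boxes E -> L2dot G (ind E) = 0) -> G = 0.
Proof.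
move=> G0.
have iG E : boxes E -> cint mu (fun t => indC E t * rep G t).
  by move=> bE; apply: cint_mul; [exact: indC_L2|exact: repP].
have E0 E : boxes E -> Cintegral mu (fun t => indC E t * rep G t) = 0.
  move=> bE; rewrite -(G0 E bE) -{2}(L2class_rep G) dot_class ?repP ?indC_L2//.
  apply: eq_Cintegral => t; rewrite mulrC; congr (_ * _).
  by apply: complex_eq; rewrite !ReImE//= oppr0.
have part (u : M -> R) : (forall E, boxes E -> rint mu (fun t => \1_E t * u t)) ->
    (forall E, boxes E -> \int[mu]_t (\1_E t * u t)%:E = 0)%E -> {ae mu, forall t, u t = 0}.
  move=> iu u0; have [g [gB gT _]] := @boxes_cover R p p_pr.
  have H k : {ae mu, forall t, g k t -> u t = 0}.
    have : {ae mu, forall t, (\1_(g k) t * u t)%:E = 0%E}.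
      apply: ae0_of_boxes; first exact: iu.
      move=> q n j; have bB : boxes (box q n j) by right; exists q, n, j.
      rewrite integral_mkcond -[RHS](u0 _ (boxes_setI (gB k) bB)).
      apply: eq_integral => t _; rewrite indicI /patch /= [\1_(box q n j) t]indicE.
      by case: ifPn => tB; [rewrite mulr1|rewrite mulr0 mul0r].
    by apply: filterS => t [+] gt; rewrite indicE mem_set// mul1r.
  have := ae_foralln H; apply: filterS => t Ht.
  have : (\bigcup_k g k) t by rewrite gT.
  by move=> [k _ /Ht].
have HRe : {ae mu, forall t, complex.Re (rep G t) = 0}.
  have i E : boxes E -> rint mu (fun t => \1_E t * complex.Re (rep G t)).
    by move=> bE; have [i _] := iG E bE; move: i; under eq_fun do rewrite ReImE /= mul0r subr0.
  apply: part => // E bE; rewrite -[LHS]fineK; last first.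
    by apply: integrable_fin_num => //; exact: i.
  congr EFin; have /(congr1 (@complex.Re R)) /= := E0 E bE.
  by under eq_Rintegral do rewrite ReImE /= mul0r subr0.
have HIm : {ae mu, forall t, complex.Im (rep G t) = 0}.
  have i E : boxes E -> rint mu (fun t => \1_E t * complex.Im (rep G t)).
    by move=> bE; have [_ i] := iG E bE; move: i; under eq_fun do rewrite ReImE /= mul0r addr0.
  apply: part => // E bE; rewrite -[LHS]fineK; last first.
    by apply: integrable_fin_num => //; exact: i.
  congr EFin; have /(congr1 (@complex.Im R)) /= := E0 E bE.
  by under eq_Rintegral do rewrite ReImE /= mul0r addr0.
apply/L2eqP; have H0 := rep_class (L2pred0 mu); rewrite L2class0 in H0.
by apply: filterS3 HRe HIm H0 => t r i ->; exact: complex_eq.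
Qed.

(** The p sub-balls are indexed by the leading digit, the residue modulo p, of (x - q) / p^n. *)
Lemma ball_split q n (x : Qp) : (\1_(padic_ball q n) x : R) =
  \sum_(i < p) \1_(padic_ball (q + i%:R * p%:R ^+ n) n.+1) x.
Proof.
have ball_i (i : nat) : padic_ball q n (q + i%:R * p%:R ^+ n).
  by apply/padic_ballP; rewrite addrAC subrr add0r mulfK ?padic_pX_neq0//; exact: padic_int_nat.
have [qx|nqx] := pselect (padic_ball q n x); last first.
  rewrite indicE memNset// big1// => i _; rewrite indicE memNset// => ix; apply: nqx.
  exact: (padic_ball_sub (ball_i i) (leqnSn n)).
rewrite indicE mem_set//; have [z xz] := qx.
have z1p : (z 1%N < p)%N by rewrite -residue_mod expn1 ltn_mod prime_gt0.
have inE_i (i : 'I_p) : padic_ball (q + i%:R * p%:R ^+ n) n.+1 x <-> i = z 1%N :> nat.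
  split=> [[u xu]|iz].
    have zE : z = i%:R + p%:R * u.
      apply/eqP; rewrite -(tofrac_eq z) tofracD tofracM !rmorph_nat; apply/eqP.
      apply: (mulfI (padic_pX_neq0 p_pr n)); apply: (addrI q); rewrite -xz xu.
      by rewrite -addrA exprS; congr (_ + _); rewrite mulrDr; congr (_ + _); [rewrite mulrC|rewrite mulrA (mulrC (p%:R ^+ n))].
    rewrite zE /= !residue_natr expn1 modnn mul0n mod0n addn0 modn_mod.
    by rewrite modn_small.
  have [u [uE _]] : exists u : padic_int p_pr, z - i%:R = p%:R ^+ 1 * u /\
      forall m, u m = ((z - i%:R)%R (1 + m) %/ p ^ 1)%N.
    apply: padic_int_div.
    rewrite /= residue_natr iz residue_mod expn1 modnDmr.
    by rewrite addnC subnK ?modnn// ltnW.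
  exists u; rewrite xz -addrA exprSr -mulrA mulrC; congr (_ + _).
  have -> : z = i%:R + p%:R ^+ 1 * u by rewrite -uE addrC subrK.
  by rewrite tofracD tofracM tofracXn !rmorph_nat expr1 mulrDl mulrC [in RHS]mulrC; congr (_ + _); rewrite mulrC.
rewrite (bigD1 (Ordinal z1p))//= indicE mem_set; last exact: ((inE_i (Ordinal z1p)).2 erefl).
rewrite big1 ?addr0// => i iz; rewrite indicE memNset// => /inE_i iE.
by move: iz; rewrite -val_eqE /= iE eqxx.
Qed.

Lemma box_indE q n j (t : M) : (\1_(box q n j) t : R) =
  \1_(padic_ball q n) t.1 * (j%:~R < 2 ^+ n * t.2 <= j%:~R + 1)%R%:R.
Proof.
rewrite !indicE -natrM mulnb; congr (_ : bool)%:R.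
apply/idP/idP; first by rewrite inE => -[qt ->]; rewrite andbT inE.
by rewrite inE => /andP[]; rewrite inE.
Qed.

(** Doubling turns ]j, j+1] into ]2j, 2j+2], cut at 2j + 1; the p-adic ball splits into p
    sub-balls. *)
Lemma box_split q n j (t : M) :
  (\1_(box q n j) t : R) = \sum_(i < p) \sum_(k < 2)
    \1_(box (q + i%:R * p%:R ^+ n) n.+1 (2 * j + k%:Z)) t.
Proof.
rewrite box_indE ball_split mulr_suml; apply: eq_bigr => i _.
rewrite !big_ord_recl big_ord0 !addr0 !box_indE -mulrDr; congr (_ * _).
rewrite intrD intrM exprS -mulrA; move: (2 ^+ n * t.2) => r.
rewrite -[(lift _ _)%:~R]/(1 : R) -[2%:~R]/(2 : R).
have [h1|h1] := ltP (j%:~R : R) r; have [h2|h2] := leP r (j%:~R + 1);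
 have [h3|h3] := ltP ((2 * j%:~R) : R) (2 * r);
 have [h4|h4] := leP (2 * r) (2 * j%:~R + 1);
 have [h5|h5] := ltP (2 * j%:~R + 1) (2 * r);
 have [h6|h6] := leP (2 * r) (2 * j%:~R + 1 + 1);
 rewrite /= ?addr0 ?add0r //; exfalso; lra.
Qed.

End BoxVectors.

Section Schur.
Context (R : realType) (p : nat) (p_pr : prime p).
Local Notation Qp := (padic p_pr).
Local Notation M := (padic p_pr * R)%type.
Local Notation C := R[i].
Context (mu : {measure set M -> \bar R}) (mu_haar : haar_measure mu).
Variables (alpha0 : R) (y : Qp).
Implicit Types (E A B : set M) (F G : L2 mu) (q : Qp) (n : nat) (j : int).
Local Notation boxes := (@boxes R p p_pr).
Local Notation ind := (@ind R p p_pr mu).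

Section BoxForm.
Context (U : unitary mu).
Hypothesis UW : forall z F, U (weyl alpha0 y z F) = weyl alpha0 y z (U F).
Hypothesis Ubox : forall q n j, commutes U (\1_(box q n j) : M -> R).

Definition box_form E : C := L2dot (U (ind E)) (ind E).

Lemma ind0 : ind set0 = 0.
Proof.
rewrite -L2class0; congr L2class; apply/funext => t.
by rewrite /indC indicE memNset.
Qed.

Lemma commutes_boxes E : boxes E -> commutes U (\1_E : M -> R).
Proof.
move=> [->|[q [n [j ->]]]]; last exact: Ubox.
rewrite (_ : \1_set0 = fun=> 0); first exact: commutes_cst.
by apply/funext => t; rewrite indicE memNset.
Qed.

(** The multipliers 1_A and 1_B are idempotent, self-adjoint and commute with U: each can be copied
    to the other side of the product, leaving the intersection on both. *)
Lemma dot_ind A B : boxes A -> boxes B -> L2dot (U (ind A)) (ind B) = box_form (A `&` B).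
Proof.
move=> bA bB; have [ba UA] := commutes_boxes bA; have [bb UB] := commutes_boxes bB.
have mA := boxes_measurable bA; have mB := boxes_measurable bB.
have AA : ind A = mulop (\1_A) (ind A) by rewrite mulop_ind// setIid.
have bD := boxes_setI bA bB.
have DD : ind (A `&` B) = mulop (\1_B) (ind (A `&` B)) by rewrite mulop_ind// setICA setIid.
have E1 : L2dot (U (ind A)) (ind B) = L2dot (U (ind A)) (ind (A `&` B)).
  by rewrite {1}AA UA (mulop_adj _ _ ba) (mulop_ind mu_haar mA bB).
have E2 : L2dot (U (ind A)) (mulop (\1_B) (ind (A `&` B))) =
    L2dot (U (ind (B `&` A))) (ind (A `&` B)).
  by rewrite -(mulop_adj _ _ bb) -UB (mulop_ind mu_haar mB bA).
rewrite E1; apply: (etrans (congr1 (L2dot (U (ind A))) DD)); apply: (etrans E2).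
exact: (congr1 (fun X => L2dot (U (ind X)) (ind (A `&` B))) (setIC B A)).
Qed.

Lemma weyl_shift_ind x E : boxes E ->
  weyl alpha0 y (x, 0) (ind E) = ind ((fun t : M => t - x) @^-1` E).
Proof.
move=> bE; rewrite weyl_class ?indC_L2//; congr L2class; apply/funext => t.
by rewrite /weyl_fun /= chi0r mul1r /indC !indicE.
Qed.

(** A translation W(x, 0) carries one box to the other, is unitary and commutes with U. *)
Lemma box_form_level q q' n j j' : box_form (box q n j) = box_form (box q' n j').
Proof.
pose x : M := (q - q', (j - j')%:~R / 2 ^+ n).
have bx q0 j0 : boxes (box q0 n j0) by right; exists q0, n, j0.
have E : (fun t : M => t - x) @^-1` (box q' n j') = box q n j.
  have H t : box q' n j' (t - x) <-> box q n j t.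
    have -> : q = q' - (- x).1 by rewrite /x /= opprK subrKC.
    have -> : j = j' - - (j - j') by rewrite opprK subrKC.
    by apply: box_shift; rewrite /x /= intrN mulNr.
  by apply/seteqP; split=> t /H.
rewrite -E /box_form -(weyl_shift_ind x (bx q' j')) UW; exact: weyl_dot.
Qed.

(** The second vector is expanded over the 2p sub-boxes. By [dot_ind], pairing with a sub-box gives
    the form of that sub-box, and these values all agree. *)
Lemma box_form_split q n j :
  box_form (box q n j) = (2 * p)%:R * box_form (box q n.+1 j).
Proof.
have bE : boxes (box q n j) by right; exists q, n, j.
pose F (i : nat) (k : nat) : set M := box (q + i%:R * p%:R ^+ n) n.+1 (2 * j + k%:Z).
have bF i k : boxes (F i k) by right; do 3!eexists.
(* The inclusion is read off [box_split]: outside the box a sum of non-negative indicators is 0, so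
   each of them is. *)
have FE (i : 'I_p) (k : 'I_2) : box q n j `&` F i k = F i k.
  apply/setIidr => t Ft; have := box_split q n j t; rewrite indicE.
  case: (boolP (t \in box q n j)); rewrite ?inE// => _ /esym/eqP.
  rewrite psumr_eq0; last by move=> i' _; apply: sumr_ge0.
  move=> /allP/(_ i); rewrite mem_index_enum => /(_ isT)/implyP/(_ isT).
  rewrite psumr_eq0// => /allP/(_ k); rewrite mem_index_enum => /(_ isT)/implyP/(_ isT).
  by rewrite indicE mem_set// oner_eq0.
have dec : ind (box q n j) = \sum_(i < p) \sum_(k < 2) ind (F i k).
  have sumL2 m (f : 'I_m -> M -> C) : (forall i, f i \in L2pred mu) ->
      (fun t => \sum_i f i t) \in L2pred mu /\
      L2class mu (fun t => \sum_i f i t) = \sum_i L2class mu (f i).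
    elim: m f => [|m IH] f fP.
      rewrite big_ord0; under eq_fun do rewrite big_ord0.
      by split; [exact: L2pred0|exact: L2class0].
    have [I1 I2] := IH (fun i => f (lift ord0 i)) (fun i => fP _).
    rewrite big_ord_recl -I2; under eq_fun do rewrite big_ord_recl.
    by split; [exact: L2predD|rewrite L2classD].
  have H i : (fun t => \sum_(k < 2) indC (F i k) t) \in L2pred mu /\
      L2class mu (fun t => \sum_(k < 2) indC (F i k) t) = \sum_(k < 2) ind (F i k).
    by apply: sumL2 => k; exact: indC_L2.
  transitivity (L2class mu (fun t => \sum_(i < p) \sum_(k < 2) indC (F i k) t)).
    congr L2class; apply/funext => t; rewrite /indC box_split rmorph_sum.
    by apply: eq_bigr => i _; rewrite rmorph_sum.
  have [_ ->] := sumL2 p (fun i t => \sum_(k < 2) indC (F i k) t) (fun i => (H i).1).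
  by apply: eq_bigr => i _; rewrite (H i).2.
have Usum m (f : 'I_m -> L2 mu) (G : L2 mu) :
    L2dot G (\sum_i f i) = \sum_i L2dot G (f i).
  elim: m f => [|m IH] f; last by rewrite !big_ord_recl dotDr IH.
  by rewrite !big_ord0 dotC dot0l rmorph0.
rewrite /box_form {2}dec Usum; under eq_bigr do rewrite Usum.
transitivity (\sum_(i < p) \sum_(k < 2) box_form (box q n.+1 j)).
  apply: eq_bigr => i _; apply: eq_bigr => k _.
  by apply: (etrans (dot_ind bE (bF i k))); rewrite FE; exact: box_form_level.
by rewrite !sumr_const !card_ord -mulrnA mulr_natl.
Qed.

End BoxForm.

(* Both [box_form U] and [box_form 1] are multiplied by (2p)^-1 when the level of
   the box increases by one, so they are proportional. *)
Lemma schur (U : unitary mu) : 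
  (forall z F, U (weyl alpha0 y z F) = weyl alpha0 y z (U F)) ->
  (forall q n j, commutes U (\1_(box q n j) : M -> R)) ->
  exists2 c : C, `|c| = 1 & forall F, U F = c *: F.
Proof.
move=> UW Ubox; set I1 := unitary1 mu.
have IW z F : I1 (weyl alpha0 y z F) = weyl alpha0 y z (I1 F) by [].
have Ibox q n j : commutes I1 (\1_(box q n j) : M -> R).
  by split=> [|//]; apply: bounded_ind; exact: measurable_box.
pose m n := box_form I1 (box 0 n 0); pose nu n := box_form U (box 0 n 0).
have p0 : ((2 * p)%:R : C) != 0 by rewrite pnatr_eq0 muln_eq0 /= -lt0n prime_gt0.
have mS n : m n = (2 * p)%:R * m n.+1 by exact: box_form_split.
have nuS n : nu n = (2 * p)%:R * nu n.+1 by exact: box_form_split.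
have b0 : boxes (box 0 0 0) by right; exists 0, 0%N, 0.
have m0 : m 0%N != 0.
  rewrite /m /box_form /= dot_class ?indC_L2//; apply/eqP => /(congr1 (@complex.Re R)) /=.
  rewrite /Rintegral (_ : (fun x => _) = fun x => (\1_(box 0 0 0) x)%:E); last first.
    by apply/funext => t; rewrite mul0r subr0 indicE -natrM mulnb andbb.
  rewrite integral_indic//; last exact: measurable_box.
  rewrite setIT => m0; have := mu_box_gt0 mu_haar 0 0 0.
  rewrite -[X in (0 < X)%E]fineK ?m0 ?ltxx// ge0_fin_numE//; exact: mu_box_fin.
pose c := nu 0%N / m 0%N.
have nuE n : nu n = c * m n.
  elim: n => [|n IH]; first by rewrite /c divfK.
  by apply: (mulfI p0); rewrite -nuS IH mS; ring.
have formE E : boxes E -> box_form U E = c * box_form I1 E.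
  move=> [->|[q [n [j ->]]]].
    by rewrite /box_form ind0 !unitary0 !dot0l mulr0.
  rewrite (box_form_level UW q 0 n j 0) (box_form_level IW q 0 n j 0); exact: nuE.
have UE A : boxes A -> U (ind A) = c *: ind A.
  move=> bA; apply/eqP; rewrite -subr_eq0; apply/eqP; apply: (ind_total mu_haar) => B bB.
  rewrite dotBl dotZl (dot_ind Ubox)// formE; last exact: boxes_setI.
  by rewrite -(dot_ind Ibox)// subrr.
(* U preserves the nonzero norm of one box vector. *)
have c1 : c * c^* = 1.
  apply: (mulIf m0); rewrite mul1r -[in RHS]/(L2dot (ind (box 0 0 0)) (ind (box 0 0 0))).
  by rewrite -[RHS](unitary_dot U) UE// dotZl dotZr mulrA.
have nc : `|c| = 1.
  by apply/eqP; rewrite -(@eqrXn2 _ 2)// ?normr_ge0// expr1n normCK c1.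
exists c => // F; apply/eqP; rewrite -subr_eq0; apply/eqP; apply: (ind_total mu_haar) => B bB.
have -> : L2dot (U F - c *: F) (ind B) = L2dot (U F) (ind B) - c * L2dot F (ind B).
  by rewrite dotBl dotZl.
(* Hence <U F, 1_B> = c <U F, U 1_B> = c <F, 1_B>: unitarity extends U = c from boxes to every F,
   with no approximation of F. *)
have {1}-> : ind B = c^* *: U (ind B) by rewrite UE// scalerA mulrC c1 scale1r.
by rewrite dotZr conjCK unitary_dot subrr.
Qed.

End Schur.

(** * Generation of SL_2(Z[1/p]) *)

Section Words.
Context (G : groupType) (g : generator -> G).

Lemma word_eval_cat (w w' : word) :
  word_eval g (w ++ w') = (word_eval g w * word_eval g w')%g.
Proof. by rewrite /word_eval big_cat. Qed.

Definition word_inv (w : word) : word := rev [seq (l.1, ~~ l.2) | l <- w].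

Lemma word_eval1 l b : word_eval g [:: (l, b)] = if b then (g l)^-1%g else g l.
Proof. by rewrite /word_eval big_seq1. Qed.

Lemma word_eval_inv (w : word) : word_eval g (word_inv w) = (word_eval g w)^-1%g.
Proof.
elim: w => [|[l b] w IH]; first by rewrite /word_eval !big_nil invg1.
rewrite -cat1s word_eval_cat word_eval1 invgM -IH /word_inv /= rev_cons -cats1.
by rewrite word_eval_cat word_eval1; case: b; rewrite /= ?invgK.
Qed.

End Words.

Section Generation.
Context (p : nat) (p_pr : prime p).
Local Notation eval := (word_eval (gen_sl2 p_pr)).
Implicit Types (X Y : 'M[rat]_2) (x : rat).

Definition generated X := exists w : word, eval w = X :> 'M[rat]_2.

Lemma generatedM X Y : generated X -> generated Y -> generated (X *m Y).
Proof. by move=> [w <-] [w' <-]; exists (w ++ w'); rewrite word_eval_cat. Qed.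

Lemma generated1 : generated 1%:M.
Proof. by exists [::]; rewrite /word_eval big_nil. Qed.

Lemma generatedV X Y : generated X -> X *m Y = 1%:M -> generated Y.
Proof.
move=> [w wX] XY; exists (word_inv w); rewrite word_eval_inv.
have : sl2_mx ((eval w)^-1 * eval w)%g = 1%:M by rewrite mulVg.
rewrite /= wX => VX; rewrite -[LHS]mulmx1 -XY mulmxA.
by have -> : \adj X *m X = 1%:M; rewrite ?mul1mx.
Qed.

Lemma mx22M (a b c d a' b' c' d' : rat) : mx22 a b c d *m mx22 a' b' c' d' =
  mx22 (a * a' + b * c') (a * b' + b * d') (c * a' + d * c') (c * b' + d * d').
Proof.
apply/matrixP => i j; rewrite !mxE !big_ord_recl big_ord0 addr0 !mxE /=.
by case: (i == 0); case: (j == 0).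
Qed.

Lemma mx22_1 : mx22 1 0 0 1 = 1%:M :> 'M[rat]_2.
Proof.
apply/matrixP => i j; rewrite !mxE.
by case: i => [[|[|//]] ?]; case: j => [[|[|//]] ?].
Qed.

Lemma mx22E X : X = mx22 (X 0 0) (X 0 1) (X 1 0) (X 1 1).
Proof.
apply/matrixP => i j; rewrite !mxE.
by case: i => [[|[|//]] ?]; case: j => [[|[|//]] ?]; rewrite /=;
  congr (X _ _); apply: val_inj.
Qed.

Lemma generated_gen l : generated (gen_mx p l).
Proof. by exists [:: (l, false)]; rewrite word_eval1. Qed.

Lemma generated_low_nat (m : nat) : generated (mx22 1 0 m%:R 1).
Proof.
elim: m => [|m IH]; first by rewrite mx22_1; exact: generated1.
have := generatedM IH (generated_gen genL); rewrite /= mx22M.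
by rewrite !(mul0r, mulr0, mulr1, add0r, addr0) natr1.
Qed.

Lemma generated_low_int (m : int) : generated (mx22 1 0 m%:~R 1).
Proof.
case: m => m; first exact: generated_low_nat.
apply: (generatedV (generated_low_nat m.+1)).
by rewrite mx22M -mx22_1 NegzE mulrNz; congr mx22; rewrite ?mul0r ?mulr0 ?mulr1 ?mul1r ?addr0 ?add0r ?subrr.
Qed.

Lemma generated_Jinv : generated (mx22 0 (-1) 1 0).
Proof.
by apply: (generatedV (generated_gen genJ)); rewrite /= mx22M -mx22_1; congr mx22; ring.
Qed.

(** Conjugation by J exchanges lower and upper unipotents, up to sign. *)
Lemma generated_up x : generated (mx22 1 0 x 1) -> generated (mx22 1 (- x) 0 1).
Proof.
move=> gx; have -> : mx22 1 (- x) 0 1 = gen_mx p genJ *m mx22 1 0 x 1 *m mx22 0 (-1) 1 0.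
  by rewrite /= !mx22M; congr mx22; ring.
apply: generatedM generated_Jinv; apply: generatedM gx; exact: generated_gen.
Qed.

Lemma generated_up_int (m : int) : generated (mx22 1 m%:~R 0 1).
Proof. by rewrite -[m]opprK mulrNz; apply/generated_up/generated_low_int. Qed.

Lemma generated_diag (k : nat) : generated (mx22 (p%:R ^+ k) 0 0 (p%:R ^- k)) /\
  generated (mx22 (p%:R ^- k) 0 0 (p%:R ^+ k)).
Proof.
have H : generated (mx22 (p%:R ^+ k) 0 0 (p%:R ^- k)).
  elim: k => [|k IH]; first by rewrite !expr0 invr1 mx22_1; exact: generated1.
  have -> : mx22 (p%:R ^+ k.+1) 0 0 (p%:R ^- k.+1) =
      mx22 (p%:R ^+ k) 0 0 (p%:R ^- k) *m gen_mx p genD :> 'M[rat]_2.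
    by rewrite /= mx22M !(mulr0, mul0r, addr0, add0r) exprSr invfM [_^-1 * _^-1]mulrC.
  apply: generatedM IH _; exact: generated_gen.
split=> //; apply: (generatedV H); rewrite mx22M -mx22_1.
by rewrite !(mulr0, mul0r, addr0, add0r) mulfV ?mulVf// p_rat_neq0.
Qed.

(** Conjugation by diag(p^-k, p^k) multiplies the upper entry by p^(-2k), hence the start from the
    integer m p^k. *)
Lemma generated_up_Zinv x : x \in Zinv p -> generated (mx22 1 x 0 1).
Proof.
move=> /(Zinv_eq p_pr)[m [k ->]]; have [d1 d2] := generated_diag k.
have pk := p_rat_neq0 p_pr k.
have -> : mx22 1 (m%:~R / p%:R ^+ k) 0 1 = mx22 (p%:R ^- k) 0 0 (p%:R ^+ k) *m
    mx22 1 (m * (p%:Z ^+ k))%:~R 0 1 *m mx22 (p%:R ^+ k) 0 0 (p%:R ^- k) :> 'M[rat]_2.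
  rewrite !mx22M intrM rmorphXn /=; move: (p%:R ^+ k : rat) pk => P P0.
  by congr mx22; field.
by apply: generatedM d1; apply: generatedM d2 _; exact: generated_up_int.
Qed.

Lemma generatedNI : generated (mx22 (-1) 0 0 (-1)).
Proof.
have -> : mx22 (-1) 0 0 (-1) = gen_mx p genJ *m gen_mx p genJ.
  by rewrite /= mx22M; congr mx22; ring.
by apply: generatedM; exact: generated_gen.
Qed.

(* The units of Z[1/p] are the [+-p^k]. *)
Lemma generated_diag_Zinv u v : u \in Zinv p -> v \in Zinv p -> u * v = 1 ->
  generated (mx22 u 0 0 v).
Proof.
move=> /(Zinv_eq p_pr)[m [i uE]] /(Zinv_eq p_pr)[n [j vE]] uv.
have pi0 := p_rat_neq0 p_pr i; have pj0 := p_rat_neq0 p_pr j.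
have mn : m * n = (p ^ (i + j))%:Z.
  apply: (@intr_inj rat); rewrite intrM -pmulrn natrX exprD.
  apply: (mulIf (invr_neq0 (mulf_neq0 pi0 pj0))); rewrite mulfV ?mulf_neq0//.
  by rewrite invfM mulrACA -uE -vE.
(* The numerator m divides a power of the prime p, so it is a power of p up to sign. *)
have [k km] : exists k, `|m|%N = (p ^ k)%N.
  have : (`|m|%N %| p ^ (i + j))%N.
    by apply/dvdnP; exists `|n|%N; rewrite mulnC -abszM mn.
  by move=> /(dvdn_pfactor _ _ p_pr)[k _ kE]; exists k.
have u0 : u != 0 by apply/eqP => u0; move/eqP: uv; rewrite u0 mul0r eq_sym oner_eq0.
have vu : v = u^-1 by apply: (mulfI u0); rewrite uv mulfV.
have [d1 _] := generated_diag k; have [_ d2] := generated_diag i.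
have pk0 := p_rat_neq0 p_pr k.
have gp : generated (mx22 (p%:R ^+ k / p%:R ^+ i) 0 0 (p%:R ^+ i / p%:R ^+ k)).
  have -> : mx22 (p%:R ^+ k / p%:R ^+ i) 0 0 (p%:R ^+ i / p%:R ^+ k) =
      mx22 (p%:R ^+ k) 0 0 (p%:R ^- k) *m mx22 (p%:R ^- i) 0 0 (p%:R ^+ i) :> 'M[rat]_2.
    by rewrite mx22M !(mulr0, mul0r, addr0, add0r) [p%:R ^- k * _]mulrC.
  exact: generatedM.
have mE : m%:~R = p%:R ^+ k :> rat \/ m%:~R = - p%:R ^+ k :> rat.
  case: m km {uE mn} => m /= km; first by left; rewrite -pmulrn km natrX.
  by right; rewrite NegzE mulrNz -pmulrn km natrX.
rewrite vu uE; case: mE => ->; rewrite ?mulNr ?invrN invf_div//.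
have -> : mx22 (- (p%:R ^+ k / p%:R ^+ i)) 0 0 (- (p%:R ^+ i / p%:R ^+ k)) =
    mx22 (-1) 0 0 (-1) *m mx22 (p%:R ^+ k / p%:R ^+ i) 0 0 (p%:R ^+ i / p%:R ^+ k) :> 'M[rat]_2.
  by rewrite mx22M !(mulr0, mul0r, addr0, add0r, mulN1r).
by apply: generatedM gp; exact: generatedNI.
Qed.

Lemma generated_triangular (a b d : rat) : a \in Zinv p -> b \in Zinv p -> d \in Zinv p ->
  a * d = 1 -> generated (mx22 a b 0 d).
Proof.
move=> aZ bZ dZ ad.
have -> : mx22 a b 0 d = mx22 a 0 0 d *m mx22 1 (b * d) 0 1.
  by rewrite mx22M !(mulr0, mul0r, addr0, add0r, mulr1) mulrCA ad mulr1.
apply: generatedM; first exact: generated_diag_Zinv.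
by apply: generated_up_Zinv; rewrite rpredM.
Qed.

Lemma generated_cancel X Y : generated X -> X \in unitmx -> generated (X *m Y) -> generated Y.
Proof.
move=> gX uX gXY; rewrite -(mulKmx uX Y); apply: generatedM gXY.
by apply: (generatedV gX); rewrite mulmxV.
Qed.

Lemma unit_mx22 (a b c d : rat) : a * d - b * c = 1 -> mx22 a b c d \in unitmx.
Proof. by move=> e; rewrite unitmxE det_mx22 e unitr1. Qed.

(* Euclid's algorithm on the numerators of the first column. *)
Lemma generated_SL2 (m : nat) (a c : int) (b d : rat) : b \in Zinv p -> d \in Zinv p ->
  a%:~R / p%:R ^+ m * d - b * (c%:~R / p%:R ^+ m) = 1 ->
  generated (mx22 (a%:~R / p%:R ^+ m) b (c%:~R / p%:R ^+ m) d).
Proof.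
have [N] := ubnP (`|a| + `|c|)%N.
elim: N => // N IH in a c b d *; rewrite ltnS => acN bZ dZ.
have ZP (i : int) : i%:~R / p%:R ^+ m \in Zinv p by exact: Zinv_div_pX.
have [->|c0] := eqVneq c 0.
  by rewrite mul0r mulr0 subr0 => ad; exact: generated_triangular.
have [->|a0] := eqVneq a 0.
  rewrite !mul0r sub0r => bc.
  apply: (@generated_cancel (mx22 0 1 (-1) 0)); first exact: (generated_gen genJ).
    by apply: unit_mx22; ring.
  rewrite mx22M !(mul0r, mul1r, add0r, mulN1r, addr0, oppr0).
  by apply: generated_triangular; rewrite ?rpredN// mulrN mulrC.
(* The sign s makes the subtraction lower the larger absolute value by exactly the smaller, nonzero
   one, so |a| + |c| decreases; the denominator p^m stays fixed. *)
move=> det; pose s : int := sgz a * sgz c.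
have abss (x z : int) : x != 0 -> z != 0 -> (`|z| <= `|x|)%N ->
    (`|(x - sgz x * sgz z * z)%R| + `|z| <= `|x|)%N.
  move=> x0 z0 zx.
  have -> : x - sgz x * sgz z * z = sgz x * (`|x|%N%:Z - `|z|%N%:Z).
    rewrite -mulrA mulrBr; congr (_ - _).
      by rewrite -{1}(intEsg x).
    by congr (_ * _); rewrite -abszEsg.
  rewrite abszM absz_sg x0 mul1n subzn//= subnK//.
have [ca|/ltnW ac] := leqP `|c| `|a|.
  apply: (@generated_cancel (mx22 1 (- s)%:~R 0 1)); first exact: generated_up_int.
    by apply: unit_mx22; ring.
  rewrite mx22M !(mul0r, mul1r, add0r) mulrA -mulrDl -intrM -intrD mulNr.
  apply: IH => //.
  - apply: leq_trans acN; apply: (leq_ltn_trans (abss a c a0 c0 ca)).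
    by rewrite -[X in (X < _)%N]addn0 ltn_add2l absz_gt0.
  - by rewrite rpredD// rpredM// rpred_int.
  - by rewrite -[RHS]det !(intrD, intrN, intrM); ring.
apply: (@generated_cancel (mx22 1 0 (- s)%:~R 1)); first exact: generated_low_int.
  by apply: unit_mx22; ring.
rewrite mx22M !(mul0r, mul1r, addr0) mulrA -mulrDl -intrM -intrD mulNr.
rewrite [- (s * a) + c]addrC /s [sgz a * _]mulrC; apply: IH => //.
- apply: leq_trans acN; rewrite addnC; apply: (leq_ltn_trans (abss c a c0 a0 ac)).
  by rewrite -[X in (X < _)%N]add0n ltn_add2r absz_gt0.
- by rewrite rpredD// rpredM// rpred_int.
- by rewrite -[RHS]det /s !(intrD, intrN, intrM); ring.
Qed.

Lemma word_eval_surj (A : SL2 p) : exists w : word, eval w = A.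
Proof.
have /andP[/mxOverP AZ /eqP] := sl2P A; rewrite [sl2_mx A]mx22E det_mx22 => detA.
have [a [i aE]] := Zinv_eq p_pr (AZ 0 0); have [c [j cE]] := Zinv_eq p_pr (AZ 1 0).
have pi0 := p_rat_neq0 p_pr i; have pj0 := p_rat_neq0 p_pr j.
(* The first column is brought over one denominator, as Euclid's algorithm on integers requires. *)
have aE' : A 0 0 = (a * p%:Z ^+ j)%:~R / p%:R ^+ (i + j).
  by rewrite aE intrM rmorphXn /= exprD; field; rewrite pi0 pj0.
have cE' : A 1 0 = (c * p%:Z ^+ i)%:~R / p%:R ^+ (i + j).
  by rewrite cE intrM rmorphXn /= exprD; field; rewrite pi0 pj0.
have [w wE] : generated A.
  rewrite [sl2_mx A]mx22E aE' cE'; apply: generated_SL2; rewrite ?AZ//.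
  by rewrite -aE' -cE'.
by exists w; exact: val_inj.
Qed.

End Generation.

(** * Words of generators acting on Weyl operators *)

Section Representation.
Context (R : realType) (p : nat) (p_pr : prime p).
Local Notation Qp := (padic p_pr).
Local Notation M := (padic p_pr * R)%type.
Variables (alpha0 : R) (y : Qp).
Hypotheses (alpha0_neq0 : alpha0 != 0) (y_neq0 : y != 0).
Context (mu : {measure set M -> \bar R}) (mu_haar : haar_measure mu).
Context (S : generator -> unitary mu).
Hypothesis S_gen : forall g, gen_unitary alpha0 y g (S g).
Local Notation eval := (word_eval (gen_sl2 p_pr)).
Implicit Types (z : M * M) (F : L2 mu) (w : word).

Lemma sl2_actM (A B : 'M[rat]_2) z : sl2_act (A *m B) z = sl2_act A (sl2_act B z).
Proof.
have E (a b b' c d d' : rat) (x x' : M) :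
    scaleM (a * b + c * d) x + scaleM (a * b' + c * d') x' =
    scaleM a (scaleM b x + scaleM b' x') + scaleM c (scaleM d x + scaleM d' x').
  rewrite (scaleM_Dl (a * b)) (scaleM_Dl (a * b')) (scaleM_Dr a) (scaleM_Dr c) !scaleM_M.
  exact: addrACA.
rewrite /sl2_act !mxE !big_ord_recl !big_ord0 !addr0 /=.
have -> : lift ord0 ord0 = 1 :> 'I_2 by apply: val_inj.
congr pair; exact: E.
Qed.

Lemma sl2_act1 z : sl2_act 1%:M z = z.
Proof.
by rewrite /sl2_act !mxE /= !scaleM_0 !scaleM_1 add0r addr0; case: z.
Qed.

Lemma word_weyl w z F : word_eval S w (weyl alpha0 y z F) =
  weyl alpha0 y (sl2_act (eval w) z) (word_eval S w F).
Proof.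
elim: w z F => [|[g b] w IH] z F; first by rewrite /word_eval !big_nil /= sl2_act1.
rewrite -cat1s !word_eval_cat !word_eval1.
have mulE (U V : unitary mu) (G : L2 mu) : (U * V)%g G = U (V G) by [].
rewrite !mulE IH [in RHS](sl2_actM (sl2_mx _)); move: (sl2_act (eval w) z) (word_eval S w F) => z' F'.
case: b; last exact: (gen_weyl mu_haar).
(* An inverse letter reduces to the letter itself: S_g is applied to both sides, and g g^-1 = 1
   cancels in the action on M x M. *)
have [_ Sb _] := unitaryP (S g); apply: (bij_inj Sb).
rewrite [LHS](unitary_invK (S g)) (gen_weyl mu_haar _ _ (S_gen g)) [S g _ in RHS](unitary_invK (S g)).
rewrite -sl2_actM.
have -> : gen_mx p g *m sl2_mx ((gen_sl2 p_pr g)^-1)%g = 1%:M.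
  by have := congr1 (@sl2_mx p) (mulgV (gen_sl2 p_pr g)).
by rewrite sl2_act1.
Qed.

Lemma word_phase w w' : eval w = eval w' ->
  PUclass (word_eval S w) = PUclass (word_eval S w').
Proof.
move=> ww'; set U := ((word_eval S w')^-1 * word_eval S w)%g.
(* Writing U as a word of value 1 lets [word_weyl] give its commutation with all Weyl operators. *)
have UE : U = word_eval S (word_inv w' ++ w) by rewrite word_eval_cat word_eval_inv.
have UW z F : U (weyl alpha0 y z F) = weyl alpha0 y z (U F).
  rewrite UE word_weyl word_eval_cat word_eval_inv ww' mulVg.
  by rewrite [sl2_act _ _]sl2_act1.
have [c c1 UF] := schur mu_haar UW (commutes_box mu_haar alpha0_neq0 y_neq0 UW).
apply/PUclassP/asboolP; exists c => // F.
rewrite -unitaryZ -UF; exact: esym (unitary_invK (word_eval S w') (word_eval S w F)).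
Qed.

End Representation.

Theorem theorem5p7 (R : realType) (p : nat) (p_pr : prime p) (p_odd : odd p)
    (alpha0 : R) (alpha0_neq0 : alpha0 != 0)
    (y : padic p_pr) (y_neq0 : y != 0)
    (mu : {measure set (padic p_pr * R)%type -> \bar R})
    (mu_haar : haar_measure mu) (mu_dual : self_dual alpha0 y mu)
    (S : generator -> unitary mu)
    (S_gen : forall g : generator, gen_unitary alpha0 y g (S g)) :
  [/\ forall A : SL2 p, exists w : word, word_eval (gen_sl2 p_pr) w = A,
      forall w w' : word,
        word_eval (gen_sl2 p_pr) w = word_eval (gen_sl2 p_pr) w' ->
        PUclass (word_eval S w) = PUclass (word_eval S w'),
      forall word_of : SL2 p -> word,
        (forall A : SL2 p, word_eval (gen_sl2 p_pr) (word_of A) = A) ->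
        {morph (fun A : SL2 p => PUclass (word_eval S (word_of A))) :
           A B / (A * B)%g} &
      forall (A : SL2 p) (w : word), word_eval (gen_sl2 p_pr) w = A ->
        forall z : (padic p_pr * R) * (padic p_pr * R),
        word_eval S w \o weyl alpha0 y z \o (word_eval S w)^-1%g =
        weyl alpha0 y (sl2_act A z)].
Proof.
have phase := word_phase alpha0_neq0 y_neq0 mu_haar S_gen.
split.
- exact: word_eval_surj.
- exact: phase.
- move=> word_of wE A B /=.
  (* The word chosen for A B has the same value as the concatenation of those chosen for A and B. *)
  rewrite (phase _ (word_of A ++ word_of B)); last by rewrite word_eval_cat !wE.
  by rewrite word_eval_cat -PUclassM.
- move=> A w <- z; apply/funext => F /=.
  rewrite (word_weyl mu_haar S_gen); congr (weyl _ _ _ _).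
  exact: (unitary_invK (word_eval S w) F).
Qed.
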